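(* Let $E_1=(1,i,0,0,0)$, $E_2=(0,0,1,i,0)$, $e_5=(0,0,0,0,1)$, and let $x$ be the minimal surface in $\mathbb{R}^5$ $$x=x_0+2\,\mathrm{Re}\Big[\frac{1+32z^3}{2(z^3-1)^2z^2}E_1+\frac{1-2z^3}{12(z^3-1)^2}\bar E_1+\frac{8z-5z^4}{(z^3-1)^2}E_2-\frac1{6(z^3-1)^2}\bar E_2-\frac{\sqrt{30}\,z^2}{2(z^3-1)^2}e_5\Big],$$ $x_0\in\mathbb{R}^5$ a constant, defined on $\mathbb{C}\cup\{\infty\}$ minus $0$ and the three cube roots of unity. There exists an adjoint surface $\hat x$ of $x$ such that, by conformally embedding $\mathbb{R}^5$ into $S^5$, $\hat x$ becomes a global immersion from $S^2$ into $S^5$. Moreover, $\hat x$ is neither super-conformal nor S-Willmore.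
   Context: $S^2=\mathbb{C}\cup\{\infty\}$; $\mathbb{R}^5\subset S^5=\mathbb{R}^5\cup\{\infty\}$ by inverse stereographic projection. ($x$ is a super-conformal minimal surface with a branch point at $z=\infty$; the adjoint relation is understood where $x$ is immersed, and the assertion is that $\hat x$ extends to all of $S^2$ as an immersion.) Let $\mathbb{R}^{n+2}_1$ be $\mathbb{R}^{n+2}$ with $\langle Y,Y\rangle=\sum_{i=1}^{n+1}Y_i^2-Y_{n+2}^2$, extended complex bilinearly, and identify $S^n$ with the projectivized light cone by $y\leftrightarrow[(y,1)]$. For a conformal immersion $y:M\to S^n$ with local coordinate $z$, the canonical lift $Y$ is the (forward) light-cone-valued lift, $y=[Y]$, with $\langle Y_z,Y_{\bar z}\rangle=\frac12$. Let $V=\mathrm{span}\{Y,\mathrm{Re}\,Y_z,\mathrm{Im}\,Y_z,Y_{z\bar z}\}$, $V^\perp$ its orthogonal complement with normal connection $D$, and $N\in V$ the unique section with $\langle N,N\rangle=0$, $\langle N,Y\rangle=-1$, $\langle N,Y_z\rangle=0$. The equation $Y_{zz}=-\frac s2Y+\kappa$ defines the complex function $s$ and $\kappa\in\Gamma(V^\perp\otimes\mathbb{C})$. Umbilic points are the zeros of $\kappa$. $y$ is Willmore if $D_{\bar z}D_{\bar z}\kappa+\frac{\bar s}2\kappa=0$; super-conformal if $\langle\kappa,\kappa\rangle\equiv0$; S-Willmore if away from umbilic points there is locally a complex function $\mu$ with $D_{\bar z}\kappa+\frac{\bar\mu}2\kappa=0$. An adjoint surface (adjoint transform) of a Willmore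 immersion $y:M\to S^n$ is a smooth map $\hat y:M\to S^n$ such that on an open dense subset, with respect to local coordinates, $\hat y=[\hat Y]$ with $\hat Y=\frac12|\mu|^2Y+\bar\mu Y_z+\mu Y_{\bar z}+N$ for a smooth local complex function $\mu$ satisfying $\mu_z-\frac12\mu^2-s=0$ and $\langle\eta,\eta\rangle=0$, where $\eta=D_{\bar z}\kappa+\frac{\bar\mu}2\kappa$. An adjoint surface of a minimal surface $x$ means one of its image in $S^n$. *)

(* Defs.v *)
From HB Require Import structures.
From mathcomp Require Import all_boot all_order all_algebra.
From mathcomp Require Import complex.
From mathcomp Require Import all_classical all_reals all_analysis.
Set Implicit Arguments.
Unset Strict Implicit.
Unset Printing Implicit Defensive.
Import Order.TTheory GRing.Theory Num.Theory.
Import numFieldNormedType.Exports.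
Local Open Scope classical_set_scope.
Local Open Scope complex_scope.
Local Open Scope ring_scope.

(* The complex plane as a real normed space; [zcoord p] is the point z = u + iv. *)
Notation plane R := (R * R)%type.

Definition zcoord (R : realType) (p : plane R) : R[i] := p.1 +i* p.2.
Definition plane_of (R : realType) (z : R[i]) : plane R := (complex.Re z, complex.Im z).

Definition e_u (R : realType) : plane R := (1, 0).
Definition e_v (R : realType) : plane R := (0, 1).

(* C^k on an open set U. *)
Fixpoint Ck (R : realType) (k : nat) (U : set (plane R)) (f : plane R -> R) : Prop :=
  if k is k'.+1 then
    [/\ forall p, U p -> derivable f p (e_u R),
        forall p, U p -> derivable f p (e_v R),
        Ck k' U ('D_(e_u R) f) & Ck k' U ('D_(e_v R) f)]
  else forall p, U p -> {for p, continuous f}.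

Definition smooth (R : realType) (U : set (plane R)) (f : plane R -> R) : Prop :=
  forall k, Ck k U f.

Definition smoothC (R : realType) (U : set (plane R)) (f : plane R -> R[i]) : Prop :=
  smooth U (fun p => complex.Re (f p)) /\ smooth U (fun p => complex.Im (f p)).

Definition smooth_row (R : realType) (m : nat) (U : set (plane R))
  (F : plane R -> 'rV[R]_m) : Prop := forall j, smooth U (fun p => F p 0 j).

Definition partial (R : realType) (v : plane R) (f : plane R -> R[i]) (p : plane R) : R[i] :=
  'D_v (fun q => complex.Re (f q)) p +i* 'D_v (fun q => complex.Im (f q)) p.

Definition dz (R : realType) (f : plane R -> R[i]) (p : plane R) : R[i] :=
  (partial (e_u R) f p - 'i * partial (e_v R) f p) / 2%:R.

Definition dzb (R : realType) (f : plane R -> R[i]) (p : plane R) : R[i] :=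
  (partial (e_u R) f p + 'i * partial (e_v R) f p) / 2%:R.

Definition vdz (R : realType) (m : nat) (F : plane R -> 'rV[R[i]]_m) (p : plane R) :
  'rV[R[i]]_m := \row_j dz (fun q => F q 0 j) p.

Definition vdzb (R : realType) (m : nat) (F : plane R -> 'rV[R[i]]_m) (p : plane R) :
  'rV[R[i]]_m := \row_j dzb (fun q => F q 0 j) p.

Definition toC (R : realType) (m : nat) (v : 'rV[R]_m) : 'rV[R[i]]_m :=
  map_mx (fun a : R => a%:C) v.
Definition reC (R : realType) (m : nat) (v : 'rV[R[i]]_m) : 'rV[R]_m :=
  map_mx (fun a : R[i] => complex.Re a) v.
Definition imC (R : realType) (m : nat) (v : 'rV[R[i]]_m) : 'rV[R]_m :=
  map_mx (fun a : R[i] => complex.Im a) v.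

Definition dot (K : comNzRingType) (m : nat) (a b : 'rV[K]_m) : K := (a *m b^T) 0 0.

(* R^{n+2}_1 is encoded with n + 1 spacelike coordinates followed by the timelike one;
   over R[i] the form is bilinear, not Hermitian. *)
Definition minkowski (K : comNzRingType) (n : nat) : 'M[K]_(n + 1 + 1) :=
  block_mx 1%:M 0 0 (- 1%:M).

Definition lor (K : comNzRingType) (n : nat) (a b : 'rV[K]_(n + 1 + 1)) : K :=
  (a *m minkowski K n *m b^T) 0 0.

Definition cone (R : realType) (n : nat) (y : 'rV[R]_(n + 1)) : 'rV[R]_(n + 1 + 1) :=
  row_mx y 1%:M.

Definition immersed_at (R : realType) (m : nat) (y : plane R -> 'rV[R]_m) (p : plane R) : Prop :=
  row_free (col_mx (\row_j 'D_(e_u R) (fun q => y q 0 j) p)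
                   (\row_j 'D_(e_v R) (fun q => y q 0 j) p)).

Section Surfaces.
Context (R : realType) (n : nat).
Implicit Types (U : set (plane R)) (y : plane R -> 'rV[R]_(n + 1)).
Implicit Types (Y N : plane R -> 'rV[R]_(n + 1 + 1)).
Implicit Types (kappa : plane R -> 'rV[R[i]]_(n + 1 + 1)) (s mu : plane R -> R[i]).

Local Notation cx Y := (fun p => toC (Y p)).

Definition conformal_immersion U y : Prop :=
  [/\ smooth_row U y,
      forall p, U p -> dot (y p) (y p) = 1,
      forall p, U p -> immersed_at y p &
      forall p, U p -> dot (vdz (cx y) p) (vdz (cx y) p) = 0].

Definition canonical_lift U y Y : Prop :=
  [/\ smooth_row U Y,
      forall p, U p -> lor (Y p) (Y p) = 0,
      forall p, U p -> exists2 c : R, 0 < c & Y p = c *: cone (y p) &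
      forall p, U p -> lor (vdz (cx Y) p) (vdzb (cx Y) p) = 2%:R^-1].

(* The complexification of V = span{Y, Re Y_z, Im Y_z, Y_{z zbar}}, as a row space. *)
Definition Vspace Y (p : plane R) : 'M[R[i]]_(n + 1 + 1) :=
  (toC (Y p) + toC (reC (vdz (cx Y) p)) + toC (imC (vdz (cx Y) p))
    + vdzb (vdz (cx Y)) p)%MS.

Definition Vperp Y (p : plane R) : 'M[R[i]]_(n + 1 + 1) :=
  kermx (minkowski R[i] n *m (Vspace Y p)^T).

(* D_{zbar}: the component of the zbar-derivative in V^perp along V. *)
Definition Dzb Y (psi : plane R -> 'rV[R[i]]_(n + 1 + 1)) (p : plane R) :
  'rV[R[i]]_(n + 1 + 1) := vdzb psi p *m proj_mx (Vperp Y p) (Vspace Y p).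

Definition frame U y Y N s kappa : Prop :=
  [/\ canonical_lift U y Y,
      forall p, U p ->
        [/\ (toC (N p) <= Vspace Y p)%MS, lor (N p) (N p) = 0,
            lor (N p) (Y p) = -1 & lor (toC (N p)) (vdz (cx Y) p) = 0],
      forall p, U p -> (kappa p <= Vperp Y p)%MS &
      forall p, U p ->
        vdz (vdz (cx Y)) p = - (s p / 2%:R) *: toC (Y p) + kappa p].

Definition willmore U y : Prop :=
  conformal_immersion U y /\
  exists Y N s kappa, frame U y Y N s kappa /\
    forall p, U p ->
      Dzb Y (Dzb Y kappa) p + ((s p)^*%C / 2%:R) *: kappa p = 0.

Definition super_conformal U y : Prop :=
  exists Y N s kappa, frame U y Y N s kappa /\
    forall p, U p -> lor (kappa p) (kappa p) = 0.

Definition s_willmore U y : Prop :=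
  exists Y N s kappa, frame U y Y N s kappa /\
    forall p, U p -> kappa p != 0 ->
      exists mu, \forall q \near p,
        Dzb Y kappa q + ((mu q)^*%C / 2%:R) *: kappa q = 0.

Definition adjoint_lift Y N mu (p : plane R) : 'rV[R[i]]_(n + 1 + 1) :=
  (`|mu p| ^+ 2 / 2%:R) *: toC (Y p) + (mu p)^*%C *: vdz (cx Y) p
    + mu p *: vdzb (cx Y) p + toC (N p).

(* The conditions are covariant under holomorphic changes of coordinate, so on a plane
   domain the coordinate z is enough. *)
Definition adjoint U y (yhat : plane R -> 'rV[R]_(n + 1)) : Prop :=
  [/\ willmore U y, smooth_row U yhat,
      forall p, U p -> dot (yhat p) (yhat p) = 1 &
      exists Y N s kappa, frame U y Y N s kappa /\
      exists O : set (plane R), [/\ open O, O `<=` U, U `<=` closure O &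
        forall p, O p -> exists (W : set (plane R)) mu,
          [/\ open W, W p, W `<=` O, smoothC W mu &
            forall q, W q ->
              let eta := Dzb Y kappa q + ((mu q)^*%C / 2%:R) *: kappa q in
              [/\ dz mu q - (mu q) ^+ 2 / 2%:R - s q = 0, lor eta eta = 0 &
                  exists2 c : R, c != 0 &
                    adjoint_lift Y N mu q = toC (c *: cone (yhat q))]]]].

End Surfaces.

(* The Riemann sphere C u {oo} and its two coordinates z and w = 1/z. *)
Notation S2 R := (one_point_compactification (plane R)).

Definition chart_z (R : realType) (p : plane R) : S2 R := Some p.
Definition chart_w (R : realType) (p : plane R) : S2 R :=
  if p == 0 then None else Some (plane_of (zcoord p)^-1).

(* A local, coordinate-independent property P of a map on the sphere, checked in both
   coordinates. *)
Definition on_S2 (R : realType) (m : nat)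
  (P : set (plane R) -> (plane R -> 'rV[R]_m) -> Prop) (F : S2 R -> 'rV[R]_m) : Prop :=
  P setT (fun p => F (chart_z p)) /\ P setT (fun p => F (chart_w p)).

Definition inv_stereo (R : realType) (n : nat) (v : 'rV[R]_n) : 'rV[R]_(n + 1) :=
  (1 + dot v v)^-1 *: row_mx (2%:R *: v) ((dot v v - 1)%:M).

Definition E1 (R : realType) : 'rV[R[i]]_5 := \row_(j < 5) [:: 1; 'i; 0; 0; 0]`_j.
Definition E2 (R : realType) : 'rV[R[i]]_5 := \row_(j < 5) [:: 0; 0; 1; 'i; 0]`_j.
Definition e5 (R : realType) : 'rV[R[i]]_5 := \row_(j < 5) [:: 0; 0; 0; 0; 1]`_j.

Definition conjV (R : realType) (m : nat) (v : 'rV[R[i]]_m) : 'rV[R[i]]_m :=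
  map_mx (fun a : R[i] => a^*%C) v.

Definition Psi (R : realType) (z : R[i]) : 'rV[R[i]]_5 :=
  let d := (z ^+ 3 - 1) ^+ 2 in
  ((1 + 32%:R * z ^+ 3) / (2%:R * d * z ^+ 2)) *: E1 R
  + ((1 - 2%:R * z ^+ 3) / (12%:R * d)) *: conjV (E1 R)
  + ((8%:R * z - 5%:R * z ^+ 4) / d) *: E2 R
  - (1 / (6%:R * d)) *: conjV (E2 R)
  - ((Num.sqrt (30%:R : R))%:C * z ^+ 2 / (2%:R * d)) *: e5 R.

Definition minimal_x (R : realType) (x0 : 'rV[R]_5) (p : plane R) : 'rV[R]_5 :=
  x0 + 2%:R *: reC (Psi (zcoord p)).

(* The part of the domain of x on which x is immersed. *)
Definition domain_x (R : realType) (x0 : 'rV[R]_5) : set (plane R) :=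
  [set p | [/\ zcoord p != 0, zcoord p ^+ 3 != 1 & immersed_at (minimal_x x0) p]].

(* Main.v *)
(* For a minimal surface [x = x0 + 2 Re Psi] with [phi = Psi'] and <phi,phi> = <phi',phi'> = 0, a
   function [a] with [a_z + theta a + 1 = 0], [theta = <phi',phi^*> / |phi|^2], yields the adjoint
   surface [x + 2 Re (a phi)]. The equation says that [<Psi + a phi, phi^*>] is, up to an
   antiholomorphic factor, an arbitrary antiholomorphic function [H]. Here [phi = Q / D^3] with a
   polynomial [Q], and [H = c * zbar^8] with a real constant [c] makes the surface extend to the
   whole sphere: [x + 2 Re (a phi)] has a finite limit at [z = 0] and [z = oo] and simple poles
   at the cube roots of unity, where the surface passes through the point at infinity of S^5.
   A branch point satisfies two equations that are linear in [c] and, by compactness, have no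
   common solution for [c] large. Where [a] is nonzero, [<xhat_zz, xhat_zz>] is
   [a^2 <phi'', phi''>], which is nonzero, so the surface is not super-conformal. By the
   intermediate value theorem [a] vanishes at a point of the interval (0, 1); there
   [xhat_zzzbar] has a component along [phi''] that an S-Willmore surface cannot have. *)

Require Import Defs.
From mathcomp Require Import all_boot all_order all_algebra.
From mathcomp Require Import complex ring lra.
From mathcomp Require Import all_classical all_reals all_analysis.
Import Order.TTheory GRing.Theory Num.Theory.
Import numFieldNormedType.Exports.
Local Open Scope classical_set_scope.
Local Open Scope complex_scope.
Local Open Scope ring_scope.
Set Implicit Arguments.
Unset Strict Implicit.
Unset Printing Implicit Defensive.

(** Exponent 8: [Q] has degree 9, so after rescaling to [w = 1/z] the term of [H] becomes
    [c * wbar^9 / wbar^8 = c * wbar]. One factor is left, hence the surface tends to [x0] at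
    [z = oo] with a derivative proportional to [c], and is immersed there. The adjoint condition is
    imposed only on a dense set, because [mu = theta + 2 / a] has a pole where [a = 0]. The zeros of
    [a] have empty interior: at such a point the zbar-derivative of the coefficient of [Q] is
    nonzero, which is the no-branch condition again. The two negative claims range over every
    possible frame. What makes them tractable is that any canonical lift is a scalar multiple [k] of
    one polynomial lift of xhat. Conditions on [kappa] then become conditions on [xhat_zz] and
    [xhat_zzzbar] modulo lower derivatives, and the unknown [k] disappears. The poles of xhat forbid
    working with an R^5-valued map throughout. The sphere-valued map is written with [|m|^2] cleared
    ([m = z^3 - 1]), which stays smooth because the square of the singular part has only a simple
    pole in [m]. *)

Local Notation "x ^*" := (conjc x) : ring_scope.

(** * Smooth functions on the plane *)

Section RealSmooth.
Context {R : realType}.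
Implicit Types (U : set (plane R)) (f g : plane R -> R).

Lemma nbhs_eq_on (T : Type) U (f g : plane R -> T) p : open U -> U p -> (forall q, U q -> f q = g q) ->
  \forall q \near p, f q = g q.
Proof. by move=> oU Up fg; near=> q; apply: fg; near: q; exact: open_nbhs_nbhs. Unshelve. all: by end_near. Qed.

Lemma Ck_ext k U f g : open U -> (forall q, U q -> f q = g q) -> Ck k U f -> Ck k U g.
Proof.
move=> oU; elim: k f g => [|k IH] f g fg /=.
  move=> cf p Up; have nfg := nbhs_eq_on oU Up fg.
  rewrite /prop_for /continuous_at -(fg p Up); apply: cvg_trans (cf p Up).
  exact: near_eq_cvg.
case=> du dv Cu Cv; split=> [p Up|p Up||].
- exact: near_eq_derivable (nbhs_eq_on oU Up fg) (du p Up).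
- exact: near_eq_derivable (nbhs_eq_on oU Up fg) (dv p Up).
- apply: IH Cu => q Uq; apply: near_eq_derive; exact: (nbhs_eq_on oU Uq fg).
- apply: IH Cv => q Uq; apply: near_eq_derive; exact: (nbhs_eq_on oU Uq fg).
Qed.

Lemma Ck_sub k U V f : U `<=` V -> Ck k V f -> Ck k U f.
Proof.
move=> UV; elim: k f => [|k IH] f /=; first by move=> h p /UV; exact: h.
by case=> a b c d; split; [move=> p /UV; exact: a|move=> p /UV; exact: b|exact: IH|exact: IH].
Qed.

Lemma Ck_D k U f g : open U -> Ck k U f -> Ck k U g -> Ck k U (fun p => f p + g p).
Proof.
move=> oU; elim: k f g => [|k IH] f g /=.
  by move=> cf cg p Up; apply: cvgD; [exact: cf|exact: cg].
case=> fu fv Cfu Cfv [gu gv Cgu Cgv]; split=> [p Up|p Up||].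
- by apply: derivableD; auto.
- by apply: derivableD; auto.
- by apply: Ck_ext (IH _ _ Cfu Cgu) => // q Uq; rewrite -deriveD; auto.
- by apply: Ck_ext (IH _ _ Cfv Cgv) => // q Uq; rewrite -deriveD; auto.
Qed.

(** All orders [j <= k] are assumed because [Ck k.+1] speaks of derivability and of the partial
    derivatives only, whereas the Leibniz terms contain [f] and [g] themselves at order [k]. *)
Lemma Ck_M k U f g : open U -> (forall j, (j <= k)%N -> Ck j U f) ->
  (forall j, (j <= k)%N -> Ck j U g) -> Ck k U (fun p => f p * g p).
Proof.
move=> oU; elim: k f g => [|k IH] f g Cf Cg.
  by move=> p Up; apply: cvgM; [exact: (Cf 0%N)|exact: (Cg 0%N)].
have lk j : (j <= k)%N -> (j <= k.+1)%N by move=> h; exact: leqW.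
have [fu fv _ _] := Cf _ (leqnn _); have [gu gv _ _] := Cg _ (leqnn _).
split=> [p Up|p Up||].
- by apply: derivableM; auto.
- by apply: derivableM; auto.
- apply: (@Ck_ext _ _ (fun p => f p * 'D_(e_u R) g p + g p * 'D_(e_u R) f p)) => //.
    by move=> q Uq; rewrite -deriveM; auto.
  apply: Ck_D => //; apply: IH => j jk; try exact: (Cf j (lk j jk)); try exact: (Cg j (lk j jk)).
  + by have [] := Cg j.+1 jk.
  + by have [] := Cf j.+1 jk.
- apply: (@Ck_ext _ _ (fun p => f p * 'D_(e_v R) g p + g p * 'D_(e_v R) f p)) => //.
    by move=> q Uq; rewrite -deriveM; auto.
  apply: Ck_D => //; apply: IH => j jk; try exact: (Cf j (lk j jk)); try exact: (Cg j (lk j jk)).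
  + by have [] := Cg j.+1 jk.
  + by have [] := Cf j.+1 jk.
Qed.

Lemma Ck_cst k U (a : R) : open U -> Ck k U (fun=> a).
Proof.
move=> oU; elim: k a => [|k IH] a /=; first by move=> p _; exact: cst_continuous.
split=> [p _|p _||]; try exact: derivable_cst.
- by apply: Ck_ext (IH 0) => // q _; rewrite derive_cst.
- by apply: Ck_ext (IH 0) => // q _; rewrite derive_cst.
Qed.

Lemma smooth_ext U f g : open U -> (forall q, U q -> f q = g q) -> smooth U f -> smooth U g.
Proof. by move=> oU fg sf k; exact: Ck_ext (sf k). Qed.

Lemma smooth_sub U V f : U `<=` V -> smooth V f -> smooth U f.
Proof. by move=> UV sf k; exact: Ck_sub (sf k). Qed.

Lemma smoothD U f g : open U -> smooth U f -> smooth U g -> smooth U (fun p => f p + g p).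
Proof. by move=> oU sf sg k; exact: Ck_D. Qed.

Lemma smoothM U f g : open U -> smooth U f -> smooth U g -> smooth U (fun p => f p * g p).
Proof. by move=> oU sf sg k; apply: Ck_M. Qed.

Lemma smooth_cst U (a : R) : open U -> smooth U (fun=> a).
Proof. by move=> oU k; exact: Ck_cst. Qed.

Lemma smoothN U f : open U -> smooth U f -> smooth U (fun p => - f p).
Proof.
move=> oU sf; apply: (@smooth_ext _ (fun p => -1 * f p)) => // [q _|]; first by rewrite mulN1r.
by apply: smoothM => //; exact: smooth_cst.
Qed.

Lemma smoothB U f g : open U -> smooth U f -> smooth U g -> smooth U (fun p => f p - g p).
Proof. by move=> oU sf sg; apply: smoothD => //; exact: smoothN. Qed.

Lemma smooth_derive_u U f : smooth U f -> smooth U ('D_(e_u R) f).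
Proof. by move=> sf k; have [] := sf k.+1. Qed.

Lemma smooth_derive_v U f : smooth U f -> smooth U ('D_(e_v R) f).
Proof. by move=> sf k; have [] := sf k.+1. Qed.

Lemma smooth_derivable_u U f p : smooth U f -> U p -> derivable f p (e_u R).
Proof. by move=> sf Up; have [h _ _ _] := sf 1%N; exact: h. Qed.

Lemma smooth_derivable_v U f p : smooth U f -> U p -> derivable f p (e_v R).
Proof. by move=> sf Up; have [_ h _ _] := sf 1%N; exact: h. Qed.

Lemma smooth_continuous U f p : smooth U f -> U p -> {for p, continuous f}.
Proof. by move=> sf; exact: (sf 0%N). Qed.

(** The derivative of [1/f] contains [1/f] again, so the induction treats all orders up to [k] at
    once: order [j.+1] uses the inverse at orders up to [j] only. *)
Lemma smooth_inv U f : open U -> smooth U f -> (forall p, U p -> f p != 0) ->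
  smooth U (fun p => (f p)^-1).
Proof.
move=> oU sf f0 k.
suff: forall j, (j <= k)%N -> Ck j U (fun p => (f p)^-1) by apply.
elim: k => [|k IH] j.
  rewrite leqn0 => /eqP -> p Up; apply: cvgV; [exact: f0|exact: (sf 0%N)].
case: j => [|j]; first by move=> _; exact: IH.
rewrite ltnS => jk.
have aux (h : plane R -> R) : smooth U h -> Ck j U (fun p => - h p * (f p)^-1 * (f p)^-1).
  move=> sh; apply: Ck_M => // i ij; last by apply: IH; exact: leq_trans jk.
  apply: Ck_M => // i' ij'; last by apply: IH; exact: leq_trans (leq_trans ij jk).
  exact: smoothN.
split=> [p Up|p Up||].
- by apply: derivableV; [exact: f0|exact: smooth_derivable_u Up].
- by apply: derivableV; [exact: f0|exact: smooth_derivable_v Up].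
- apply: Ck_ext (aux _ (smooth_derive_u sf)) => // q Uq.
  rewrite deriveV; [|exact: f0|exact: smooth_derivable_u Uq].
  by rewrite /GRing.scale /= expr2 invfM; ring.
- apply: Ck_ext (aux _ (smooth_derive_v sf)) => // q Uq.
  rewrite deriveV; [|exact: f0|exact: smooth_derivable_v Uq].
  by rewrite /GRing.scale /= expr2 invfM; ring.
Qed.

(** A directional derivative is an ordinary derivative along the line [h |-> h *: v + p], which
    reduces the claim to the one-variable chain rule. *)
Lemma is_derive_sqrt_comp f p v : 0 < f p -> derivable f p v ->
  is_derive p v (fun q => Num.sqrt (f q)) ('D_v f p * (2 * Num.sqrt (f p))^-1).
Proof.
move=> f0 df; set g := fun h : R => f (h *: v + p).
have g0 : g 0 = f p by rewrite /g scale0r add0r.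
have dg : derivable g 0 1 := (derivable1P f p v).1 df.
have ds : is_derive (g 0) 1 (@Num.sqrt R) (2 * Num.sqrt (g 0))^-1.
  by apply: is_derive1_sqrt; rewrite g0.
have [dc cE] := is_derive1_comp ds (derivableP dg).
have Dg (h : plane R -> R) : 'D_1 (fun t : R => h (t *: v + p)) 0 = 'D_v h p.
  rewrite /derive; set g1 := fun t => t^-1 *: _; set g2 := fun t => t^-1 *: _.
  suff -> : g1 = g2 by [].
  by apply/funext => t; rewrite /g1 /g2 /= addr0 scale0r add0r [_%:A]mulr1.
split; first by apply/derivable1P; exact: dc.
have := Dg (fun q => Num.sqrt (f q)); rewrite -/g => <-.
by rewrite -(Dg f) -/g -g0 mulrC -cE.
Qed.

(** Writing [1 / (2 sqrt f)] as [sqrt f / (2 f)] turns the derivative into a smooth factor times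
    [sqrt f] itself, and the induction on the order closes. *)
Lemma smooth_sqrt U f : open U -> smooth U f -> (forall p, U p -> 0 < f p) ->
  smooth U (fun p => Num.sqrt (f p)).
Proof.
move=> oU sf f0 k.
suff: forall j, (j <= k)%N -> Ck j U (fun p => Num.sqrt (f p)) by apply.
have s0 p : U p -> Num.sqrt (f p) != 0 by move=> Up; rewrite gt_eqF // sqrtr_gt0 f0.
elim: k => [|k IH] j.
  rewrite leqn0 => /eqP -> p Up; apply: continuous_comp; first exact: (sf 0%N).
  exact: sqrt_continuous.
case: j => [|j]; first by move=> _; exact: IH.
rewrite ltnS => jk.
have du p : U p -> derivable f p (e_u R) by move=> Up; exact: smooth_derivable_u Up.
have dv p : U p -> derivable f p (e_v R) by move=> Up; exact: smooth_derivable_v Up.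
have aux (h : plane R -> R) : smooth U h ->
    Ck j U (fun p => h p * 2^-1 * (f p)^-1 * Num.sqrt (f p)).
  move=> sh; apply: Ck_M => // i ij; last by apply: IH; exact: leq_trans jk.
  apply: smoothM => //; first by apply: smoothM => //; exact: smooth_cst.
  by apply: smooth_inv => // p Up; rewrite gt_eqF ?f0.
have E (a : R) p : U p -> a * 2^-1 * (f p)^-1 * Num.sqrt (f p) = a * (2 * Num.sqrt (f p))^-1.
  move=> Up; have := s0 p Up; have : f p = Num.sqrt (f p) ^+ 2 by rewrite sqr_sqrtr // ltW // f0.
  by move: (Num.sqrt (f p)) => t -> t0; field.
split=> [p Up|p Up||].
- by have [] := is_derive_sqrt_comp (f0 p Up) (du p Up).
- by have [] := is_derive_sqrt_comp (f0 p Up) (dv p Up).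
- apply: Ck_ext (aux _ (smooth_derive_u sf)) => // q Uq.
  by have [_ ->] := is_derive_sqrt_comp (f0 q Uq) (du q Uq); exact: E.
- apply: Ck_ext (aux _ (smooth_derive_v sf)) => // q Uq.
  by have [_ ->] := is_derive_sqrt_comp (f0 q Uq) (dv q Uq); exact: E.
Qed.

Lemma is_derive_coord1 (p v : plane R) : is_derive p v (fun q : plane R => q.1) v.1.
Proof.
have E : forall h : R, h != 0 -> h^-1 *: ((fun q : plane R => q.1) (h *: v + p) - p.1) = v.1.
  by move=> h h0 /=; rewrite addrK scalerA mulVf // scale1r.
have cv : (fun h : R => h^-1 *: (((fun q : plane R => q.1) \o shift p) (h *: v) - p.1)) @ 0^' --> v.1.
  apply: cvg_near_cst; near=> h.
  by apply: E; near: h; exact: nbhs_dnbhs_neq.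
by split; [apply/cvg_ex; exists v.1|exact: cvg_lim cv].
Unshelve. all: by end_near. Qed.

Lemma is_derive_coord2 (p v : plane R) : is_derive p v (fun q : plane R => q.2) v.2.
Proof.
have E : forall h : R, h != 0 -> h^-1 *: ((fun q : plane R => q.2) (h *: v + p) - p.2) = v.2.
  by move=> h h0 /=; rewrite addrK scalerA mulVf // scale1r.
have cv : (fun h : R => h^-1 *: (((fun q : plane R => q.2) \o shift p) (h *: v) - p.2)) @ 0^' --> v.2.
  apply: cvg_near_cst; near=> h.
  by apply: E; near: h; exact: nbhs_dnbhs_neq.
by split; [apply/cvg_ex; exists v.2|exact: cvg_lim cv].
Unshelve. all: by end_near. Qed.

Lemma smooth_coord1 U : open U -> smooth U (fun q : plane R => q.1).
Proof.
move=> oU [|k]; first by move=> p _; exact: cvg_fst.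
split=> [p _|p _||].
- by have [] := is_derive_coord1 p (e_u R).
- by have [] := is_derive_coord1 p (e_v R).
- apply: Ck_ext (Ck_cst k 1 oU) => // q _.
  by have [_ ->] := is_derive_coord1 q (e_u R).
- apply: Ck_ext (Ck_cst k 0 oU) => // q _.
  by have [_ ->] := is_derive_coord1 q (e_v R).
Qed.

Lemma smooth_coord2 U : open U -> smooth U (fun q : plane R => q.2).
Proof.
move=> oU [|k]; first by move=> p _; exact: cvg_snd.
split=> [p _|p _||].
- by have [] := is_derive_coord2 p (e_u R).
- by have [] := is_derive_coord2 p (e_v R).
- apply: Ck_ext (Ck_cst k 0 oU) => // q _.
  by have [_ ->] := is_derive_coord2 q (e_u R).
- apply: Ck_ext (Ck_cst k 1 oU) => // q _.
  by have [_ ->] := is_derive_coord2 q (e_v R).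
Qed.

End RealSmooth.

(** * Wirtinger derivatives of complex functions *)

Section ComplexCalculus.
Context {R : realType}.
Local Notation C := R[i].
Implicit Types (U : set (plane R)) (f g : plane R -> C) (p v : plane R).

Lemma complex_eqP (x y : C) : complex.Re x = complex.Re y -> complex.Im x = complex.Im y -> x = y.
Proof. by case: x => a b; case: y => c d /= -> ->. Qed.

Lemma imag_unitE : 'i = (Complex 0 1 : C). Proof. by rewrite -complexiE. Qed.
Lemma imag_sqr : 'i * 'i = -1 :> C. Proof. by rewrite -expr2 sqrCi. Qed.

Lemma cReM (x y : C) : complex.Re (x * y) = complex.Re x * complex.Re y - complex.Im x * complex.Im y.
Proof. by case: x => a b; case: y. Qed.
Lemma cImM (x y : C) : complex.Im (x * y) = complex.Re x * complex.Im y + complex.Im x * complex.Re y.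
Proof. by case: x => a b; case: y. Qed.
Lemma cReD (x y : C) : complex.Re (x + y) = complex.Re x + complex.Re y.
Proof. by case: x => a b; case: y. Qed.
Lemma cImD (x y : C) : complex.Im (x + y) = complex.Im x + complex.Im y.
Proof. by case: x => a b; case: y. Qed.
Lemma cReN (x : C) : complex.Re (- x) = - complex.Re x.
Proof. by case: x. Qed.
Lemma cImN (x : C) : complex.Im (- x) = - complex.Im x.
Proof. by case: x. Qed.
Lemma cReJ (x : C) : complex.Re (x^*) = complex.Re x.
Proof. by case: x. Qed.
Lemma cImJ (x : C) : complex.Im (x^*) = - complex.Im x.
Proof. by case: x. Qed.
Definition ReImE := (cReD, cImD, cReN, cImN, cReM, cImM, cReJ, cImJ).

Lemma conjci : ('i : C)^* = - 'i.
Proof. by rewrite imag_unitE; apply: complex_eqP => /=; rewrite ?oppr0. Qed.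

Lemma conjcD (x y : C) : (x + y)^* = x^* + y^*. Proof. exact: (rmorphD (@conjc R)). Qed.
Lemma conjcN (x : C) : (- x)^* = - x^*. Proof. exact: (rmorphN (@conjc R)). Qed.
Lemma conjcM (x y : C) : (x * y)^* = x^* * y^*. Proof. exact: (rmorphM (@conjc R)). Qed.
Lemma conjcX (x : C) n : (x ^+ n)^* = x^* ^+ n. Proof. exact: (rmorphXn (@conjc R)). Qed.
Definition conjcE := (conjcD, conjcN, conjcM, conjcX, @conjc_inv R, @conjcK R, @conjc_nat R,
  @conjc0 R, @conjc1 R, @conjc_real R, conjci).

(** Reduces smoothness and derivatives of a complex inverse to those of the real inverse of the
    squared modulus. *)
Lemma invc_conj (x : C) : x^-1 = x^* * (complex.Re (x * x^*))^-1%:C.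
Proof.
case: x => a b; apply: complex_eqP => /=; rewrite ?(mulr0, subr0, add0r, addr0, mulrN, opprK);
  by rewrite -!expr2 ?mulNr.
Qed.

Lemma Re_mulJ_neq0 (x : C) : x != 0 -> complex.Re (x * x^*) != 0.
Proof.
move=> x0; apply: contra x0 => /eqP; case: x => a b /=; rewrite mulrN opprK -!expr2 => h.
have := sqr_ge0 a; have := sqr_ge0 b => hb ha.
have a0 : a ^+ 2 == 0 by apply/eqP; lra.
have b0 : b ^+ 2 == 0 by apply/eqP; lra.
by rewrite !sqrf_eq0 in a0 b0; rewrite (eqP a0) (eqP b0).
Qed.

Definition has_cderive f p v (d : C) : Prop :=
  is_derive p v (fun q => complex.Re (f q)) (complex.Re d) /\
  is_derive p v (fun q => complex.Im (f q)) (complex.Im d).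

(* [f_z = a] and [f_zbar = b]. *)
Definition has_dz f p (a b : C) : Prop :=
  has_cderive f p (e_u R) (a + b) /\ has_cderive f p (e_v R) ('i * (a - b)).

Lemma has_dz_dz f p a b : has_dz f p a b -> dz f p = a.
Proof.
case=> [[[_ h1] [_ h2]] [[_ h3] [_ h4]]]; rewrite /dz /partial h1 h2 h3 h4.
have E (x : C) : complex.Re x +i* complex.Im x = x by case: x.
by rewrite !E mulrA imag_sqr; field.
Qed.

Lemma has_dz_dzb f p a b : has_dz f p a b -> dzb f p = b.
Proof.
case=> [[[_ h1] [_ h2]] [[_ h3] [_ h4]]]; rewrite /dzb /partial h1 h2 h3 h4.
have E (x : C) : complex.Re x +i* complex.Im x = x by case: x.
by rewrite !E mulrA imag_sqr; field.
Qed.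

Lemma has_dz_eq f p a b a' b' : has_dz f p a b -> a = a' -> b = b' -> has_dz f p a' b'.
Proof. by move=> h <- <-. Qed.

Lemma has_cderive_eq f p v d d' : has_cderive f p v d -> d = d' -> has_cderive f p v d'.
Proof. by move=> h <-. Qed.

Lemma has_cderive_ext f g p v d : (\forall q \near p, f q = g q) -> has_cderive f p v d -> has_cderive g p v d.
Proof.
move=> fg [h1 h2]; split.
- have h : \forall q \near p, complex.Re (f q) = complex.Re (g q) by apply: filterS fg => q ->.
  exact: near_eq_is_derive h h1.
- have h : \forall q \near p, complex.Im (f q) = complex.Im (g q) by apply: filterS fg => q ->.
  exact: near_eq_is_derive h h2.
Qed.

Lemma has_dz_ext f g p a b : (\forall q \near p, f q = g q) -> has_dz f p a b -> has_dz g p a b.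
Proof. by move=> fg [h1 h2]; split; [exact: (has_cderive_ext fg h1)|exact: (has_cderive_ext fg h2)]. Qed.

Lemma has_cderiveD f g p v a b : has_cderive f p v a -> has_cderive g p v b ->
  has_cderive (fun q => f q + g q) p v (a + b).
Proof.
move=> [f1 f2] [g1 g2]; split; rewrite ?cReD ?cImD.
- under [X in is_derive _ _ X]eq_fun do rewrite cReD; exact: is_deriveD.
- under [X in is_derive _ _ X]eq_fun do rewrite cImD; exact: is_deriveD.
Qed.

Lemma has_cderiveM f g p v a b : has_cderive f p v a -> has_cderive g p v b ->
  has_cderive (fun q => f q * g q) p v (a * g p + f p * b).
Proof.
move=> [f1 f2] [g1 g2]; split; rewrite !ReImE.
- under [X in is_derive _ _ X]eq_fun do rewrite cReM.
  apply: (@is_derive_eq _ _ _ _ _ _ _ _ (is_deriveB (is_deriveM f1 g1) (is_deriveM f2 g2))).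
  rewrite /GRing.scale /=; ring.
- under [X in is_derive _ _ X]eq_fun do rewrite cImM.
  apply: (@is_derive_eq _ _ _ _ _ _ _ _ (is_deriveD (is_deriveM f1 g2) (is_deriveM f2 g1))).
  rewrite /GRing.scale /=; ring.
Qed.

Lemma has_cderiveJ f p v a : has_cderive f p v a -> has_cderive (fun q => (f q)^*) p v (a^*).
Proof.
move=> [f1 f2]; split; rewrite !ReImE.
- by under [X in is_derive _ _ X]eq_fun do rewrite cReJ.
- under [X in is_derive _ _ X]eq_fun do rewrite cImJ; exact: is_deriveN.
Qed.

Lemma has_cderive_cst (c : C) p v : has_cderive (fun=> c) p v 0.
Proof. by split; exact: is_derive_cst. Qed.

Lemma has_cderive_real (h : plane R -> R) p v d : is_derive p v h d ->
  has_cderive (fun q => (h q)%:C%C) p v (d%:C)%C.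
Proof. by move=> hd; split => //=; exact: is_derive_cst. Qed.

Lemma has_cderiveV f p v a : f p != 0 -> has_cderive f p v a ->
  has_cderive (fun q => (f q)^-1) p v (- a / f p ^+ 2).
Proof.
move=> f0 fa; have fJ := has_cderiveJ fa.
have [Nd _] := has_cderiveM fa fJ.
have N0 := Re_mulJ_neq0 f0.
have Vd : is_derive p v (fun q => (complex.Re (f q * (f q)^*))^-1)
    (- (complex.Re (f p * (f p)^*)) ^- 2 *: complex.Re (a * (f p)^* + f p * a^*)).
  have [Nx NE] := Nd.
  by split; [exact: derivableV|rewrite deriveV // NE].
have := has_cderiveM fJ (has_cderive_real Vd).
have E : (fun q => (f q)^-1) = (fun q => (f q)^* * ((complex.Re (f q * (f q)^*))^-1)%:C%C).
  by apply/funext => q; exact: invc_conj.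
rewrite -E => h; apply: (has_cderive_eq h).
have CR (x : C) : (complex.Re (x * x^*))%:C%C = x * x^*.
  by case: x => s t; apply: complex_eqP => //=; ring.
have CR2 (x y : C) : (complex.Re (x * y^* + y * x^*))%:C%C = x * y^* + y * x^*.
  by case: x => s t; case: y => s' t'; apply: complex_eqP => //=; ring.
rewrite /GRing.scale /= rmorphM rmorphN !fmorphV rmorphXn /= CR CR2.
have fj0 : (f p)^* != 0 by rewrite conjc_eq0.
by field; rewrite f0 fj0.
Qed.

Lemma has_dzD f g p a b a' b' : has_dz f p a b -> has_dz g p a' b' ->
  has_dz (fun q => f q + g q) p (a + a') (b + b').
Proof.
move=> [f1 f2] [g1 g2]; split; [apply: has_cderive_eq (has_cderiveD f1 g1) _|
  apply: has_cderive_eq (has_cderiveD f2 g2) _]; ring.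
Qed.

Lemma has_dzM f g p a b a' b' : has_dz f p a b -> has_dz g p a' b' ->
  has_dz (fun q => f q * g q) p (a * g p + f p * a') (b * g p + f p * b').
Proof.
move=> [f1 f2] [g1 g2]; split; [apply: has_cderive_eq (has_cderiveM f1 g1) _|
  apply: has_cderive_eq (has_cderiveM f2 g2) _]; ring.
Qed.

Lemma has_dz_cst (c : C) p : has_dz (fun=> c) p 0 0.
Proof. by split; rewrite ?addr0 ?subr0 ?mulr0; exact: has_cderive_cst. Qed.

Lemma has_dzJ f p a b : has_dz f p a b -> has_dz (fun q => (f q)^*) p (b^*) (a^*).
Proof.
move=> [f1 f2]; split; [apply: has_cderive_eq (has_cderiveJ f1) _|
  apply: has_cderive_eq (has_cderiveJ f2) _].
  by rewrite conjcD addrC.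
by rewrite !conjcE; ring.
Qed.

Lemma has_dzV f p a b : f p != 0 -> has_dz f p a b ->
  has_dz (fun q => (f q)^-1) p (- a / f p ^+ 2) (- b / f p ^+ 2).
Proof.
move=> f0 [f1 f2]; split; [apply: has_cderive_eq (has_cderiveV f0 f1) _|
  apply: has_cderive_eq (has_cderiveV f0 f2) _]; field; exact: f0.
Qed.

Lemma has_dzN f p a b : has_dz f p a b -> has_dz (fun q => - f q) p (- a) (- b).
Proof.
move=> h; have := has_dzM (has_dz_cst (-1) p) h.
under [X in has_dz X]eq_fun do rewrite mulN1r.
by move=> h'; apply: has_dz_eq h' _ _; ring.
Qed.

Lemma has_dzB f g p a b a' b' : has_dz f p a b -> has_dz g p a' b' ->
  has_dz (fun q => f q - g q) p (a - a') (b - b').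
Proof. by move=> hf hg; apply: has_dzD => //; exact: has_dzN. Qed.

Lemma has_dzZ (c : C) f p a b : has_dz f p a b -> has_dz (fun q => c * f q) p (c * a) (c * b).
Proof.
by move=> h; apply: has_dz_eq (has_dzM (has_dz_cst c p) h) _ _; rewrite mul0r add0r.
Qed.

Lemma has_dzX f p a b n : has_dz f p a b ->
  has_dz (fun q => f q ^+ n) p (n%:R * f p ^+ n.-1 * a) (n%:R * f p ^+ n.-1 * b).
Proof.
move=> h; elim: n => [|n IH] /=.
  by rewrite !mul0r; under [X in has_dz X]eq_fun do rewrite expr0; exact: has_dz_cst.
under [X in has_dz X]eq_fun do rewrite exprS.
apply: has_dz_eq (has_dzM h IH) _ _.
- by case: n {IH} => [|n] /=; [ring|rewrite -(addn1 n.+1) natrD exprS; ring].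
- by case: n {IH} => [|n] /=; [ring|rewrite -(addn1 n.+1) natrD exprS; ring].
Qed.

Lemma has_dz_zcoord p : has_dz (@zcoord R) p 1 0.
Proof.
split; split; rewrite ?imag_unitE !ReImE /=.
- by apply: is_derive_eq (is_derive_coord1 _ _) _ => /=; ring.
- by apply: is_derive_eq (is_derive_coord2 _ _) _ => /=; ring.
- by apply: is_derive_eq (is_derive_coord1 _ _) _ => /=; ring.
- by apply: is_derive_eq (is_derive_coord2 _ _) _ => /=; ring.
Qed.

Lemma smoothC_ext U f g : open U -> (forall q, U q -> f q = g q) -> smoothC U f -> smoothC U g.
Proof.
move=> oU fg [h1 h2]; split; [apply: smooth_ext h1|apply: smooth_ext h2] => // q Uq;
  by rewrite fg.
Qed.

Lemma smoothC_sub U V f : U `<=` V -> smoothC V f -> smoothC U f.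
Proof. by move=> UV [h1 h2]; split; exact: smooth_sub UV _. Qed.

Lemma smoothCD U f g : open U -> smoothC U f -> smoothC U g -> smoothC U (fun p => f p + g p).
Proof.
move=> oU [f1 f2] [g1 g2]; split.
- by under [X in smooth _ X]eq_fun do rewrite cReD; exact: smoothD.
- by under [X in smooth _ X]eq_fun do rewrite cImD; exact: smoothD.
Qed.

Lemma smoothCM U f g : open U -> smoothC U f -> smoothC U g -> smoothC U (fun p => f p * g p).
Proof.
move=> oU [f1 f2] [g1 g2]; split.
- by under [X in smooth _ X]eq_fun do rewrite cReM; apply: smoothB => //; exact: smoothM.
- by under [X in smooth _ X]eq_fun do rewrite cImM; apply: smoothD => //; exact: smoothM.
Qed.

Lemma smoothC_cst U (c : C) : open U -> smoothC U (fun=> c).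
Proof. by move=> oU; split; exact: smooth_cst. Qed.

Lemma smoothCN U f : open U -> smoothC U f -> smoothC U (fun p => - f p).
Proof.
move=> oU [f1 f2]; split.
- by under [X in smooth _ X]eq_fun do rewrite cReN; exact: smoothN.
- by under [X in smooth _ X]eq_fun do rewrite cImN; exact: smoothN.
Qed.

Lemma smoothCB U f g : open U -> smoothC U f -> smoothC U g -> smoothC U (fun p => f p - g p).
Proof. by move=> oU sf sg; apply: smoothCD => //; exact: smoothCN. Qed.

Lemma smoothCJ U f : open U -> smoothC U f -> smoothC U (fun p => (f p)^*).
Proof.
move=> oU [f1 f2]; split.
- by under [X in smooth _ X]eq_fun do rewrite cReJ.
- by under [X in smooth _ X]eq_fun do rewrite cImJ; exact: smoothN.
Qed.

Lemma smoothC_real U (h : plane R -> R) : open U -> smooth U h -> smoothC U (fun p => (h p)%:C%C).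
Proof. by move=> oU sh; split => //=; exact: smooth_cst. Qed.

Lemma smoothCV U f : open U -> smoothC U f -> (forall p, U p -> f p != 0) ->
  smoothC U (fun p => (f p)^-1).
Proof.
move=> oU sf f0; under [X in smoothC _ X]eq_fun do rewrite invc_conj.
apply: smoothCM => //; first exact: smoothCJ.
apply: smoothC_real => //; apply: smooth_inv => // [|p Up]; last exact/Re_mulJ_neq0/f0.
by have [] := smoothCM oU sf (smoothCJ oU sf).
Qed.

Lemma smoothCX U f n : open U -> smoothC U f -> smoothC U (fun p => f p ^+ n).
Proof.
move=> oU sf; elim: n => [|n IH].
  by under [X in smoothC _ X]eq_fun do rewrite expr0; exact: smoothC_cst.
by under [X in smoothC _ X]eq_fun do rewrite exprS; exact: smoothCM.
Qed.

Lemma smoothC_zcoord U : open U -> smoothC U (@zcoord R).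
Proof. by move=> oU; split; [exact: smooth_coord1|exact: smooth_coord2]. Qed.

Lemma smoothC_near_neq0 U f p : open U -> smoothC U f -> U p -> f p != 0 ->
  \forall q \near p, f q != 0.
Proof.
move=> oU [sre sim] Up a0.
have : complex.Re (f p) != 0 \/ complex.Im (f p) != 0.
  apply/orP; rewrite -negb_and; apply: contra a0 => /andP[/eqP h1 /eqP h2].
  by apply/eqP; exact: complex_eqP.
case=> h.
- have := smooth_continuous sre Up.
  move=> /(_ _ (open_nbhs_nbhs (conj (@open_neq R 0) h))).
  apply: filterS2 (open_nbhs_nbhs (conj oU Up)) => q /= _ /eqP hq; by apply/eqP => q0; apply: hq; rewrite q0.
- have := smooth_continuous sim Up.
  move=> /(_ _ (open_nbhs_nbhs (conj (@open_neq R 0) h))).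
  apply: filterS2 (open_nbhs_nbhs (conj oU Up)) => q /= _ /eqP hq; by apply/eqP => q0; apply: hq; rewrite q0.
Qed.

Lemma open_smoothC_neq0 U f : open U -> smoothC U f ->
  open [set p | U p /\ f p != 0].
Proof.
move=> oU sf; rewrite openE => p [Up f0].
have nU : nbhs p U by exact: (open_nbhs_nbhs (conj oU Up)).
by apply: filterS2 nU (smoothC_near_neq0 oU sf Up f0) => q.
Qed.

Lemma smoothC_has_dz U f p : smoothC U f -> U p -> has_dz f p (dz f p) (dzb f p).
Proof.
move=> [f1 f2] Up.
have D (h : plane R -> R) v : derivable h p v -> is_derive p v h ('D_v h p) by move/derivableP.
have du h sh := D h _ (@smooth_derivable_u _ _ _ _ sh Up).
have dv h sh := D h _ (@smooth_derivable_v _ _ _ _ sh Up).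
have E1 : dz f p + dzb f p = partial (e_u R) f p by rewrite /dz /dzb; field.
have E2 : 'i * (dz f p - dzb f p) = partial (e_v R) f p.
  have -> : dz f p - dzb f p = - 'i * partial (e_v R) f p by rewrite /dz /dzb; field.
  by rewrite mulNr mulrN mulrA imag_sqr mulN1r opprK.
by split; rewrite ?E1 ?E2; split; rewrite /partial /=; auto.
Qed.

Lemma smoothC_partial_u U f : smoothC U f -> smoothC U (partial (e_u R) f).
Proof. by move=> [f1 f2]; split; exact: smooth_derive_u. Qed.

Lemma smoothC_partial_v U f : smoothC U f -> smoothC U (partial (e_v R) f).
Proof. by move=> [f1 f2]; split; exact: smooth_derive_v. Qed.

Lemma smoothC_dz U f : open U -> smoothC U f -> smoothC U (dz f).
Proof.
move=> oU sf; apply: smoothCM => //; last exact: smoothC_cst.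
apply: smoothCB => //; first exact: smoothC_partial_u.
by apply: smoothCM => //; [exact: smoothC_cst|exact: smoothC_partial_v].
Qed.

Lemma smoothC_dzb U f : open U -> smoothC U f -> smoothC U (dzb f).
Proof.
move=> oU sf; apply: smoothCM => //; last exact: smoothC_cst.
apply: smoothCD => //; first exact: smoothC_partial_u.
by apply: smoothCM => //; [exact: smoothC_cst|exact: smoothC_partial_v].
Qed.

End ComplexCalculus.

(** * The light cone and moving frames *)

Section Forms.
Context {K : comNzRingType}.

Lemma dotE m (a b : 'rV[K]_m) : dot a b = \sum_j a 0 j * b 0 j.
Proof. by rewrite /dot mxE; apply: eq_bigr => j _; rewrite mxE. Qed.
Lemma dotC m (a b : 'rV[K]_m) : dot a b = dot b a.
Proof. by rewrite !dotE; apply: eq_bigr => j _; rewrite mulrC. Qed.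
Lemma dotDl m (a b c : 'rV[K]_m) : dot (a + b) c = dot a c + dot b c.
Proof. by rewrite /dot mulmxDl mxE. Qed.
Lemma dotZl m k (a b : 'rV[K]_m) : dot (k *: a) b = k * dot a b.
Proof. by rewrite /dot -scalemxAl mxE. Qed.
Lemma dotNl m (a b : 'rV[K]_m) : dot (- a) b = - dot a b.
Proof. by rewrite /dot mulNmx mxE. Qed.
Lemma dot0l m (a : 'rV[K]_m) : dot 0 a = 0.
Proof. by rewrite /dot mul0mx mxE. Qed.
Lemma dotDr m (a b c : 'rV[K]_m) : dot c (a + b) = dot c a + dot c b.
Proof. by rewrite dotC dotDl !(dotC c). Qed.
Lemma dotZr m k (a b : 'rV[K]_m) : dot b (k *: a) = k * dot b a.
Proof. by rewrite dotC dotZl (dotC b). Qed.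
Lemma dotNr m (a b : 'rV[K]_m) : dot b (- a) = - dot b a.
Proof. by rewrite dotC dotNl (dotC b). Qed.
Lemma dot0r m (a : 'rV[K]_m) : dot a 0 = 0.
Proof. by rewrite dotC dot0l. Qed.
Definition dot_lin := (dotDl, dotDr, dotZl, dotZr, dotNl, dotNr, @dot0l, @dot0r).

(** Applied with [x] the conjugate of [Q]. The last bracket is then a pairing against that
    conjugate, which a differentiated orthogonality relation makes vanish. *)
Lemma dot_null_comb m (u v w x : 'rV[K]_m) k l r t : dot u u = 0 -> dot v v = 0 -> dot x x = 0 ->
  dot u v = 0 -> dot u w = 0 -> dot v w = 0 ->
  dot (k *: u + l *: v + r *: w + t *: x) (k *: u + l *: v + r *: w + t *: x) =
  r ^+ 2 * dot w w + 2 * t * (k * dot u x + l * dot v x + r * dot w x).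
Proof.
move=> uu vv xx uv uw vw; rewrite !(dotDl, dotDr, dotZl, dotZr) !(dotC x) !(dotC w u) !(dotC w v) (dotC v u).
rewrite uu vv xx uv uw vw.
by move: (dot w w) (dot u x) (dot v x) (dot w x) => d0 d e f; ring.
Qed.

Lemma trmx_minkowski n : (Defs.minkowski K n)^T = Defs.minkowski K n.
Proof. by rewrite /Defs.minkowski tr_block_mx trmx1 !trmx0 (raddfN trmx) /= trmx1. Qed.

Context {n : nat}.
Implicit Types a b c : 'rV[K]_(n + 1 + 1).

Lemma lorC a b : lor a b = lor b a.
Proof.
rewrite /lor; have -> : a *m Defs.minkowski K n *m b^T = (b *m Defs.minkowski K n *m a^T)^T.
  by rewrite !trmx_mul trmxK trmx_minkowski mulmxA.
by rewrite mxE.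
Qed.
Lemma lorDl a b c : lor (a + b) c = lor a c + lor b c.
Proof. by rewrite /lor !mulmxDl mxE. Qed.
Lemma lorZl k a b : lor (k *: a) b = k * lor a b.
Proof. by rewrite /lor -!scalemxAl mxE. Qed.
Lemma lorNl a b : lor (- a) b = - lor a b.
Proof. by rewrite /lor !mulNmx mxE. Qed.
Lemma lor0l a : lor 0 a = 0.
Proof. by rewrite /lor !mul0mx mxE. Qed.
Lemma lorDr a b c : lor c (a + b) = lor c a + lor c b.
Proof. by rewrite lorC lorDl !(lorC c). Qed.
Lemma lorZr k a b : lor b (k *: a) = k * lor b a.
Proof. by rewrite lorC lorZl (lorC b). Qed.
Lemma lorNr a b : lor b (- a) = - lor b a.
Proof. by rewrite lorC lorNl (lorC b). Qed.
Lemma lor0r a : lor a 0 = 0.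
Proof. by rewrite lorC lor0l. Qed.
Definition lor_lin := (lorDl, lorDr, lorZl, lorZr, lorNl, lorNr, @lor0l, @lor0r).

Definition clift (v : 'rV[K]_n) (s t : K) : 'rV[K]_(n + 1 + 1) := row_mx (row_mx v s%:M) t%:M.

Lemma lor_clift v s t v' s' t' : lor (clift v s t) (clift v' s' t') = dot v v' + s * s' - t * t'.
Proof.
rewrite /lor /clift /Defs.minkowski mul_row_block !mulmx0 addr0 add0r mulmx1 mulmxN mulmx1.
rewrite !tr_row_mx !mul_row_col mulNmx !tr_scalar_mx -!scalar_mxM.
by rewrite !mxE /dot mxE eqxx !mulr1n.
Qed.

Lemma cliftD v s t v' s' t' : clift v s t + clift v' s' t' = clift (v + v') (s + s') (t + t').
Proof. by rewrite /clift !add_row_mx !raddfD. Qed.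
Lemma cliftZ k v s t : k *: clift v s t = clift (k *: v) (k * s) (k * t).
Proof. by rewrite /clift !scale_row_mx !scale_scalar_mx. Qed.

Lemma clift_inj v s t v' s' t' : clift v s t = clift v' s' t' -> [/\ v = v' , s = s' & t = t' ].
Proof.
have sc (x y : K) : (x%:M = y%:M :> 'M[K]_1) -> x = y.
  by move=> h; have := congr1 (fun A : 'M[K]_1 => A 0 0) h; rewrite !mxE eqxx !mulr1n.
by rewrite /clift => /eq_row_mx[/eq_row_mx[-> /sc ->] /sc ->].
Qed.

Lemma clift_surj a : exists v s t, a = clift v s t.
Proof.
exists (lsubmx (lsubmx a)), (rsubmx (lsubmx a) 0 0), (rsubmx a 0 0).
by rewrite /clift -!mx11_scalar !hsubmxK.
Qed.

End Forms.

Section ComplexRows.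
Context {R : realType}.
Local Notation C := R[i].

Lemma conjVK m : involutive (@conjV R m).
Proof. by move=> v; apply/rowP => j; rewrite !mxE conjcK. Qed.
Lemma conjVD m (a b : 'rV[C]_m) : conjV (a + b) = conjV a + conjV b.
Proof. by apply/rowP => j; rewrite !mxE conjcD. Qed.
Lemma conjVZ m k (a : 'rV[C]_m) : conjV (k *: a) = k^* *: conjV a.
Proof. by apply/rowP => j; rewrite !mxE conjcM. Qed.
Lemma conjV0 m : conjV (0 : 'rV[C]_m) = 0.
Proof. by apply/rowP => j; rewrite !mxE conjc0. Qed.
Lemma conjV_toC m (a : 'rV[R]_m) : conjV (toC a) = toC a.
Proof. by apply/rowP => j; rewrite !mxE conjc_real. Qed.
Lemma toC_reC m (a : 'rV[C]_m) : 2 *: toC (reC a) = a + conjV a.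
Proof. by apply/rowP => j; rewrite !mxE addcJ. Qed.
Lemma toC_real m (a : 'rV[C]_m) : conjV a = a -> toC (reC a) = a.
Proof.
move=> h; apply/rowP => j; have := congr1 (fun v : 'rV_m => v 0 j) h; rewrite !mxE.
by case: (a 0 j) => x y [yN]; apply: complex_eqP => //=; lra.
Qed.
Lemma toCD m (a b : 'rV[R]_m) : toC (a + b) = toC a + toC b.
Proof. by apply/rowP => j; rewrite !mxE rmorphD. Qed.
Lemma toCZ m k (a : 'rV[R]_m) : toC (k *: a) = k%:C *: toC a.
Proof. by apply/rowP => j; rewrite !mxE rmorphM. Qed.
Lemma toC_inj m : injective (@toC R m).
Proof.
move=> a b h; apply/rowP => j; have := congr1 (fun v : 'rV_m => v 0 j) h; rewrite !mxE.
by move/complexI.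
Qed.
Lemma dot_toC m (a b : 'rV[R]_m) : dot (toC a) (toC b) = (dot a b)%:C.
Proof. by rewrite !dotE rmorph_sum; apply: eq_bigr => j _; rewrite !mxE rmorphM. Qed.
Lemma dot_conj m (a b : 'rV[C]_m) : dot (conjV a) (conjV b) = (dot a b)^*.
Proof. by rewrite !dotE rmorph_sum; apply: eq_bigr => j _; rewrite !mxE rmorphM. Qed.

Context {n : nat}.
Lemma clift_conj (v : 'rV[C]_n) s t : conjV (clift v s t) = clift (conjV v) (s^*) (t^*).
Proof.
rewrite /clift /conjV !map_row_mx; congr (row_mx (row_mx _ _) _);
  by apply/matrixP => i j; rewrite !mxE !ord1 eqxx !mulr1n.
Qed.
Lemma clift_toC (v : 'rV[R]_n) s t : toC (clift v s t) = clift (toC v) (s%:C) (t%:C).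
Proof.
rewrite /clift /toC !map_row_mx; congr (row_mx (row_mx _ _) _);
  by apply/matrixP => i j; rewrite !mxE !ord1 eqxx !mulr1n.
Qed.
Lemma lor_toC (a b : 'rV[R]_(n + 1 + 1)) : lor (toC a) (toC b) = (lor a b)%:C.
Proof.
have [v [s [t ->]]] := clift_surj a; have [v' [s' [t' ->]]] := clift_surj b.
by rewrite !clift_toC !lor_clift dot_toC rmorphB rmorphD !rmorphM.
Qed.
Lemma lor_conj (a b : 'rV[C]_(n + 1 + 1)) : lor (conjV a) (conjV b) = (lor a b)^*.
Proof.
have [v [s [t ->]]] := clift_surj a; have [v' [s' [t' ->]]] := clift_surj b.
by rewrite !clift_conj !lor_clift dot_conj rmorphB rmorphD !rmorphM.
Qed.

Definition hdot m (a b : 'rV[C]_m) : C := dot a (conjV b).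

Lemma hdot_ge0 m (a : 'rV[C]_m) : 0 <= hdot a a.
Proof.
by rewrite /hdot dotE; apply: sumr_ge0 => j _; rewrite mxE; exact: mulcJ_ge0.
Qed.

Lemma hdot_eq0 m (a : 'rV[C]_m) : hdot a a = 0 -> a = 0.
Proof.
rewrite /hdot dotE => /eqP; rewrite psumr_eq0; last by move=> j _; rewrite mxE; exact: mulcJ_ge0.
move=> /allP h; apply/rowP => j; rewrite mxE.
have := h j; rewrite mem_index_enum => /(_ isT) /=; rewrite mxE mulf_eq0 conjc_eq0 orbb.
by move/eqP.
Qed.

Lemma hdot_gt0 m (a : 'rV[C]_m) : a != 0 -> 0 < hdot a a.
Proof. by move=> a0; rewrite lt0r hdot_ge0 andbT; apply: contra a0 => /eqP/hdot_eq0/eqP. Qed.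

End ComplexRows.

(** * The splitting of the ambient space into [V] and its orthogonal complement *)

Section NormalSpace.
Context {R : realType} {n : nat}.
Local Notation C := R[i].
Local Notation vec := 'rV[C]_(n + 1 + 1).
Variables (Y : plane R -> 'rV[R]_(n + 1 + 1)) (p : plane R).
Local Notation y0 := (toC (Y p)).
Local Notation y1 := (vdz (fun q => toC (Y q)) p).
Local Notation y2 := (conjV y1).
Local Notation y3 := (vdzb (vdz (fun q => toC (Y q))) p).

(** Over the complex numbers, [Re Y_z] and [Im Y_z] have the same span as [Y_z] and its conjugate;
    coordinates in this basis suit the Gram relations below. *)
Lemma VspaceP (v : vec) :
  (v <= Vspace Y p)%MS <-> exists a b c d, v = a *: y0 + b *: y1 + c *: y2 + d *: y3.
Proof.
have reE : toC (reC y1) = 2^-1 *: (y1 + y2).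
  by apply: (scalerI (_ : (2 : C) != 0)); rewrite ?toC_reC ?scalerA ?divff ?scale1r.
have imE : toC (imC y1) = (- 'i / 2) *: (y1 - y2).
  apply/rowP => j; rewrite !mxE; move: (dz _ _) => x.
  have -> : x - x^*%C = 2 * (complex.Im x)%:C * 'i by rewrite subcJ complexiE.
  have -> : - 'i / 2 * (2 * (complex.Im x)%:C * 'i) = - ('i * 'i) * (complex.Im x)%:C :> C by field.
  by rewrite imag_sqr opprK mul1r.
rewrite /Vspace; split.
  move/sub_addsmxP=> [[u1 u2] /= ->].
  have /sub_addsmxP[[u3 u4] /= ->] := submxMl u1 (y0 + toC (reC y1) + toC (imC y1))%MS.
  have /sub_addsmxP[[u5 u6] /= ->] := submxMl u3 (y0 + toC (reC y1))%MS.
  rewrite reE imE [u5]mx11_scalar [u6]mx11_scalar [u4]mx11_scalar [u2]mx11_scalar.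
  rewrite !mul_scalar_mx; move: (u5 0 0) (u6 0 0) (u4 0 0) (u2 0 0) => a b c d.
  exists a, (b * 2^-1 + c * (- 'i / 2)), (b * 2^-1 - c * (- 'i / 2)), d.
  have E (k : C) (u v' w x : vec) : a *: u + b *: (2^-1 *: (v' + w)) + c *: (k *: (v' - w)) + d *: x
      = a *: u + (b * 2^-1 + c * k) *: v' + (b * 2^-1 - c * k) *: w + d *: x.
    by apply/rowP => j; rewrite !mxE; ring.
  exact: E.
have sub0 : (y0 <= y0 + toC (reC y1) + toC (imC y1) + y3)%MS.
  by rewrite -!addsmxA addsmxSl.
have subre : (toC (reC y1) <= y0 + toC (reC y1) + toC (imC y1) + y3)%MS.
  by rewrite -addsmxA (submx_trans _ (addsmxSl _ _)) // addsmxSr.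
have subim : (toC (imC y1) <= y0 + toC (reC y1) + toC (imC y1) + y3)%MS.
  by rewrite (submx_trans _ (addsmxSl _ _)) // addsmxSr.
have ii : 'i * (- 'i / 2) = 2^-1 :> C by rewrite mulrA mulrN imag_sqr opprK mul1r.
have y1E : y1 = toC (reC y1) + 'i *: toC (imC y1).
  rewrite reE imE scalerA ii; apply/rowP => j; rewrite !mxE.
  by move: (dz _ _) => x; move: (conjc x) => y; field.
have y2E : y2 = toC (reC y1) - 'i *: toC (imC y1).
  rewrite reE imE scalerA ii; apply/rowP => j; rewrite !mxE.
  by move: (dz _ _) => x; move: (conjc x) => y; field.
move=> [a [b [c [d ->]]]]; rewrite y2E {1}y1E.
apply: addmx_sub; last by rewrite scalemx_sub // addsmxSr.
apply: addmx_sub; last by apply: scalemx_sub; apply: addmx_sub => //; rewrite -scaleNr; apply: scalemx_sub.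
by apply: addmx_sub; rewrite scalemx_sub // addmx_sub // scalemx_sub.
Qed.

Lemma VperpP (v : vec) :
  (v <= Vperp Y p)%MS <-> [/\ lor v y0 = 0, lor v y1 = 0, lor v y2 = 0 & lor v y3 = 0].
Proof.
have E (w : vec) : (w <= kermx (v *m Defs.minkowski C n)^T)%MS = (lor v w == 0).
  have h : w *m (v *m Defs.minkowski C n)^T = w *m Defs.minkowski C n *m v^T.
    by rewrite trmx_mul trmx_minkowski mulmxA.
  rewrite (sameP sub_kermxP eqP) h lorC /lor.
  apply/eqP/eqP => [->|h']; first by rewrite mxE.
  by apply/matrixP => i j; rewrite !ord1 h' mxE.
have : (v <= Vperp Y p)%MS <-> (Vspace Y p <= kermx (v *m Defs.minkowski C n)^T)%MS.
  rewrite /Vperp; split => [/sub_kermxP h|/sub_kermxP h]; apply/sub_kermxP.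
    by apply: trmx_inj; rewrite trmx_mul trmxK trmx0 -mulmxA.
  by apply: trmx_inj; rewrite mulmxA trmx_mul trmxK trmx0.
move=> ->; split=> [h|[h0 h1 h2 h3]].
  have Ev w : (w <= Vspace Y p)%MS -> lor v w = 0.
    by move=> wV; apply/eqP; rewrite -E; exact: submx_trans h.
  split; apply: Ev; apply/VspaceP.
  - by exists 1, 0, 0, 0; rewrite !scale0r !addr0 scale1r.
  - by exists 0, 1, 0, 0; rewrite !scale0r !addr0 add0r scale1r.
  - by exists 0, 0, 1, 0; rewrite !scale0r !addr0 !add0r scale1r.
  - by exists 0, 0, 0, 1; rewrite !scale0r !add0r scale1r.
apply/row_subP => i; have /VspaceP[a [b [c [d ->]]]] := row_sub i (Vspace Y p).
by rewrite E !lor_lin h0 h1 h2 h3 !mulr0 !addr0.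
Qed.

Hypothesis g00 : lor y0 y0 = 0.
Hypothesis g01 : lor y0 y1 = 0.
Hypothesis g02 : lor y0 y2 = 0.
Hypothesis g11 : lor y1 y1 = 0.
Hypothesis g12 : lor y1 y2 = 2^-1.
Hypothesis g03 : lor y0 y3 = - 2^-1.

(** The form is nondegenerate on [V]: for a combination orthogonal to [V], pairing with [y0], [y1],
    [y2], [y3] in this order removes the coefficients [d], [c], [b], [a] one after the other. *)
Lemma Vperp_Vspace_disjoint : (Vperp Y p :&: Vspace Y p)%MS = 0.
Proof.
have half0 : (2^-1 : C) != 0 by rewrite invr_eq0.
apply/eqP; rewrite -submx0; apply/row_subP => i; set w := row i _.
have := row_sub i (Vperp Y p :&: Vspace Y p)%MS; rewrite -/w sub_capmx => /andP[/VperpP + /VspaceP].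
move=> [h0 h1 h2 h3] [a [b [c [d wE]]]].
have d0 : d = 0.
  move: h0; rewrite wE !lor_lin !(lorC _ y0) g00 g01 g02 g03 !mulr0 !add0r => /eqP.
  by rewrite mulf_eq0 oppr_eq0 (negPf half0) orbF => /eqP.
have c0 : c = 0.
  move: h1; rewrite wE d0 scale0r addr0 !lor_lin g01 g11 (lorC y2) g12 !mulr0 !add0r => /eqP.
  by rewrite mulf_eq0 (negPf half0) orbF => /eqP.
have b0 : b = 0.
  move: h2; rewrite wE d0 c0 !scale0r !addr0 !lor_lin g02 g12 !mulr0 !add0r => /eqP.
  by rewrite mulf_eq0 (negPf half0) orbF => /eqP.
have a0 : a = 0.
  move: h3; rewrite wE d0 c0 b0 !scale0r !addr0 !lor_lin g03 => /eqP.
  by rewrite mulf_eq0 oppr_eq0 (negPf half0) orbF => /eqP.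
by rewrite wE a0 b0 c0 d0 !scale0r !addr0 sub0mx.
Qed.

Lemma Vperp_proj_eq (v a b : vec) : v = a + b -> (a <= Vperp Y p)%MS -> (b <= Vspace Y p)%MS ->
  v *m proj_mx (Vperp Y p) (Vspace Y p) = a.
Proof.
move=> -> aV bV; rewrite mulmxDl proj_mx_id //; last exact: Vperp_Vspace_disjoint.
by rewrite proj_mx_0 ?addr0 //; exact: Vperp_Vspace_disjoint.
Qed.

(** A dimension count: the Minkowski matrix is its own inverse, so the complement has rank the
    dimension minus the rank of [V]. With trivial intersection the two spaces fill everything, and
    the projection leaves a remainder in [V]. *)
Lemma Vperp_proj_sub (v : vec) :
  (v - v *m proj_mx (Vperp Y p) (Vspace Y p) <= Vspace Y p)%MS.
Proof.
apply: proj_mx_compl_sub; apply: submx_full.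
rewrite /row_full mxrank_disjoint_sum; last exact: Vperp_Vspace_disjoint.
have MM : Defs.minkowski C n *m Defs.minkowski C n = 1%:M.
  rewrite /Defs.minkowski mulmx_block !mulmx0 !mul0mx !addr0 !add0r mulmx1 mulmxN mulNmx mulmx1 opprK.
  by rewrite -scalar_mx_block.
have fM : row_full (Defs.minkowski C n) by apply/row_fullP; exists (Defs.minkowski C n).
rewrite /Vperp mxrank_ker (eqmxMfull _ fM) mxrank_tr subnK //.
exact: rank_leq_col.
Qed.

End NormalSpace.

(** * Wirtinger calculus for row-valued maps *)

Section VectorCalculus.
Context {R : realType}.
Local Notation C := R[i].
Implicit Types (U : set (plane R)) (f g : plane R -> C) (p : plane R).

Definition has_vdz m (F : plane R -> 'rV[C]_m) p (A B : 'rV[C]_m) : Prop :=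
  forall j, has_dz (fun q => F q 0 j) p (A 0 j) (B 0 j).

Definition smoothV m U (F : plane R -> 'rV[C]_m) : Prop :=
  forall j, smoothC U (fun q => F q 0 j).

Section Rules.
Context {m : nat}.
Implicit Types (F G : plane R -> 'rV[C]_m) (A B : 'rV[C]_m).

Lemma has_vdz_vdz F p A B : has_vdz F p A B -> vdz F p = A.
Proof. by move=> h; apply/rowP => j; rewrite mxE (has_dz_dz (h j)). Qed.
Lemma has_vdz_vdzb F p A B : has_vdz F p A B -> vdzb F p = B.
Proof. by move=> h; apply/rowP => j; rewrite mxE (has_dz_dzb (h j)). Qed.
Lemma has_vdz_eq F p A B A' B' : has_vdz F p A B -> A = A' -> B = B' -> has_vdz F p A' B'.
Proof. by move=> h <- <-. Qed.
Lemma has_vdz_ext F G p A B : (\forall q \near p, F q = G q) -> has_vdz F p A B -> has_vdz G p A B.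
Proof.
move=> FG h j; have nj : \forall q \near p, F q 0 j = G q 0 j by apply: filterS FG => q ->.
exact: (has_dz_ext nj (h j)).
Qed.
Lemma has_vdzD F G p A B A' B' : has_vdz F p A B -> has_vdz G p A' B' ->
  has_vdz (fun q => F q + G q) p (A + A') (B + B').
Proof.
move=> hF hG j; rewrite !mxE; under [X in has_dz X]eq_fun do rewrite mxE; exact: has_dzD.
Qed.
Lemma has_vdzZ f F p a b A B : has_dz f p a b -> has_vdz F p A B ->
  has_vdz (fun q => f q *: F q) p (a *: F p + f p *: A) (b *: F p + f p *: B).
Proof.
move=> hf hF j; rewrite !mxE; under [X in has_dz X]eq_fun do rewrite mxE; exact: has_dzM.
Qed.
Lemma has_vdzN F p A B : has_vdz F p A B -> has_vdz (fun q => - F q) p (- A) (- B).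
Proof.
move=> hF j; rewrite !mxE; under [X in has_dz X]eq_fun do rewrite mxE; exact: has_dzN.
Qed.
Lemma has_vdz_cst A p : has_vdz (fun=> A) p 0 0.
Proof. by move=> j; rewrite !mxE; exact: has_dz_cst. Qed.
Lemma has_vdzJ F p A B : has_vdz F p A B -> has_vdz (fun q => conjV (F q)) p (conjV B) (conjV A).
Proof.
move=> hF j; rewrite !mxE; under [X in has_dz X]eq_fun do rewrite mxE; exact: has_dzJ.
Qed.

Lemma smoothV_ext U F G : open U -> (forall q, U q -> F q = G q) -> smoothV U F -> smoothV U G.
Proof. by move=> oU FG sF j; apply: smoothC_ext (sF j) => // q Uq; rewrite FG. Qed.
Lemma smoothVD U F G : open U -> smoothV U F -> smoothV U G -> smoothV U (fun q => F q + G q).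
Proof.
move=> oU sF sG j; under [X in smoothC _ X]eq_fun do rewrite mxE; exact: smoothCD.
Qed.
Lemma smoothVZ U f F : open U -> smoothC U f -> smoothV U F -> smoothV U (fun q => f q *: F q).
Proof.
move=> oU sf sF j; under [X in smoothC _ X]eq_fun do rewrite mxE; exact: smoothCM.
Qed.
Lemma smoothV_cst U A : open U -> smoothV U (fun=> A).
Proof. by move=> oU j; exact: smoothC_cst. Qed.
Lemma smoothVJ U F : open U -> smoothV U F -> smoothV U (fun q => conjV (F q)).
Proof.
move=> oU sF j; under [X in smoothC _ X]eq_fun do rewrite mxE; exact: smoothCJ.
Qed.
Lemma smoothV_has_vdz U F p : smoothV U F -> U p -> has_vdz F p (vdz F p) (vdzb F p).
Proof. by move=> sF Up j; rewrite !mxE; exact: smoothC_has_dz Up. Qed.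
Lemma smoothV_vdz U F : open U -> smoothV U F -> smoothV U (vdz F).
Proof.
move=> oU sF j; under [X in smoothC _ X]eq_fun do rewrite mxE; exact: smoothC_dz.
Qed.
Lemma smoothV_vdzb U F : open U -> smoothV U F -> smoothV U (vdzb F).
Proof.
move=> oU sF j; under [X in smoothC _ X]eq_fun do rewrite mxE; exact: smoothC_dzb.
Qed.

Lemma has_dz_dot F G p A B A' B' : has_vdz F p A B -> has_vdz G p A' B' ->
  has_dz (fun q => dot (F q) (G q)) p (dot A (G p) + dot (F p) A') (dot B (G p) + dot (F p) B').
Proof.
move=> hF hG.
suff H (r : seq 'I_m) : has_dz (fun q => \sum_(j <- r) F q 0 j * G q 0 j) p
    (\sum_(j <- r) (A 0 j * G p 0 j + F p 0 j * A' 0 j))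
    (\sum_(j <- r) (B 0 j * G p 0 j + F p 0 j * B' 0 j)).
  rewrite !dotE -!big_split /=; under [X in has_dz X]eq_fun do rewrite dotE; exact: H.
elim: r => [|j r IH].
  by rewrite !big_nil; under [X in has_dz X]eq_fun do rewrite big_nil; exact: has_dz_cst.
rewrite !big_cons; under [X in has_dz X]eq_fun do rewrite big_cons.
by apply: has_dzD => //; exact: has_dzM.
Qed.

Lemma smoothC_dot U F G : open U -> smoothV U F -> smoothV U G ->
  smoothC U (fun q => dot (F q) (G q)).
Proof.
move=> oU sF sG; under [X in smoothC _ X]eq_fun do rewrite dotE.
elim: (index_enum _) => [|j r IH].
  by under [X in smoothC _ X]eq_fun do rewrite big_nil; exact: smoothC_cst.
under [X in smoothC _ X]eq_fun do rewrite big_cons.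
by apply: smoothCD => //; exact: smoothCM.
Qed.

End Rules.

Section Block.
Context {m k : nat}.

Lemma has_vdz_row_mx (F : plane R -> 'rV[C]_m) (G : plane R -> 'rV[C]_k) p A B A' B' :
  has_vdz F p A B -> has_vdz G p A' B' ->
  has_vdz (fun q => row_mx (F q) (G q)) p (row_mx A A') (row_mx B B').
Proof.
move=> hF hG j; case: (split_ordP j) => i ->.
- by rewrite !row_mxEl; under [X in has_dz X]eq_fun do rewrite row_mxEl.
- by rewrite !row_mxEr; under [X in has_dz X]eq_fun do rewrite row_mxEr.
Qed.

Lemma smoothV_row_mx U (F : plane R -> 'rV[C]_m) (G : plane R -> 'rV[C]_k) :
  smoothV U F -> smoothV U G -> smoothV U (fun q => row_mx (F q) (G q)).
Proof.
move=> hF hG j; case: (split_ordP j) => i ->.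
- by under [X in smoothC _ X]eq_fun do rewrite row_mxEl.
- by under [X in smoothC _ X]eq_fun do rewrite row_mxEr.
Qed.

Lemma has_vdz_scalar_mx f p a b : has_dz f p a b ->
  has_vdz (fun q => (f q)%:M : 'M[C]_1) p a%:M b%:M.
Proof.
move=> h j; rewrite !ord1 !mxE !eqxx !mulr1n.
by under [X in has_dz X]eq_fun do rewrite mxE eqxx mulr1n.
Qed.

Lemma smoothV_scalar_mx U f : smoothC U f -> smoothV U (fun q => (f q)%:M : 'M[C]_1).
Proof.
move=> h j; rewrite !ord1.
by under [X in smoothC _ X]eq_fun do rewrite mxE eqxx mulr1n.
Qed.

End Block.

Context {n : nat}.

Lemma has_vdz_clift (F : plane R -> 'rV[C]_n) f g p A B a b a' b' :
  has_vdz F p A B -> has_dz f p a b -> has_dz g p a' b' ->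
  has_vdz (fun q => clift (F q) (f q) (g q)) p (clift A a a') (clift B b b').
Proof.
move=> hF hf hg; apply: has_vdz_row_mx; last exact: has_vdz_scalar_mx.
by apply: has_vdz_row_mx => //; exact: has_vdz_scalar_mx.
Qed.

Lemma smoothV_clift U (F : plane R -> 'rV[C]_n) f g :
  smoothV U F -> smoothC U f -> smoothC U g -> smoothV U (fun q => clift (F q) (f q) (g q)).
Proof.
move=> hF hf hg; apply: smoothV_row_mx; last exact: smoothV_scalar_mx.
by apply: smoothV_row_mx => //; exact: smoothV_scalar_mx.
Qed.

Lemma has_vdz_mulmxr (M : 'M[C]_n) (F : plane R -> 'rV[C]_n) p A B : has_vdz F p A B ->
  has_vdz (fun q => F q *m M) p (A *m M) (B *m M).
Proof.
move=> hF j.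
have E (v : 'rV[C]_n) : (v *m M) 0 j = dot v (col j M)^T.
  by rewrite /dot trmxK !mxE; apply: eq_bigr => i _; rewrite !mxE.
rewrite !E; under [X in has_dz X]eq_fun do rewrite E.
apply: has_dz_eq (has_dz_dot hF (has_vdz_cst (col j M)^T p)) _ _; by rewrite dot0r addr0.
Qed.

Lemma smoothV_mulmxr U (M : 'M[C]_n) (F : plane R -> 'rV[C]_n) : open U -> smoothV U F ->
  smoothV U (fun q => F q *m M).
Proof.
move=> oU hF j.
have E (v : 'rV[C]_n) : (v *m M) 0 j = dot v (col j M)^T.
  by rewrite /dot trmxK !mxE; apply: eq_bigr => i _; rewrite !mxE.
under [X in smoothC _ X]eq_fun do rewrite E.
by apply: smoothC_dot => //; exact: smoothV_cst.
Qed.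

End VectorCalculus.

Section LorentzCalculus.
Context {R : realType} {n : nat}.
Local Notation C := R[i].
Implicit Types (U : set (plane R)) (p : plane R) (F G : plane R -> 'rV[C]_(n + 1 + 1)).

Lemma has_dz_lor F G p A B A' B' : has_vdz F p A B -> has_vdz G p A' B' ->
  has_dz (fun q => lor (F q) (G q)) p (lor A (G p) + lor (F p) A') (lor B (G p) + lor (F p) B').
Proof. by move=> hF hG; apply: has_dz_dot => //; exact: has_vdz_mulmxr. Qed.

Lemma smoothC_lor U F G : open U -> smoothV U F -> smoothV U G ->
  smoothC U (fun q => lor (F q) (G q)).
Proof. by move=> oU hF hG; apply: smoothC_dot => //; exact: smoothV_mulmxr. Qed.

End LorentzCalculus.

Section RealRows.
Context {R : realType}.
Local Notation C := R[i].
Context {m : nat}.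
Implicit Types (U : set (plane R)) (p : plane R) (Y : plane R -> 'rV[R]_m).

Lemma vdzb_toC Y p : vdzb (fun q => toC (Y q)) p = conjV (vdz (fun q => toC (Y q)) p).
Proof.
apply/rowP => j; rewrite !mxE /dz /dzb /partial.
have E : (fun q => complex.Im (toC (Y q) 0 j)) = cst 0 by apply/funext => q; rewrite mxE.
rewrite E !derive_cst; move: ('D_(e_u R) _ p) ('D_(e_v R) _ p) => a b.
by rewrite !complexr0 !conjcE; ring.
Qed.

Lemma smooth_rowP U Y : open U -> smooth_row U Y <-> smoothV U (fun q => toC (Y q)).
Proof.
move=> oU; split=> h j.
  by under [X in smoothC _ X]eq_fun do rewrite mxE; exact: smoothC_real.
have [+ _] := h j; apply: smooth_ext => // q _; by rewrite mxE.
Qed.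

Lemma vdz_ext k (F G : plane R -> 'rV[C]_k) p : (\forall q \near p, F q = G q) -> vdz F p = vdz G p.
Proof.
move=> FG; apply/rowP => j; rewrite !mxE /dz /partial.
have h1 : \forall q \near p, complex.Re (F q 0 j) = complex.Re (G q 0 j) by apply: filterS FG => q ->.
have h2 : \forall q \near p, complex.Im (F q 0 j) = complex.Im (G q 0 j) by apply: filterS FG => q ->.
by rewrite !(near_eq_derive _ h1) !(near_eq_derive _ h2).
Qed.

Lemma vdzb_ext k (F G : plane R -> 'rV[C]_k) p : (\forall q \near p, F q = G q) -> vdzb F p = vdzb G p.
Proof.
move=> FG; apply/rowP => j; rewrite !mxE /dzb /partial.
have h1 : \forall q \near p, complex.Re (F q 0 j) = complex.Re (G q 0 j) by apply: filterS FG => q ->.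
have h2 : \forall q \near p, complex.Im (F q 0 j) = complex.Im (G q 0 j) by apply: filterS FG => q ->.
by rewrite !(near_eq_derive _ h1) !(near_eq_derive _ h2).
Qed.

(** Writing [Y_z = (u - i v) / 2] with the real partial derivatives [u] and [v], nullity says that
    they are orthogonal of equal length, and [Y_z != 0] makes this length nonzero. The transpose
    divided by [|u|^2] is then a right inverse of the Jacobian. *)
Lemma immersed_of_conformal Y p U : U p -> smooth_row U Y ->
  vdz (fun q => toC (Y q)) p != 0 ->
  dot (vdz (fun q => toC (Y q)) p) (vdz (fun q => toC (Y q)) p) = 0 -> immersed_at Y p.
Proof.
move=> Up sY; set u := \row_j 'D_(e_u R) (fun q => Y q 0 j) p.
set v := \row_j 'D_(e_v R) (fun q => Y q 0 j) p.
have -> : vdz (fun q => toC (Y q)) p = 2^-1 *: (toC u - 'i *: toC v).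
  apply/rowP => j; rewrite !mxE /dz /partial.
  have E : (fun q => complex.Im (toC (Y q) 0 j)) = cst 0 by apply/funext => q; rewrite mxE.
  have E' : (fun q => complex.Re (toC (Y q) 0 j)) = (fun q => Y q 0 j).
    by apply/funext => q; rewrite mxE.
  rewrite E E' !derive_cst !complexr0.
  by move: ('D_(e_u R) _ p) ('D_(e_v R) _ p) => a b; ring.
rewrite /immersed_at -/u -/v; clearbody u v.
move=> nz cf.
have {cf} : dot u u = dot v v /\ dot u v = 0.
  move: cf; rewrite !dot_lin !dot_toC (dotC v u).
  move: (dot u u) (dot v v) (dot u v) => a b c cf.
  have {}cf : a%:C - b%:C - 2 * 'i * c%:C = 0 :> C.
    have -> : a%:C - b%:C - 2 * 'i * c%:C =
       a%:C + ('i * 'i) * b%:C - 2 * 'i * c%:C :> C.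
      by rewrite imag_sqr mulN1r.
    by rewrite -[RHS](mulr0 4) -cf; field.
  have := congr1 (@complex.Re R) cf; have := congr1 (@complex.Im R) cf.
  rewrite imag_unitE !ReImE /= => h1 h2.
  by split; lra.
move=> [uv uv0].
have u0 : dot u u != 0.
  apply: contra nz => /eqP h.
  have z (w : 'rV[R]_m) : dot w w = 0 -> w = 0.
    rewrite dotE => /eqP; rewrite psumr_eq0; last by move=> j _; rewrite -expr2 sqr_ge0.
    move=> /allP hh; apply/rowP => j; rewrite mxE.
    by have := hh j; rewrite mem_index_enum => /(_ isT) /=; rewrite -expr2 sqrf_eq0 => /eqP.
  have toC0 : toC (0 : 'rV[R]_m) = 0 by apply/rowP => j; rewrite !mxE.
  by rewrite (z u h) (z v) -?uv // toC0 scaler0 subr0 scaler0.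
apply/row_freeP.
exists (row_mx ((dot u u)^-1 *: u^T) ((dot u u)^-1 *: v^T)).
have dE (a b : 'rV[R]_m) : a *m b^T = (dot a b)%:M by rewrite [LHS]mx11_scalar.
rewrite mul_col_row -!scalemxAr !dE !scale_scalar_mx (dotC v u) uv0 -uv mulr0 mulVf //.
have -> : (0 : R)%:M = 0 :> 'M[R]_1 by rewrite raddf0.
by rewrite -scalar_mx_block.
Qed.

End RealRows.

(** * Stereographic projection as a section of the light cone *)

Section Stereographic.
Context {R : realType} {n : nat}.
Local Notation C := R[i].
Implicit Types (v : 'rV[R]_n) (U : set (plane R)) (x : plane R -> 'rV[R]_n).

Lemma dot_ge0 m (v : 'rV[R]_m) : 0 <= dot v v.
Proof. by rewrite dotE; apply: sumr_ge0 => j _; rewrite -expr2 sqr_ge0. Qed.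

Lemma stereo_den_gt0 m (v : 'rV[R]_m) : 0 < 1 + dot v v.
Proof. by rewrite ltr_wpDr // dot_ge0. Qed.

Lemma stereo_den_neq0 m (v : 'rV[R]_m) : 1 + dot v v != 0.
Proof. by rewrite gt_eqF // stereo_den_gt0. Qed.

Lemma stereo_denC_neq0 m (v : 'rV[R]_m) : 1 + dot (toC v) (toC v) != 0.
Proof.
rewrite dot_toC -[1]/(1%:C) -rmorphD /=; apply/negP => /eqP/complexI/eqP.
by rewrite (negPf (stereo_den_neq0 v)).
Qed.

Lemma dot_row_mx (K : comNzRingType) m k (a c : 'rV[K]_m) (b d : 'rV[K]_k) :
  dot (row_mx a b) (row_mx c d) = dot a c + dot b d.
Proof. by rewrite /dot tr_row_mx mul_row_col mxE. Qed.

Lemma dot_scalar_mx (K : comNzRingType) (a b : K) : dot (a%:M : 'M[K]_1) b%:M = a * b.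
Proof. by rewrite /dot tr_scalar_mx -scalar_mxM mxE eqxx mulr1n. Qed.

Lemma dot_inv_stereo v : dot (inv_stereo v) (inv_stereo v) = 1.
Proof.
rewrite /inv_stereo dotZl dotZr dot_row_mx dot_scalar_mx dotZl dotZr.
have := stereo_den_neq0 v; move: (dot v v) => q q0; field; exact: q0.
Qed.

(** The parabolic section of the light cone: a light-like vector over the stereographic image of [v]
    that is polynomial in [v], with no denominator to differentiate. *)
Definition cone_lift (K : fieldType) (v : 'rV[K]_n) : 'rV[K]_(n + 1 + 1) :=
  clift v ((dot v v - 1) / 2) ((dot v v + 1) / 2).

Lemma cone_inv_stereo v : cone (inv_stereo v) = (2 / (1 + dot v v)) *: cone_lift v.
Proof.
have q0 := stereo_den_neq0 v.
rewrite /cone /inv_stereo /cone_lift /clift !scale_row_mx !scale_scalar_mx scalerA.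
move: q0; move: (dot v v) => q q0.
congr (row_mx (row_mx _ _) _).
- by congr (_ *: _); field.
- by congr (_%:M); field.
- by congr (_%:M); field.
Qed.

Lemma toC_inv_stereo v : toC (inv_stereo v) =
  row_mx ((2 / (1 + dot (toC v) (toC v))) *: toC v) ((1 - 2 / (1 + dot (toC v) (toC v)))%:M).
Proof.
have q0 := stereo_den_neq0 v; have := stereo_denC_neq0 v.
rewrite dot_toC => q0'.
have -> : inv_stereo v = row_mx ((2 / (1 + dot v v)) *: v) ((1 - 2 / (1 + dot v v))%:M).
  rewrite /inv_stereo scale_row_mx scalerA scale_scalar_mx; move: (dot v v) q0 {q0'} => q q0.
  by congr row_mx; [congr (_ *: _); field|congr (_%:M); field].
have kE : (2 / (1 + dot v v))%:C = 2 / (1 + (dot v v)%:C) :> C.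
  by rewrite fmorph_div !rmorphD rmorph1.
rewrite /toC map_row_mx map_scalar_mx -/(toC _) toCZ -kE; congr (row_mx _ _%:M).
exact: (rmorphB (real_complex R) 1 _).
Qed.

(** The differential of inverse stereographic projection at [xc] applied to [A]; [k] is the
    conformal factor and [kz] its derivative in the direction [A]. *)
Definition stereo_dz (xc A : 'rV[C]_n) : 'rV[C]_(n + 1) :=
  let k := 2 / (1 + dot xc xc) in let kz := - k ^+ 2 * dot xc A in
  row_mx (kz *: xc + k *: A) (- kz)%:M.

Lemma has_vdz_inv_stereo x p A : has_vdz (fun q => toC (x q)) p A (conjV A) ->
  has_vdz (fun q => toC (inv_stereo (x q))) p (stereo_dz (toC (x p)) A)
    (conjV (stereo_dz (toC (x p)) A)).
Proof.
move=> hx.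
suff : exists B, has_vdz (fun q => toC (inv_stereo (x q))) p (stereo_dz (toC (x p)) A) B.
  move=> [B hB]; have := vdzb_toC (fun q => inv_stereo (x q)) p.
  by rewrite (has_vdz_vdzb hB) (has_vdz_vdz hB) => <-.
have q0 := stereo_denC_neq0 (x p).
have hq := has_dzD (has_dz_cst 1 p) (has_dz_dot hx hx).
have hk := has_dzZ 2 (has_dzV q0 hq).
have := has_vdz_row_mx (has_vdzZ hk hx) (has_vdz_scalar_mx (has_dzB (has_dz_cst 1 p) hk)).
under [X in has_vdz X]eq_fun do rewrite -toC_inv_stereo.
set B := row_mx _ _; set B' := row_mx _ _ => h; exists B'; apply: has_vdz_eq h _ erefl.
rewrite /B /stereo_dz (dotC A); move: (dot _ _) (dot _ A) q0 => q a q0.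
by congr (row_mx (_ *: _ + _) _%:M); field.
Qed.

(** Conformality of stereographic projection: in general the square is [k^2] times that of [A]. *)
Lemma dot_stereo_dz v A : dot A A = 0 -> dot (stereo_dz (toC v) A) (stereo_dz (toC v) A) = 0.
Proof.
move=> A0; rewrite /stereo_dz /= dot_row_mx dot_scalar_mx !dot_lin A0 (dotC A).
have := stereo_denC_neq0 v; move: (dot _ _) (dot _ A) => q a q0; by field.
Qed.

Lemma stereo_dz_neq0 v A : A != 0 -> stereo_dz (toC v) A != 0.
Proof.
have q0 := stereo_denC_neq0 v.
apply: contra => /eqP; rewrite /stereo_dz /=; set k := 2 / _; set kz := - _ * _.
rewrite -[0](@row_mx0 _ 1 n 1) => /eq_row_mx[h1 h2].
have kz0 : kz = 0.
  have := congr1 (fun M : 'M[C]_1 => M 0 0) h2; rewrite !mxE eqxx mulr1n => /eqP.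
  by rewrite oppr_eq0 => /eqP.
move: h1; rewrite kz0 scale0r add0r => /eqP; rewrite scaler_eq0 => /orP[|//].
by rewrite /k mulf_eq0 invr_eq0 (negPf q0) orbF pnatr_eq0.
Qed.

Lemma smooth_inv_stereo U x : open U -> smooth_row U x ->
  smooth_row U (fun p => inv_stereo (x p)).
Proof.
move=> oU sx; apply/smooth_rowP => //; have {}sx := (smooth_rowP x oU).1 sx.
under [X in smoothV _ X]eq_fun do rewrite toC_inv_stereo.
have sk : smoothC U (fun p => 2 / (1 + dot (toC (x p)) (toC (x p)))).
  apply: smoothCM => //; first exact: smoothC_cst.
  apply: smoothCV => // [|p _]; last exact: stereo_denC_neq0.
  by apply: smoothCD => //; [exact: smoothC_cst|exact: smoothC_dot].
apply: smoothV_row_mx; first exact: smoothVZ.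
by apply: smoothV_scalar_mx; apply: smoothCB => //; exact: smoothC_cst.
Qed.

Lemma has_vdz_toC m (y : plane R -> 'rV[R]_m) U p : open U -> smooth_row U y -> U p ->
  has_vdz (fun q => toC (y q)) p (vdz (fun q => toC (y q)) p) (conjV (vdz (fun q => toC (y q)) p)).
Proof.
move=> oU sy Up; have sy' := (smooth_rowP y oU).1 sy.
by rewrite -vdzb_toC; exact: smoothV_has_vdz Up.
Qed.

Lemma conformal_immersion_inv_stereo U x : open U -> smooth_row U x ->
  (forall p, U p -> vdz (fun q => toC (x q)) p != 0) ->
  (forall p, U p -> dot (vdz (fun q => toC (x q)) p) (vdz (fun q => toC (x q)) p) = 0) ->
  conformal_immersion U (fun p => inv_stereo (x p)).
Proof.
move=> oU sx nz cf; have sy := smooth_inv_stereo oU sx.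
have E p : U p -> vdz (fun q => toC (inv_stereo (x q))) p =
    stereo_dz (toC (x p)) (vdz (fun q => toC (x q)) p).
  by move=> Up; apply: has_vdz_vdz (has_vdz_inv_stereo _); exact: (has_vdz_toC oU sx Up).
split=> // p Up; first exact: dot_inv_stereo.
- apply: (immersed_of_conformal Up sy); rewrite (E _ Up).
    by apply: stereo_dz_neq0; exact: nz.
  by apply: dot_stereo_dz; exact: cf.
- by rewrite (E _ Up); apply: dot_stereo_dz; exact: cf.
Qed.

End Stereographic.

(** * The moving frame carried by the polynomial lift *)

Section MovingFrame.
Context {R : realType} {n : nat}.
Local Notation C := R[i].
Implicit Types (v w xc : 'rV[C]_n) (a b c : C).

(* The null vector of the point at infinity. *)
Definition null_infty : 'rV[C]_(n + 1 + 1) := clift 0 1 1.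

(** The differential of [cone_lift] at [xc] in the direction [w]. *)
Definition tangent_lift xc w : 'rV[C]_(n + 1 + 1) := clift w (dot xc w) (dot xc w).

(* Locked: unification would otherwise unfold the blocks. *)
Definition moving xc a w c : 'rV[C]_(n + 1 + 1) :=
  locked (a *: cone_lift xc + tangent_lift xc w + c *: null_infty).

Lemma movingE xc a w c :
  moving xc a w c = a *: cone_lift xc + tangent_lift xc w + c *: null_infty.
Proof. by rewrite /moving -lock. Qed.

Lemma tangent_liftD xc w w' : tangent_lift xc (w + w') = tangent_lift xc w + tangent_lift xc w'.
Proof. by rewrite /tangent_lift !dotDr cliftD. Qed.

Lemma tangent_liftZ xc k w : tangent_lift xc (k *: w) = k *: tangent_lift xc w.
Proof. by rewrite /tangent_lift cliftZ !dotZr. Qed.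

Lemma tangent_lift0 xc : tangent_lift xc 0 = 0.
Proof. by rewrite -(scale0r (0 : 'rV[C]_n)) tangent_liftZ scale0r. Qed.

Lemma movingD xc a w c a' w' c' :
  moving xc a w c + moving xc a' w' c' = moving xc (a + a') (w + w') (c + c').
Proof.
rewrite !movingE tangent_liftD.
move: (cone_lift _) null_infty (tangent_lift _ w) (tangent_lift _ w') => u v t t'.
by apply/rowP => j; rewrite !mxE; ring.
Qed.

Lemma movingZ xc k a w c : k *: moving xc a w c = moving xc (k * a) (k *: w) (k * c).
Proof.
rewrite !movingE tangent_liftZ.
move: (cone_lift _) null_infty (tangent_lift _ w) => u v t.
by apply/rowP => j; rewrite !mxE; ring.
Qed.

(** The polynomial lift and [null_infty] are light-like with product -1, and lifted tangent vectors
    are orthogonal to both. The base point therefore drops out of all inner products. *)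
Lemma lor_moving xc a w c a' w' c' :
  lor (moving xc a w c) (moving xc a' w' c') = dot w w' - a * c' - c * a'.
Proof.
rewrite !movingE /cone_lift /tangent_lift /null_infty !cliftZ !cliftD lor_clift !dot_lin.
rewrite !(dotC w) !(dotC _ xc) !(dotC w').
move: (dot xc xc) (dot xc w) (dot xc w') (dot w' w) => q d d' e; by field.
Qed.

(** The second-order Taylor expansion, exact because the lift is quadratic. It recognises a vector
    computed in the frame at [xc] as the lift of the displaced point [xc + w]. *)
Lemma cone_liftD xc w : cone_lift (xc + w) = moving xc 1 w (dot w w / 2).
Proof.
rewrite !movingE /cone_lift /tangent_lift /null_infty !cliftZ !cliftD !dot_lin (dotC w xc).
rewrite scale1r scaler0 addr0; move: (dot _ _) (dot _ _) (dot _ _) => q d e.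
by congr clift; field.
Qed.

Lemma moving_eq xc a w c a' w' c' : a = a' -> w = w' -> c = c' ->
  moving xc a w c = moving xc a' w' c'.
Proof. by move=> -> -> ->. Qed.

Lemma moving_comb xc k a w c a' w' c' :
  k *: moving xc a w c + moving xc a' w' c' = moving xc (k * a + a') (k *: w + w') (k * c + c').
Proof. by rewrite movingZ movingD. Qed.

Lemma toC_cone_lift (x : 'rV[R]_n) : toC (cone_lift x) = cone_lift (toC x).
Proof.
rewrite /cone_lift clift_toC dot_toC; congr clift.
  by rewrite fmorph_div rmorphB rmorph1 (rmorph_nat (real_complex R) 2).
by rewrite fmorph_div rmorphD rmorph1 (rmorph_nat (real_complex R) 2).
Qed.

Lemma conjV_cone_lift (x : 'rV[R]_n) : conjV (cone_lift (toC x)) = cone_lift (toC x) :> 'rV[C]__.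
Proof.
rewrite /cone_lift clift_conj conjV_toC dot_toC.
by congr clift; rewrite !conjcE.
Qed.

Lemma conjV_tangent_lift (x : 'rV[R]_n) w :
  conjV (tangent_lift (toC x) w) = tangent_lift (toC x) (conjV w).
Proof. by rewrite /tangent_lift clift_conj -{3 4}(conjV_toC x) -dot_conj. Qed.

Lemma conjV_null_infty : conjV null_infty = null_infty.
Proof. by rewrite /null_infty clift_conj conjV0 conjc1. Qed.

Lemma conjV_moving (x : 'rV[R]_n) a w c :
  conjV (moving (toC x) a w c) = moving (toC x) (a^*) (conjV w) (c^*).
Proof.
have E (u t v : 'rV[C]_(n + 1 + 1)) :
  conjV (a *: u + t + c *: v) = a^* *: conjV u + conjV t + c^* *: conjV v.
  by apply/rowP => j; rewrite !mxE !conjcE.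
rewrite !movingE -conjV_tangent_lift -{2}conjV_cone_lift -{2}conjV_null_infty; exact: E.
Qed.

Lemma has_vdz_cone_lift (F : plane R -> 'rV[C]_n) p A B : has_vdz F p A B ->
  has_vdz (fun q => cone_lift (F q)) p (tangent_lift (F p) A) (tangent_lift (F p) B).
Proof.
move=> hF; have hq := has_dz_dot hF hF.
have h2 := has_dz_cst (2^-1 : C) p; have h1 := has_dz_cst (1 : C) p.
apply: has_vdz_eq (has_vdz_clift hF (has_dzM (has_dzB hq h1) h2) (has_dzM (has_dzD hq h1) h2)) _ _;
  rewrite /tangent_lift (dotC _ (F p)); move: (dot (F p) _) (dot (F p) _) => d e;
  by congr clift; field.
Qed.

(** The structure equations of the frame: the lift differentiates to a tangent vector, and a tangent
    vector [w] acquires the extra component [<X, w>] along the constant vector [null_infty]. *)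
Lemma has_vdz_moving (x : plane R -> 'rV[C]_n) (w : plane R -> 'rV[C]_n) (f g : plane R -> C) p
    X X' A B a b c d :
  has_vdz x p X X' -> has_dz f p a b -> has_vdz w p A B -> has_dz g p c d ->
  has_vdz (fun q => moving (x q) (f q) (w q) (g q)) p
    (moving (x p) a (f p *: X + A) (c + dot X (w p)))
    (moving (x p) b (f p *: X' + B) (d + dot X' (w p))).
Proof.
move=> hx hf hw hg; have hd := has_dz_dot hx hw.
have h := has_vdzD (has_vdzD (has_vdzZ hf (has_vdz_cone_lift hx)) (has_vdz_clift hw hd hd))
  (has_vdzZ hg (has_vdz_cst null_infty p)).
have mE : (fun q => moving (x q) (f q) (w q) (g q)) =
    (fun q => f q *: cone_lift (x q) + tangent_lift (x q) (w q) + g q *: null_infty).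
  by apply/funext => q; exact: movingE.
have E k (X1 A1 : 'rV[C]_n) e : k *: cone_lift (x p) + f p *: tangent_lift (x p) X1 +
    clift A1 (dot X1 (w p) + dot (x p) A1) (dot X1 (w p) + dot (x p) A1) + (e *: null_infty + g p *: 0)
    = moving (x p) k (f p *: X1 + A1) (e + dot X1 (w p)).
  have T : clift A1 (dot X1 (w p) + dot (x p) A1) (dot X1 (w p) + dot (x p) A1) =
      tangent_lift (x p) A1 + dot X1 (w p) *: null_infty.
    rewrite (addrC (dot X1 _)) /null_infty (cliftZ (dot X1 (w p))) /tangent_lift cliftD.
    by rewrite scaler0 addr0 mulr1.
  rewrite T movingE tangent_liftD tangent_liftZ.
  move: (cone_lift _) (tangent_lift _ X1) (tangent_lift _ A1) null_infty (dot X1 _) (f p) (g p) => u t t' v d' f' g'.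
  by apply/rowP => j; rewrite !mxE; ring.
by rewrite mE; apply: has_vdz_eq h _ _; rewrite E.
Qed.

Lemma smoothV_moving U (x w : plane R -> 'rV[C]_n) (f g : plane R -> C) : open U ->
  smoothV U x -> smoothC U f -> smoothV U w -> smoothC U g ->
  smoothV U (fun q => moving (x q) (f q) (w q) (g q)).
Proof.
move=> oU sx sf sw sg; have sd := smoothC_dot oU sx sw; have sq := smoothC_dot oU sx sx.
have s1 k := smoothC_cst (k : C) oU.
apply: (smoothV_ext oU (F := fun q => f q *: cone_lift (x q) + tangent_lift (x q) (w q) +
  g q *: null_infty)) => [q _|]; first by rewrite movingE.
apply: smoothVD => //; last by apply: smoothVZ => //; exact: smoothV_cst.
apply: smoothVD => //; last exact: smoothV_clift.
apply: smoothVZ => //; apply: smoothV_clift => //; apply: smoothCM => //.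
- exact: smoothCB.
- exact: smoothCD.
Qed.

End MovingFrame.

(** * Minimal surfaces and their adjoint transforms *)

Section MinimalSurface.
Context {R : realType} {n : nat}.
Local Notation C := R[i].

Variables (U : set (plane R)) (x0 : 'rV[R]_n) (Psi phi phi1 : plane R -> 'rV[C]_n).
Hypothesis oU : open U.
Hypothesis sPsi : smoothV U Psi.
Hypothesis dPsi : forall p, U p -> has_vdz Psi p (phi p) 0.
Hypothesis dphi : forall p, U p -> has_vdz phi p (phi1 p) 0.
Hypothesis dphi1 : forall p, U p -> exists phi2, has_vdz phi1 p phi2 0.
Hypothesis phi00 : forall p, U p -> dot (phi p) (phi p) = 0.
Hypothesis phi01 : forall p, U p -> dot (phi p) (phi1 p) = 0.
Hypothesis phi11 : forall p, U p -> dot (phi1 p) (phi1 p) = 0.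
Hypothesis phi_neq0 : forall p, U p -> phi p != 0.

Definition surf (p : plane R) : 'rV[R]_n := x0 + 2 *: reC (Psi p).

Lemma toC_surf p : toC (surf p) = toC x0 + Psi p + conjV (Psi p).
Proof.
rewrite /surf toCD toCZ -addrA; congr (_ + _); rewrite -toC_reC; congr (_ *: _).
exact: (rmorph_nat (real_complex R) 2).
Qed.

Lemma smooth_phi : smoothV U phi.
Proof.
apply: (smoothV_ext oU _ (smoothV_vdz oU sPsi)) => p Up; exact: has_vdz_vdz (dPsi Up).
Qed.

Lemma smooth_phi1 : smoothV U phi1.
Proof.
apply: (smoothV_ext oU _ (smoothV_vdz oU smooth_phi)) => p Up; exact: has_vdz_vdz (dphi Up).
Qed.

Lemma smooth_surfC : smoothV U (fun p => toC (surf p)).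
Proof.
apply: (smoothV_ext oU (F := fun p => toC x0 + Psi p + conjV (Psi p))) => [p _|].
  by rewrite toC_surf.
apply: smoothVD => //; last exact: smoothVJ.
by apply: smoothVD => //; exact: smoothV_cst.
Qed.

Lemma smooth_surf : smooth_row U surf.
Proof. exact/smooth_rowP/smooth_surfC. Qed.

Lemma has_vdz_surf p : U p -> has_vdz (fun q => toC (surf q)) p (phi p) (conjV (phi p)).
Proof.
move=> Up; have h := has_vdzD (has_vdzD (has_vdz_cst (toC x0) p) (dPsi Up)) (has_vdzJ (dPsi Up)).
have E : (fun q => toC (surf q)) = (fun q => toC x0 + Psi q + conjV (Psi q)).
  by apply/funext => q; exact: toC_surf.
by rewrite E; apply: has_vdz_eq h _ _; rewrite ?conjV0 ?add0r ?addr0.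
Qed.

Let r p := hdot (phi p) (phi p).
Let theta p := hdot (phi1 p) (phi p) / r p.
Let sigma p : R := (Num.sqrt (2 * complex.Re (r p)))^-1.
Let sg p : C := (sigma p)%:C.

Lemma r_real p : r p = (complex.Re (r p))%:C.
Proof. by have /ger0_Im := hdot_ge0 (phi p); rewrite -/(r p); case: (r p) => a b /= ->. Qed.

Lemma r_conj p : (r p)^* = r p.
Proof. by rewrite r_real conjc_real. Qed.

Lemma Re_r_gt0 p : U p -> 0 < complex.Re (r p).
Proof. by move=> Up; have := hdot_gt0 (phi_neq0 Up); rewrite -/(r p) r_real ltcR. Qed.

Lemma r_neq0 p : U p -> r p != 0.
Proof. by move=> Up; rewrite gt_eqF // hdot_gt0 // phi_neq0. Qed.

Lemma sigma_gt0 p : U p -> 0 < sigma p.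
Proof. by move=> Up; rewrite invr_gt0 sqrtr_gt0 mulr_gt0 // Re_r_gt0. Qed.

Lemma sg_neq0 p : U p -> sg p != 0.
Proof.
move=> Up; rewrite /sg; apply/negP => /eqP/(@complexI R)/eqP.
by rewrite gt_eqF // sigma_gt0.
Qed.

Lemma sg_sq p : U p -> sg p * sg p * (2 * r p) = 1.
Proof.
move=> Up; have h : sigma p * sigma p * (2 * complex.Re (r p)) = 1.
  have r0 : 0 < 2 * complex.Re (r p) by rewrite mulr_gt0 // Re_r_gt0.
  rewrite /sigma -invfM -expr2 sqr_sqrtr ?ltW // mulVf // gt_eqF //.
rewrite r_real /sg -[RHS]/((1 : R)%:C) -h !rmorphM /=.
by congr (_ * (_ * _)); rewrite (rmorph_nat (real_complex R) 2).
Qed.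

Lemma smooth_r : smoothC U r.
Proof. by apply: smoothC_dot => //; [exact: smooth_phi|exact/smoothVJ/smooth_phi]. Qed.

Lemma smooth_sg : smoothC U sg.
Proof.
apply: smoothC_real => //; apply: smooth_inv => // [|p Up]; last first.
  by rewrite gt_eqF // sqrtr_gt0 mulr_gt0 // Re_r_gt0.
apply: smooth_sqrt => // [|p Up]; last by rewrite mulr_gt0 // Re_r_gt0.
by apply: smoothM => //; [exact: smooth_cst|have [] := smooth_r].
Qed.

Lemma smooth_theta : smoothC U theta.
Proof.
apply: smoothCM => //.
  by apply: smoothC_dot => //; [exact: smooth_phi1|exact/smoothVJ/smooth_phi].
by apply: smoothCV => //; [exact: smooth_r|exact: r_neq0].
Qed.

Lemma theta_r p : U p -> hdot (phi1 p) (phi p) = theta p * r p.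
Proof. by move=> Up; rewrite /theta divfK // r_neq0. Qed.

Lemma theta_rJ p : U p -> dot (conjV (phi1 p)) (phi p) = (theta p)^* * r p.
Proof.
by move=> Up; rewrite -(r_conj p) -conjcM -theta_r // /hdot -dot_conj conjVK.
Qed.

Lemma has_dz_r p : U p -> has_dz r p (theta p * r p) ((theta p)^* * r p).
Proof.
move=> Up; apply: has_dz_eq (has_dz_dot (dphi Up) (has_vdzJ (dphi Up))) _ _.
  by rewrite conjV0 dot0r addr0; exact: theta_r.
by rewrite dot0l add0r dotC; exact: theta_rJ.
Qed.

(** Obtained by differentiating the normalisation [2 r sg^2 = 1] and dividing, instead of
    differentiating the square root. *)
Lemma has_dz_sg p : U p -> has_dz sg p (- theta p * sg p / 2) (- (theta p)^* * sg p / 2).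
Proof.
move=> Up; have hs := smoothC_has_dz smooth_sg Up.
have h1 := has_dzM (has_dzM hs hs) (has_dzZ 2 (has_dz_r Up)).
have hc : has_dz (fun q => sg q * sg q * (2 * r q)) p 0 0.
  apply: has_dz_ext (has_dz_cst 1 p); apply: (nbhs_eq_on oU Up) => q Uq.
  by rewrite sg_sq.
have s0 := sg_neq0 Up; have r0 := r_neq0 Up.
have e1 := has_dz_dz h1; rewrite (has_dz_dz hc) in e1.
have e2 := has_dz_dzb h1; rewrite (has_dz_dzb hc) in e2.
have key (a t : C) : 0 = (a * sg p + sg p * a) * (2 * r p) + sg p * sg p * (2 * (t * r p)) ->
    a = - t * sg p / 2.
  move: (sg p) (r p) s0 r0 => u v u0 v0 h.
  have : u * v * (2 * a + t * u) = 0.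
    by rewrite -[RHS](mulr0 (2^-1 : C)) h; field.
  move/eqP; rewrite !mulf_eq0 (negPf u0) (negPf v0) /= => /eqP h'.
  have -> : a = (2 * a + t * u) / 2 - t * u / 2 by field.
  by rewrite h' mul0r sub0r !mulNr.
by apply: has_dz_eq hs _ _; apply: key.
Qed.

End MinimalSurface.

(** * The conformal invariants of a minimal surface and its adjoint transforms *)

Section MinimalFrame.
Context {R : realType} {n : nat}.
Local Notation C := R[i].

Variables (U : set (plane R)) (surf : plane R -> 'rV[R]_n) (phi phi1 : plane R -> 'rV[C]_n).
Variables (r theta theta1 lam sg : plane R -> C) (sigma : plane R -> R).
Hypothesis oU : open U.
Hypothesis smooth_surf : smooth_row U surf.
Hypothesis has_vdz_surf : forall p, U p ->
  has_vdz (fun q => toC (surf q)) p (phi p) (conjV (phi p)).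
Hypothesis dphi : forall p, U p -> has_vdz phi p (phi1 p) 0.
Hypothesis dphi1 : forall p, U p -> exists phi2, has_vdz phi1 p phi2 0.
Hypothesis phi00 : forall p, U p -> dot (phi p) (phi p) = 0.
Hypothesis phi01 : forall p, U p -> dot (phi p) (phi1 p) = 0.
Hypothesis phi11 : forall p, U p -> dot (phi1 p) (phi1 p) = 0.
Hypothesis hdot_phi : forall p, dot (phi p) (conjV (phi p)) = r p.
Hypothesis theta_r : forall p, U p -> dot (phi1 p) (conjV (phi p)) = theta p * r p.
Hypothesis theta_rJ : forall p, U p -> dot (conjV (phi1 p)) (phi p) = (theta p)^* * r p.
Hypothesis smooth_theta : smoothC U theta.
Hypothesis has_dz_theta : forall p, U p -> has_dz theta p (theta1 p) (lam p).
Hypothesis has_dz_thetaJ : forall p, U p -> has_dz (fun q => (theta q)^*) p ((lam p)^*) ((theta1 p)^*).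
Hypothesis sigma_gt0 : forall p, U p -> 0 < sigma p.

Hypothesis sgE : forall p, sg p = (sigma p)%:C.
Hypothesis smooth_sg : smooth U sigma.
Hypothesis sg_sq : forall p, U p -> sg p * sg p * (2 * r p) = 1.
Hypothesis has_dz_sg : forall p, U p ->
  has_dz sg p (- theta p * sg p / 2) (- (theta p)^* * sg p / 2).

(* With the induced metric [e^(2 omega) |dz|^2], [sigma = e^-omega] and [theta = 2 omega_z]. *)
Let s p : C := theta1 p - theta p ^+ 2 / 2.
Let Y p : 'rV[R]_(n + 1 + 1) := sigma p *: cone_lift (surf p).
Let mv p := moving (toC (surf p)).
Let kappa p := mv p 0 (sg p *: (phi1 p - theta p *: phi p)) 0.
Let NC p := mv p (theta p * (theta p)^* * sg p / 2)
  (- (theta p)^* * sg p *: phi p - theta p * sg p *: conjV (phi p)) (sg p)^-1.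
Let N p : 'rV[R]_(n + 1 + 1) := reC (NC p).

Lemma sg_neq0' p : U p -> sg p != 0.
Proof.
move=> Up; rewrite sgE; apply/negP => /eqP/(@complexI R)/eqP.
by rewrite gt_eqF // sigma_gt0.
Qed.

Lemma sg_conj' p : (sg p)^* = sg p. Proof. by rewrite sgE; exact: conjc_real. Qed.

Lemma Y_moving p : toC (Y p) = mv p (sg p) 0 0.
Proof.
rewrite /Y toCZ -sgE /mv movingE; rewrite (toC_cone_lift (surf p)).
rewrite (tangent_lift0 (toC (surf p))).
move: (cone_lift _) null_infty => u v; by rewrite addr0 scale0r addr0.
Qed.

Lemma has_vdz_Y p : U p -> has_vdz (fun q => toC (Y q)) p
  (mv p (- theta p * sg p / 2) (sg p *: phi p) 0)
  (mv p (- (theta p)^* * sg p / 2) (sg p *: conjV (phi p)) 0).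
Proof.
move=> Up.
have h := has_vdz_moving (has_vdz_surf Up) (has_dz_sg Up) (has_vdz_cst 0 p) (has_dz_cst 0 p).
have E : (fun q => toC (Y q)) = (fun q => moving (toC (surf q)) (sg q) 0 0).
  by apply/funext => q; exact: Y_moving.
by rewrite E; apply: has_vdz_eq h _ _; rewrite /mv !dot0r !addr0.
Qed.

Lemma vdz_Y p : U p -> vdz (fun q => toC (Y q)) p = mv p (- theta p * sg p / 2) (sg p *: phi p) 0.
Proof. by move=> Up; exact: has_vdz_vdz (has_vdz_Y Up). Qed.

(** The component of [Y_zz] along [null_infty] is a multiple of [<phi, phi>] and vanishes; that of
    [Y_zzbar] is [sg * r]. Subtracting [theta * phi] from [phi1] is what separates [kappa] from the
    multiple of [Y]. *)
Lemma has_vdz_Y1 p : U p -> has_vdz (vdz (fun q => toC (Y q))) p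
  (- (s p / 2) *: toC (Y p) + kappa p)
  (mv p (theta p * (theta p)^* * sg p / 4 - lam p * sg p / 2)
     (- theta p * sg p / 2 *: conjV (phi p) - (theta p)^* * sg p / 2 *: phi p) (sg p * r p)).
Proof.
move=> Up; have ht := has_dz_theta Up; have hs := has_dz_sg Up.
have ha := has_dzM (has_dzM (has_dzN ht) hs) (has_dz_cst (2^-1 : C) p).
have h := has_vdz_moving (has_vdz_surf Up) ha (has_vdzZ hs (dphi Up)) (has_dz_cst 0 p).
have nE : \forall q \near p, moving (toC (surf q)) (- theta q * sg q / 2) (sg q *: phi q) 0 =
    vdz (fun q => toC (Y q)) q.
  by apply: (nbhs_eq_on oU Up) => q Uq; rewrite vdz_Y.
apply: has_vdz_eq (has_vdz_ext nE h) _ _.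
  apply: (etrans _ (esym (etrans (congr1 (fun v => - (s p / 2) *: v + kappa p) (Y_moving p))
    (moving_comb _ _ _ _ _ _ _ _)))); apply: moving_eq.
  - by rewrite /s; field.
  - by apply/rowP => j; rewrite !mxE; move: (phi p _ _) (phi1 p _ _) => a b; field.
  - by rewrite dotZr phi00 // !mulr0 !addr0.
apply: moving_eq.
- by field.
- by apply/rowP => j; rewrite !mxE; move: (phi p _ _) => a; field.
- by rewrite dotZr (dotC _ (phi p)) hdot_phi add0r.
Qed.

(** As [phi] and [phi1] are holomorphic, only [sg] and [theta] contribute to the zbar-derivative of
    the coefficients. The component along [null_infty] vanishes because [theta] makes
    [phi1 - theta phi] Hermitian-orthogonal to [phi]. *)
Lemma has_vdz_kappa p : U p -> exists A, has_vdz kappa p A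
  (- ((theta p)^* / 2) *: kappa p + mv p 0 (- (lam p * sg p) *: phi p) 0).
Proof.
move=> Up; have ht := has_dz_theta Up; have hs := has_dz_sg Up.
have [phi2 dphi2] := dphi1 Up.
have h := has_vdz_moving (has_vdz_surf Up) (has_dz_cst 0 p)
  (has_vdzZ hs (has_vdzD dphi2 (has_vdzN (has_vdzZ ht (dphi Up))))) (has_dz_cst 0 p).
eexists; apply: has_vdz_eq h erefl _.
apply: (etrans _ (esym (moving_comb _ _ _ _ _ _ _ _))).
have -> : dot (conjV (phi p)) (sg p *: (phi1 p - theta p *: phi p)) = 0.
  rewrite !dot_lin (dotC _ (phi1 p)) theta_r // (dotC _ (phi p)) hdot_phi.
  by rewrite subrr mulr0.
apply: moving_eq; try by ring.
by apply/rowP => j; rewrite !mxE; move: (phi p _ _) (phi1 p _ _) => a b; field.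
Qed.

Lemma conjV_vdz_Y p : U p ->
  conjV (vdz (fun q => toC (Y q)) p) = mv p (- (theta p)^* * sg p / 2) (sg p *: conjV (phi p)) 0.
Proof. by move=> Up; rewrite -vdzb_toC (has_vdz_vdzb (has_vdz_Y Up)). Qed.

Lemma toC_N p : U p -> toC (N p) = NC p.
Proof.
move=> Up; apply: toC_real; apply: (etrans (conjV_moving _ _ _ _)); apply: moving_eq.
- by rewrite !conjcE sg_conj'; ring.
- by apply/rowP => j; rewrite !mxE !conjcE sg_conj'; ring.
- by rewrite conjc_inv sg_conj'.
Qed.

Lemma sgV p : U p -> (sg p)^-1 = 2 * (sg p * r p).
Proof.
move=> Up; have := sg_neq0' Up; have := sg_sq Up; move: (sg p) (r p) => u v h u0.
by apply: (mulfI u0); rewrite mulfV // -[LHS]h; ring.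
Qed.

Lemma minimal_gram p : U p ->
  [/\ lor (toC (Y p)) (toC (Y p)) = 0,
      lor (toC (Y p)) (vdz (fun q => toC (Y q)) p) = 0,
      lor (vdz (fun q => toC (Y q)) p) (vdz (fun q => toC (Y q)) p) = 0,
      lor (vdz (fun q => toC (Y q)) p) (conjV (vdz (fun q => toC (Y q)) p)) = 2^-1 &
      lor (toC (Y p)) (vdzb (vdz (fun q => toC (Y q))) p) = - 2^-1].
Proof.
move=> Up; rewrite (conjV_vdz_Y Up) (vdz_Y Up) (has_vdz_vdzb (has_vdz_Y1 Up)) (Y_moving p).
have half : 2^-1 = (sg p * sg p * (2 * r p)) / 2 :> C by rewrite (sg_sq Up) mul1r.
split; apply: (etrans (lor_moving _ _ _ _ _ _ _)).
- by rewrite dot0l; ring.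
- by rewrite dot0l; ring.
- by rewrite dotZr dotZl (phi00 Up); ring.
- by rewrite dotZr dotZl hdot_phi half; field.
- by rewrite dot0l half; field.
Qed.

Lemma scale_Y p k : k *: toC (Y p) = mv p (k * sg p) 0 0.
Proof. by rewrite Y_moving; apply: (etrans (movingZ _ _ _ _ _)); rewrite scaler0 mulr0. Qed.

Lemma N_Vspace p : U p -> (toC (N p) <= Vspace Y p)%MS.
Proof.
(* Here [N = 2 Y_zzbar + theta_zbar Y]. *)
move=> Up; apply/VspaceP; exists (lam p), 0, 0, 2.
rewrite (toC_N Up) (has_vdz_vdzb (has_vdz_Y1 Up)) (scale_Y p).
move: (vdz _ p) => v; rewrite (scale0r v) (scale0r (conjV v)) addr0 addr0.
apply: (etrans _ (esym (etrans (congr1 _ (movingZ _ _ _ _ _)) (movingD _ _ _ _ _ _ _)))).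
apply: moving_eq.
- by field.
- by apply/rowP => j; rewrite !mxE; move: (phi p _ _) => a; field.
- by rewrite (sgV Up) add0r.
Qed.

Lemma minimal_frame : frame U (fun p => inv_stereo (surf p)) Y N s kappa.
Proof.
split.
- split.
  + apply/smooth_rowP => //.
    apply: (smoothV_ext oU (F := fun q => moving (toC (surf q)) (sg q) 0 0)) => [q _|].
      by rewrite Y_moving.
    apply: smoothV_moving => //; first exact/smooth_rowP.
    * by apply: (smoothC_ext oU _ (smoothC_real oU smooth_sg)) => q _; rewrite sgE.
    * exact: smoothV_cst.
    * exact: smoothC_cst.
  + by move=> p Up; have [h _ _ _ _] := minimal_gram Up; move: h; rewrite lor_toC => /complexI.
  + move=> p Up; have q0 := stereo_den_gt0 (surf p).
    exists (sigma p * (1 + dot (surf p) (surf p)) / 2).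
      by rewrite divr_gt0 // mulr_gt0 // sigma_gt0.
    rewrite cone_inv_stereo scalerA; congr (_ *: _).
    by move: (dot _ _) q0 => q q0; field; rewrite gt_eqF.
  + by move=> p Up; have [_ _ _ h _] := minimal_gram Up; rewrite vdzb_toC.
- move=> p Up; have sq := sg_sq Up; have sV := sgV Up; have s0 := sg_neq0' Up.
  have key (t u : C) : t * u * (sg p * sg p * (2 * r p)) = t * u by rewrite sq mulr1.
  split.
  + exact: N_Vspace.
  + apply: (@complexI R); rewrite -lor_toC (toC_N Up); apply: (etrans (lor_moving _ _ _ _ _ _ _)).
    rewrite !dot_lin dot_conj (phi00 Up) conjc0 (dotC (conjV _)) hdot_phi.
    have k := key (theta p) ((theta p)^*).
    move: (theta p) ((theta p)^*) (sg p) (r p) s0 k => t u v w v0 k.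
    rewrite [RHS](_ : _ = t * u * (v * v * (2 * w)) - t * u); first by field.
    by rewrite k subrr.
  + apply: (@complexI R); rewrite -lor_toC (toC_N Up) (Y_moving p).
    apply: (etrans (lor_moving _ _ _ _ _ _ _)).
    by rewrite dot0r mulr0 subr0 sub0r mulVf // rmorphN rmorph1.
  + rewrite (toC_N Up) (vdz_Y Up); apply: (etrans (lor_moving _ _ _ _ _ _ _)).
    rewrite !dot_lin (phi00 Up) (dotC (conjV _)) hdot_phi.
    have k := key (theta p) 1.
    move: (theta p) ((theta p)^*) (sg p) (r p) s0 k => t u v w v0 k.
    rewrite [RHS](_ : _ = (t * 1 - t * 1 * (v * v * (2 * w))) / 2); first by field.
    by rewrite k subrr mul0r.
- move=> p Up; apply/VperpP.
  have k0 : dot (conjV (phi p)) (sg p *: (phi1 p - theta p *: phi p)) = 0.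
    rewrite !dot_lin (dotC _ (phi1 p)) (theta_r Up) (dotC _ (phi p)) hdot_phi.
    by rewrite subrr mulr0.
  have k1 : dot (phi p) (sg p *: (phi1 p - theta p *: phi p)) = 0.
    by rewrite !dot_lin (phi00 Up) (phi01 Up) mulr0 subr0 mulr0.
  rewrite (conjV_vdz_Y Up) (vdz_Y Up) (has_vdz_vdzb (has_vdz_Y1 Up)) (Y_moving p).
  split; apply: (etrans (lor_moving _ _ _ _ _ _ _)).
  + by rewrite dot0r; ring.
  + by rewrite dotC dotZl k1; ring.
  + by rewrite dotC dotZl k0; ring.
  + by rewrite dotC dotDl dotNl !(dotZl _ (phi p)) !(dotZl _ (conjV (phi p))) k1 k0; ring.
- by move=> p Up; rewrite (has_vdz_vdz (has_vdz_Y1 Up)).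
Qed.

Lemma tangent_Vspace p k : U p -> (mv p 0 (- (k * sg p) *: phi p) 0 <= Vspace Y p)%MS.
Proof.
(* The lift of [sg *: phi] equals [Y_z + (theta / 2) Y]. *)
move=> Up; apply/VspaceP; exists (- k * theta p / 2), (- k), 0, 0.
rewrite (vdz_Y Up) (scale_Y p).
rewrite (scale0r (conjV _)) (scale0r (vdzb _ _)) addr0 addr0.
apply: (etrans _ (esym (etrans (congr1 _ (movingZ _ _ _ _ _)) (movingD _ _ _ _ _ _ _)))).
apply: moving_eq; first by field.
- by rewrite add0r scalerA mulNr.
- by rewrite mulr0 addr0.
Qed.

(** The remaining term of the zbar-derivative of [kappa] is a multiple of the lift of [phi], hence
    lies in [V]. So [D_zbar] preserves the line of [kappa] and acts on it as the scalar operator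
    [f |-> f_zbar - f * conj(theta) / 2]. *)
Lemma Dzb_scale_kappa p f a b : U p -> has_dz f p a b ->
  Dzb Y (fun q => f q *: kappa q) p = (b - f p * ((theta p)^* / 2)) *: kappa p.
Proof.
move=> Up hf; have [A hk] := has_vdz_kappa Up.
have [g00 g01 g11 g12 g03] := minimal_gram Up.
have g02 : lor (toC (Y p)) (conjV (vdz (fun q => toC (Y q)) p)) = 0.
  by rewrite -(conjV_toC (Y p)) lor_conj g01 conjc0.
have [_ _ /(_ p Up) kV _] := minimal_frame.
rewrite /Dzb; apply: (Vperp_proj_eq g00 g01 g02 g11 g12 g03
    (b := f p *: mv p 0 (- (lam p * sg p) *: phi p) 0)).
- rewrite (has_vdz_vdzb (has_vdzZ hf hk)).
  move: (kappa p) (mv p 0 _ 0) (f p) (theta p)^* => u v c d.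
  by apply/rowP => j; rewrite !mxE; field.
- exact: scalemx_sub.
- by apply: scalemx_sub; exact: tangent_Vspace.
Qed.

Lemma Dzb_kappa p : U p -> Dzb Y kappa p = - ((theta p)^* / 2) *: kappa p.
Proof.
move=> Up; have := Dzb_scale_kappa Up (has_dz_cst 1 p).
have -> : (fun q => (1 : C) *: kappa q) = kappa by apply/funext => q; rewrite scale1r.
by rewrite mul1r sub0r.
Qed.

(** Two applications of the scalar operator to 1 give [- conj(theta_z) / 2 + conj(theta)^2 / 4],
    which is minus half the conjugate of [s]. *)
Lemma minimal_willmore_eq p : U p -> Dzb Y (Dzb Y kappa) p + ((s p)^* / 2) *: kappa p = 0.
Proof.
move=> Up.
have nE : \forall q \near p, Dzb Y kappa q = (- 2^-1 * (theta q)^*) *: kappa q.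
  by apply: (nbhs_eq_on oU Up) => q Uq; rewrite Dzb_kappa //; congr (_ *: _); field.
rewrite {1}/Dzb (vdzb_ext nE) -/(Dzb Y _ p).
rewrite (Dzb_scale_kappa Up (has_dzZ (- 2^-1) (has_dz_thetaJ Up))) -scalerDl.
suff -> : - 2^-1 * (theta1 p)^* - - 2^-1 * (theta p)^* * ((theta p)^* / 2) + (s p)^* / 2 = 0.
  exact: scale0r.
by rewrite /s !conjcE; field.
Qed.

Hypothesis phi_neq0 : forall p, U p -> phi p != 0.

Lemma minimal_willmore : willmore U (fun p => inv_stereo (surf p)).
Proof.
split.
- apply: conformal_immersion_inv_stereo => // p Up; rewrite (has_vdz_vdz (has_vdz_surf Up)).
    exact: phi_neq0.
  exact: phi00.
- by exists Y, N, s, kappa; split; [exact: minimal_frame|exact: minimal_willmore_eq].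
Qed.

Variables (a : plane R -> C) (xhat : plane R -> 'rV[R]_n) (yhat : plane R -> 'rV[R]_(n + 1)).
Hypothesis smooth_a : smoothC U a.
Hypothesis dz_a : forall p, U p -> dz a p = -1 - theta p * a p.
Hypothesis xhatE : forall p, U p ->
  toC (xhat p) = toC (surf p) + (a p *: phi p + (a p)^* *: conjV (phi p)).
Hypothesis yhatE : forall p, U p -> yhat p = inv_stereo (xhat p).
Hypothesis smooth_yhat : smooth_row U yhat.
Hypothesis a_dense : U `<=` closure [set p | U p /\ a p != 0].

(* This substitution turns the Riccati equation for [mu] into the linear equation [dz_a]. *)
Let mu p := theta p + 2 / a p.

(** Both sides are compared in the frame at [surf p]. On the left, the coefficient of the base lift
    is [sg |mu - theta|^2 / 2] and that of [phi] is [sg * conj(mu - theta)]; with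
    [mu - theta = 2 / a] these are the coefficients of the lift of [surf + 2 Re (a phi)] up to the
    stated factor. *)
Lemma minimal_adjoint_lift p : U p -> a p != 0 ->
  adjoint_lift Y N mu p = (2 * sg p / (a p * (a p)^*)) *: cone_lift (toC (xhat p)).
Proof.
move=> Up a0; have aJ0 : (a p)^* != 0 by rewrite conjc_eq0.
rewrite (xhatE Up) cone_liftD.
have -> : dot (a p *: phi p + (a p)^* *: conjV (phi p)) (a p *: phi p + (a p)^* *: conjV (phi p)) / 2
    = a p * (a p)^* * r p.
  rewrite !dot_lin (phi00 Up) dot_conj (phi00 Up) conjc0 (dotC (conjV _)) hdot_phi.
  by field.
rewrite /adjoint_lift (toC_N Up) (scale_Y p) sqr_normc vdzb_toC (conjV_vdz_Y Up) (vdz_Y Up).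
apply: (etrans _ (esym (movingZ _ _ _ _ _))).
have M2 k k' b c d b' d' e A B D : k *: moving (toC (surf p)) b A d +
    (k' *: moving (toC (surf p)) b' B d' + moving (toC (surf p)) e D c) = moving (toC (surf p)) (k * b + k' * b' + e)
     (k *: A + k' *: B + D) (k * d + k' * d' + c).
  by rewrite !movingZ !movingD !addrA.
rewrite -addrA -addrA; apply: (etrans (congr1 _ (M2 _ _ _ _ _ _ _ _ _ _ _))).
apply: (etrans (movingD _ _ _ _ _ _ _)).
have muJ : (mu p)^* = (theta p)^* + 2 / (a p)^* by rewrite /mu !conjcE.
have muE : mu p = theta p + 2 / a p by [].
have sV := sgV Up; have s0 := sg_neq0' Up.
move: (mu p) (mu p)^* (theta p) (theta p)^* (a p) (a p)^* muE muJ a0 aJ0.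
move=> m mJ t tJ b bJ -> -> b0 bJ0; apply: moving_eq.
- by field; rewrite b0 bJ0.
- apply/rowP => j; rewrite !mxE; move: (phi p _ _) => f.
  move: (f^*) => f'; by field; rewrite b0 bJ0.
- by rewrite sV; field; rewrite b0 bJ0.
Qed.

Lemma minimal_riccati p : U p -> a p != 0 -> dz mu p - mu p ^+ 2 / 2 - s p = 0.
Proof.
move=> Up a0; have ha := smoothC_has_dz smooth_a Up.
have hm : has_dz mu p _ _ := has_dzD (has_dz_theta Up) (has_dzZ 2 (has_dzV a0 ha)).
rewrite (has_dz_dz hm) (dz_a Up) /mu /s; move: (theta p) (theta1 p) (a p) a0 => t t1 b b0.
by field.
Qed.

Lemma kappa_null p : U p -> lor (kappa p) (kappa p) = 0.
Proof.
move=> Up; apply: (etrans (lor_moving _ _ _ _ _ _ _)).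
rewrite !dot_lin (phi11 Up) (phi00 Up) (phi01 Up) (dotC (phi1 p)) (phi01 Up); ring.
Qed.

(** The condition on [eta] is automatic: [D_zbar kappa] is a multiple of [kappa], so [eta] is one
    too, and [kappa] is null. What constrains [mu] is the Riccati equation, which holds on the open
    set where [a] is nonzero. *)
Lemma minimal_adjoint : adjoint U (fun p => inv_stereo (surf p)) yhat.
Proof.
split=> //; first exact: minimal_willmore.
  by move=> p Up; rewrite (yhatE Up) dot_inv_stereo.
exists Y, N, s, kappa; split; first exact: minimal_frame.
have oO := open_smoothC_neq0 oU smooth_a.
exists [set p | U p /\ a p != 0]; split=> //; first by move=> p [].
move=> p Op; exists [set p | U p /\ a p != 0], mu; split=> //.
- have sU : [set p | U p /\ a p != 0] `<=` U by move=> q [].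
  apply: smoothCD => //; first exact: smoothC_sub sU _.
  apply: smoothCM => //; first exact: smoothC_cst.
  by apply: smoothCV => // [|q []//]; exact: smoothC_sub sU _.
- move=> q [Uq a0] /=; split; first exact: minimal_riccati.
  + rewrite (Dzb_kappa Uq) -scalerDl.
    by rewrite lorZl lorZr (kappa_null Uq) !mulr0.
  + have s0 := sigma_gt0 Uq; have q0 := stereo_den_gt0 (xhat q).
    have a2 : complex.Re (a q * (a q)^*) != 0 by exact: Re_mulJ_neq0.
    exists (sigma q * (1 + dot (xhat q) (xhat q)) / complex.Re (a q * (a q)^*)).
      by rewrite mulf_neq0 ?invr_eq0 // mulf_neq0 // gt_eqF.
    rewrite (minimal_adjoint_lift Uq a0) (yhatE Uq) cone_inv_stereo scalerA toCZ.
    rewrite (toC_cone_lift (xhat q)).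
    have aE : a q * (a q)^* = (complex.Re (a q * (a q)^*))%:C.
      by case: (a q) => u v; apply: complex_eqP => //=; ring.
    rewrite aE sgE; congr (_ *: _).
    rewrite -(rmorph_nat (real_complex R) 2) -fmorphV -!rmorphM.
    congr (_%:C); move: (dot _ _) (complex.Re _) q0 a2 => u v u0 v0.
    by rewrite [complex.Re _]/=; field; rewrite v0 gt_eqF.
Qed.

End MinimalFrame.

Section Glue.
Context {R : realType} {n : nat}.
Local Notation C := R[i].
Variables (U : set (plane R)) (x0 : 'rV[R]_n) (Psi phi phi1 : plane R -> 'rV[C]_n).
Hypothesis oU : open U.
Hypothesis sPsi : smoothV U Psi.
Hypothesis dPsi : forall p, U p -> has_vdz Psi p (phi p) 0.
Hypothesis dphi : forall p, U p -> has_vdz phi p (phi1 p) 0.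
Hypothesis dphi1 : forall p, U p -> exists phi2, has_vdz phi1 p phi2 0.
Hypothesis phi00 : forall p, U p -> dot (phi p) (phi p) = 0.
Hypothesis phi01 : forall p, U p -> dot (phi p) (phi1 p) = 0.
Hypothesis phi11 : forall p, U p -> dot (phi1 p) (phi1 p) = 0.
Hypothesis phi_neq0 : forall p, U p -> phi p != 0.
Let theta p : C := hdot (phi1 p) (phi p) / hdot (phi p) (phi p).
Variables (a : plane R -> C) (xhat : plane R -> 'rV[R]_n) (yhat : plane R -> 'rV[R]_(n + 1)).
Hypothesis smooth_a : smoothC U a.
Hypothesis dz_a : forall p, U p -> dz a p = -1 - theta p * a p.
Hypothesis xhatE : forall p, U p ->
  toC (xhat p) = toC (surf x0 Psi p) + (a p *: phi p + (a p)^* *: conjV (phi p)).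
Hypothesis yhatE : forall p, U p -> yhat p = inv_stereo (xhat p).
Hypothesis smooth_yhat : smooth_row U yhat.
Hypothesis a_dense : U `<=` closure [set p | U p /\ a p != 0].

Lemma surf_adjoint : adjoint U (fun p => inv_stereo (surf x0 Psi p)) yhat.
Proof.
have sth : smoothC U theta by exact: (smooth_theta oU sPsi dPsi dphi phi_neq0).
have hth p : U p -> has_dz theta p (dz theta p) (dzb theta p).
  by move=> Up; exact: (smoothC_has_dz sth Up).
pose sigma p : R := (Num.sqrt (2 * complex.Re (hdot (phi p) (phi p))))^-1.
have ssg : smooth U sigma.
  by have [] := smooth_sg oU sPsi dPsi phi_neq0.
exact: (minimal_adjoint (r := fun p => hdot (phi p) (phi p)) (theta := theta)
  (sg := fun p => (sigma p)%:C) oU (smooth_surf x0 oU sPsi) (@has_vdz_surf _ _ U x0 Psi phi dPsi) dphi dphi1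
  phi00 phi01 phi11 (fun p => erefl) (@theta_r _ _ U phi phi1 phi_neq0) sth hth
  (fun p Up => has_dzJ (hth p Up)) (@sigma_gt0 _ _ U phi phi_neq0) (fun p => erefl) ssg
  (@sg_sq _ _ U phi phi_neq0) (@has_dz_sg _ _ U Psi phi phi1 oU sPsi dPsi dphi phi_neq0)
  phi_neq0 smooth_a dz_a xhatE yhatE smooth_yhat a_dense).
Qed.

End Glue.

(** * Necessary conditions on jets *)

Section LocalLift.
Context {R : realType} {n : nat}.
Local Notation C := R[i].
Implicit Types (p : plane R).

Lemma moving_inj (xc w w' : 'rV[C]_n) a c a' c' : moving xc a w c = moving xc a' w' c' -> w = w'.
Proof.
have E b u d : moving xc b u d = clift (b *: xc + u) (b * ((dot xc xc - 1) / 2) + dot xc u + d)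
    (b * ((dot xc xc + 1) / 2) + dot xc u + d).
  rewrite movingE /cone_lift /tangent_lift /null_infty !cliftZ !cliftD scaler0 addr0.
  by rewrite !mulr1.
rewrite !E => /clift_inj[h1 h2 h3].
(* The difference of the last two coordinates isolates the coefficient of the base lift. *)
have aE : a = a'.
  have : (a * ((dot xc xc + 1) / 2) + dot xc w + c) - (a * ((dot xc xc - 1) / 2) + dot xc w + c) =
     (a' * ((dot xc xc + 1) / 2) + dot xc w' + c') - (a' * ((dot xc xc - 1) / 2) + dot xc w' + c').
    exact: (congr2 (fun u v => u - v) h3 h2).
  move: (dot _ _) (dot _ _) (dot _ _) => e d q h.
  have -> : a = (a * ((q + 1) / 2) + d + c) - (a * ((q - 1) / 2) + d + c) by field.
  by rewrite h; field.
by move: h1; rewrite aE => /addrI.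
Qed.

Variables (W : set (plane R)) (x : plane R -> 'rV[R]_n) (y : plane R -> 'rV[R]_(n + 1)).
Variables (Y N : plane R -> 'rV[R]_(n + 1 + 1)) (s : plane R -> C).
Variables (kappa : plane R -> 'rV[C]_(n + 1 + 1)) (p0 : plane R).
Hypotheses (oW : open W) (Wp0 : W p0) (smooth_x : smooth_row W x).
Hypothesis yE : forall q, W q -> y q = inv_stereo (x q).
Hypothesis fr : frame setT y Y N s kappa.
Let xc q := toC (x q).
Let A := vdz xc.
Hypothesis A_null : forall q, W q -> dot (A q) (A q) = 0.

Let sx : smoothV W xc. Proof. exact: (smooth_rowP x oW).1. Qed.
Let sA : smoothV W A. Proof. exact: smoothV_vdz. Qed.
Let hx q : W q -> has_vdz xc q (A q) (conjV (A q)).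
Proof. by move=> Wq; exact: (has_vdz_toC oW smooth_x Wq). Qed.

(* The canonical lift is a multiple of [cone_lift x], so conditions on [kappa] become
   conditions on the derivatives of [A = x_z] modulo the span of the lower ones. *)
Lemma exists_scale : exists k : plane R -> C,
  [/\ smoothC W k, forall q, W q -> k q != 0 & forall q, W q -> toC (Y q) = moving (xc q) (k q) 0 0].
Proof.
have [[sY _ cY _] _ _ _] := fr.
(* The scale is recovered by dividing the last coordinate of [Y] by that of the polynomial lift,
   which is positive; this formula shows its smoothness. *)
pose l q : R := Y q 0 (rshift (n + 1) ord0) / ((dot (x q) (x q) + 1) / 2).
have den q : (dot (x q) (x q) + 1) / 2 != 0.
  by rewrite mulf_neq0 ?invr_eq0 // addrC stereo_den_neq0.
have YE q : W q -> exists2 d : R, d != 0 & Y q = d *: cone_lift (x q).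
  move=> Wq; have [d d0 ->] := cY q I; exists (d * (2 / (1 + dot (x q) (x q)))).
    by rewrite !mulf_neq0 ?invr_eq0 ?stereo_den_neq0 // gt_eqF.
  by rewrite (yE Wq) cone_inv_stereo scalerA.
have lE q d : Y q = d *: cone_lift (x q) -> l q = d.
  move=> h; rewrite /l h /cone_lift /clift !scale_row_mx row_mxEr !mxE eqxx mulr1n.
  by rewrite mulfK.
exists (fun q => (l q)%:C); split.
- apply: smoothC_real => //; apply: smoothM => //.
    have : smooth setT (fun q => Y q 0 (rshift (n + 1) ord0)) by exact: sY.
    by apply: smooth_sub.
  apply: (smooth_inv oW _ (fun q _ => den q)).
  apply: smoothM => //; last exact: smooth_cst.
  apply: smoothD => //; last exact: smooth_cst.
  have [h _] := smoothC_dot oW sx sx.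
  by apply: (smooth_ext oW _ h) => q _; rewrite dot_toC.
- move=> q Wq; have [d d0 h] := YE q Wq; rewrite (lE _ _ h).
  by apply/negP => /eqP/(@complexI R)/eqP; rewrite (negPf d0).
- move=> q Wq; have [d d0 h] := YE q Wq; rewrite (lE _ _ h) h toCZ movingE.
  rewrite (toC_cone_lift (x q)).
  rewrite (tangent_lift0 (xc q)).
  by move: (cone_lift _) null_infty => u v; rewrite addr0 scale0r addr0.
Qed.

Lemma A_Az q : W q -> dot (A q) (vdz A q) = 0.
Proof.
move=> Wq; have hA := smoothV_has_vdz sA Wq.
have h := has_dz_dz (has_dz_dot hA hA).
have nE : \forall r \near q, (0 : C) = dot (A r) (A r).
  by apply: (nbhs_eq_on oW Wq) => r Wr; rewrite A_null.
have h0 := has_dz_dz (has_dz_ext nE (has_dz_cst 0 q)).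
rewrite h0 (dotC (vdz A q)) in h.
by apply/eqP; rewrite -[_ == 0]orFb -[false](pnatr_eq0 C 2) -mulf_eq0 mulr2n mulrDl mul1r -h.
Qed.

Section Scale.
Variable k : plane R -> C.
Hypotheses (sk : smoothC W k) (k_neq0 : forall q, W q -> k q != 0).
Hypothesis kE : forall q, W q -> toC (Y q) = moving (xc q) (k q) 0 0.
Let sk1 : smoothC W (dz k). Proof. exact: smoothC_dz. Qed.
Let sk2 : smoothC W (dz (dz k)). Proof. exact: smoothC_dz. Qed.
Local Notation YC := (fun q => toC (Y q)).

Lemma has_vdz_local q : W q -> has_vdz YC q (moving (xc q) (dz k q) (k q *: A q) 0)
  (moving (xc q) (dzb k q) (k q *: conjV (A q)) 0).
Proof.
move=> Wq; have h := has_vdz_moving (hx Wq) (smoothC_has_dz sk Wq) (has_vdz_cst 0 q) (has_dz_cst 0 q).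
have nE : \forall r \near q, moving (xc r) (k r) 0 0 = YC r.
  by apply: (nbhs_eq_on oW Wq) => r Wr; rewrite kE.
apply: has_vdz_eq (has_vdz_ext nE h) _ _; apply: moving_eq => //;
  by rewrite ?addr0 ?dot0r ?addr0.
Qed.

Lemma has_vdz_local1 q : W q -> has_vdz (vdz YC) q
  (moving (xc q) (dz (dz k) q) (2 * dz k q *: A q + k q *: vdz A q) 0)
  (moving (xc q) (dzb (dz k) q) (dz k q *: conjV (A q) + (dzb k q *: A q + k q *: vdzb A q))
     (k q * dot (conjV (A q)) (A q))).
Proof.
move=> Wq; have hA := smoothV_has_vdz sA Wq.
have h := has_vdz_moving (hx Wq) (smoothC_has_dz sk1 Wq)
  (has_vdzZ (smoothC_has_dz sk Wq) hA) (has_dz_cst 0 q).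
have nE : \forall r \near q, moving (xc r) (dz k r) (k r *: A r) 0 = vdz YC r.
  by apply: (nbhs_eq_on oW Wq) => r Wr; rewrite (has_vdz_vdz (has_vdz_local Wr)).
apply: has_vdz_eq (has_vdz_ext nE h) _ _; apply: moving_eq => //.
- move: (A q) (vdz A q) (dz k q) (k q) => u v c d.
  by apply/rowP => j; rewrite !mxE; ring.
- by rewrite dotZr A_null // mulr0 addr0.
- by rewrite dotZr add0r.
Qed.

Lemma has_vdz_local2 q : W q -> exists B c, has_vdz (vdz (vdz YC)) q B
  (moving (xc q) (dzb (dz (dz k)) q)
    (dz (dz k) q *: conjV (A q) + 2 * dzb (dz k) q *: A q + 2 * dz k q *: vdzb A q
      + dzb k q *: vdz A q + k q *: vdzb (vdz A) q) c).
Proof.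
move=> Wq; have hA := smoothV_has_vdz sA Wq.
have hA1 := smoothV_has_vdz (smoothV_vdz oW sA) Wq.
have h := has_vdz_moving (hx Wq) (smoothC_has_dz sk2 Wq)
  (has_vdzD (has_vdzZ (has_dzZ 2 (smoothC_has_dz sk1 Wq)) hA)
    (has_vdzZ (smoothC_has_dz sk Wq) hA1)) (has_dz_cst 0 q).
have nE : \forall r \near q,
  moving (xc r) (dz (dz k) r) (2 * dz k r *: A r + k r *: vdz A r) 0 = vdz (vdz YC) r.
  by apply: (nbhs_eq_on oW Wq) => r Wr; rewrite (has_vdz_vdz (has_vdz_local1 Wr)).
eexists; eexists; apply: has_vdz_eq (has_vdz_ext nE h) erefl _; apply: moving_eq => //.
by rewrite !addrA.
Qed.

(** Adding the multiple of [Y] to [Y_zz] leaves the tangential part [2 k_z A + k A_z]. Since [A] is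
    null and orthogonal to [A_z], only the last term contributes to the square. *)
Lemma lor_kappa : lor (kappa p0) (kappa p0) = k p0 ^+ 2 * dot (vdz A p0) (vdz A p0).
Proof.
have [_ _ _ /(_ p0 I)] := fr; rewrite (has_vdz_vdz (has_vdz_local1 Wp0)) (kE Wp0) => h.
have -> : kappa p0 = moving (xc p0) (dz (dz k) p0 + s p0 / 2 * k p0)
    (2 * dz k p0 *: A p0 + k p0 *: vdz A p0) 0.
  have e : kappa p0 = s p0 / 2 *: moving (xc p0) (k p0) 0 0 +
      moving (xc p0) (dz (dz k) p0) (2 * dz k p0 *: A p0 + k p0 *: vdz A p0) 0.
    by rewrite h scaleNr addrA subrr add0r.
  rewrite e; apply: (etrans (moving_comb _ _ _ _ _ _ _ _)); apply: moving_eq.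
  - by rewrite addrC.
  - by rewrite scaler0 add0r.
  - by rewrite mulr0 addr0.
apply: (etrans (lor_moving _ _ _ _ _ _ _)).
have E (u v : 'rV[C]_n) l m : dot u u = 0 -> dot u v = 0 ->
    dot (l *: u + m *: v) (l *: u + m *: v) = m ^+ 2 * dot v v.
  by move=> h1 h2; rewrite !(dotDl, dotDr, dotZl, dotZr) (dotC v u) h1 h2; ring.
by rewrite mulr0 mul0r !subr0; exact: (E _ _ _ _ (A_null Wp0) (A_Az Wp0)).
Qed.

Lemma kappa_umbilic : kappa p0 = 0 -> exists a, vdz A p0 = a *: A p0.
Proof.
move=> k0; have [_ _ _ /(_ p0 I)] := fr; rewrite k0 addr0 (has_vdz_vdz (has_vdz_local1 Wp0)) (kE Wp0).
move=> h; have {}h := etrans h (movingZ _ _ _ _ _).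
have := moving_inj h; rewrite scaler0 => /eqP; rewrite addrC addr_eq0 => /eqP e.
exists (- (k p0)^-1 * (2 * dz k p0)); apply: (scalerI (k_neq0 Wp0)).
rewrite e scalerA -scaleNr; congr (_ *: _).
by move: (k p0) (k_neq0 Wp0) (dz k p0) => u u0 v; field.
Qed.

(** Obtained by differentiating [<Y, Y> = 0] and [<Y, Y_z> = 0]. That [Y_z] is null needs the frame
    equation as well: [<Y_z, Y_z> = - <Y, Y_zz>], and [Y_zz] is a multiple of [Y] plus a normal
    vector. *)
Lemma frame_gram q : [/\ lor (toC (Y q)) (toC (Y q)) = 0,
      lor (toC (Y q)) (vdz YC q) = 0,
      lor (vdz YC q) (vdz YC q) = 0,
      lor (vdz YC q) (conjV (vdz YC q)) = 2^-1 &
      lor (toC (Y q)) (vdzb (vdz YC) q) = - 2^-1].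
Proof.
have [[sY YY cY Y12] _ _ _] := fr; have oT := @openT (plane R).
have sYC : smoothV setT YC by exact/(smooth_rowP _ oT).
have hY r := smoothV_has_vdz sYC (I : setT r).
have hY1 r := smoothV_has_vdz (smoothV_vdz oT sYC) (I : setT r).
have two (d : C) : d + d = 0 -> d = 0.
  by move=> h; apply/eqP; rewrite -[_ == 0]orFb -[false](pnatr_eq0 C 2) -mulf_eq0 mulr2n mulrDl mul1r h.
have e0 r : lor (YC r) (YC r) = 0 by rewrite lor_toC YY.
have e1 r : lor (YC r) (vdz YC r) = 0.
  have := has_dz_dz (has_dz_lor (hY r) (hY r)).
  have -> : (fun q => lor (YC q) (YC q)) = (fun _ => 0) by apply/funext => r'; exact: e0.
  by rewrite (has_dz_dz (has_dz_cst 0 r)) (lorC (vdz YC r)) => /esym/two.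
have [e2 e3] : (lor (vdz YC q) (vdz YC q) + lor (YC q) (vdz (vdz YC) q) = 0) /\
    (lor (vdzb YC q) (vdz YC q) + lor (YC q) (vdzb (vdz YC) q) = 0).
  have h := has_dz_lor (hY q) (hY1 q).
  have Z : (fun q => lor (YC q) (vdz YC q)) = (fun _ => 0) by apply/funext => r'; exact: e1.
  by rewrite Z in h; rewrite -(has_dz_dz h) -(has_dz_dzb h) (has_dz_dz (has_dz_cst 0 q))
    (has_dz_dzb (has_dz_cst 0 q)).
have e4 : lor (vdz YC q) (vdzb YC q) = 2^-1 by exact: Y12.
split=> //.
- have [_ _ kV kE'] := fr; have /VperpP[+ _ _ _] := kV q I; rewrite (lorC (kappa q)) => hk.
  have e5 : lor (YC q) (vdz (vdz YC) q) = 0 by rewrite (kE' q I) lorDr lorZr e0 hk mulr0 addr0.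
  by move: e2; rewrite e5 addr0.
- by rewrite -vdzb_toC.
- by move: e3; rewrite (lorC (vdzb YC q)) e4 => /eqP; rewrite addrC addr_eq0 => /eqP.
Qed.

(** Follows from [<Y, Y_zzbar> = -1/2] and the normality of [kappa]. A frame does not postulate that
    [s] is smooth; this formula provides it, and with it the right to differentiate [kappa]. *)
Lemma s_lor q : s q = 4 * lor (vdz (vdz YC) q) (vdzb (vdz YC) q).
Proof.
have [_ _ _ _ g03] := frame_gram q.
have [_ _ kV kE'] := fr; have /VperpP[_ _ _ hk] := kV q I.
by rewrite (kE' q I) lorDl lorZl hk g03; field.
Qed.

(** The hypothesis puts [kappa_zbar + mu kappa] into [V]. Comparing tangential components in the
    moving frame gives one linear relation, in which [A_zzbar] appears with the nonzero coefficient
    [k]. *)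
Lemma s_willmore_relation (mu : C) : Dzb Y kappa p0 + mu *: kappa p0 = 0 ->
  exists a b c d, vdzb (vdz A) p0 = a *: A p0 + b *: conjV (A p0) + c *: vdzb A p0 + d *: vdz A p0.
Proof.
have oT := @openT (plane R); have [[sY _ _ _] _ _ kE'] := fr.
have sYC : smoothV setT YC by exact/(smooth_rowP _ oT).
have sY1 := smoothV_vdz oT sYC; have sY2 := smoothV_vdz oT sY1.
have ss : smoothC setT s.
  apply: (smoothC_ext oT _ (smoothCM oT (smoothC_cst 4 oT) (smoothC_lor oT sY2 (smoothV_vdzb oT sY1)))).
  by move=> q _; rewrite -s_lor.
have hs := smoothC_has_dz ss (I : setT p0).
have [B [c0 hY2]] := has_vdz_local2 Wp0.
have kapE : (fun q => vdz (vdz YC) q + (2^-1 * s q) *: YC q) = kappa.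
  apply/funext => q; rewrite (kE' q I) addrAC -scalerDl.
  have -> : - (s q / 2) + 2^-1 * s q = 0 by rewrite mulrC addNr.
  by rewrite scale0r add0r.
have hk := has_vdzD hY2 (has_vdzZ (has_dzZ (2^-1) hs) (has_vdz_local Wp0)).
rewrite kapE in hk.
have [g00 g01 g11 g12 g03] := frame_gram p0.
have g02 : lor (YC p0) (conjV (vdz YC p0)) = 0.
  by rewrite -(conjV_toC (Y p0)) lor_conj g01 conjc0.
move=> /eqP; rewrite addr_eq0 => /eqP D0.
have := Vperp_proj_sub g00 g01 g02 g11 g12 g03 (vdzb kappa p0).
rewrite -/(Dzb Y kappa p0) D0 opprK => /VspaceP[a [b [c [d]]]].
rewrite (has_vdz_vdzb hk) (kE Wp0) -(vdzb_toC Y p0) (has_vdz_vdz (has_vdz_local Wp0)).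
rewrite (has_vdz_vdzb (has_vdz_local Wp0)) (has_vdz_vdzb (has_vdz_local1 Wp0)).
have kpE : kappa p0 = vdz (vdz YC) p0 + (2^-1 * s p0) *: YC p0 by rewrite -kapE.
rewrite kpE (has_vdz_vdz (has_vdz_local1 Wp0)) (kE Wp0).
have C5 a1 w1 c1 k2 a2 w2 c2 k3 a3 w3 c3 k4 a4 w4 c4 k5 a5 w5 c5 :
  moving (xc p0) a1 w1 c1 + (k2 *: moving (xc p0) a2 w2 c2 + k3 *: moving (xc p0) a3 w3 c3)
    + k4 *: (moving (xc p0) a4 w4 c4 + k5 *: moving (xc p0) a5 w5 c5) =
  moving (xc p0) (a1 + (k2 * a2 + k3 * a3) + k4 * (a4 + k5 * a5))
    (w1 + (k2 *: w2 + k3 *: w3) + k4 *: (w4 + k5 *: w5))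
    (c1 + (k2 * c2 + k3 * c3) + k4 * (c4 + k5 * c5)).
  by rewrite !movingZ !movingD !movingZ !movingD.
have C4 k1 a1 w1 c1 k2 a2 w2 c2 k3 a3 w3 c3 k4 a4 w4 c4 :
  k1 *: moving (xc p0) a1 w1 c1 + k2 *: moving (xc p0) a2 w2 c2 + k3 *: moving (xc p0) a3 w3 c3
    + k4 *: moving (xc p0) a4 w4 c4 =
  moving (xc p0) (k1 * a1 + k2 * a2 + k3 * a3 + k4 * a4)
    (k1 *: w1 + k2 *: w2 + k3 *: w3 + k4 *: w4) (k1 * c1 + k2 * c2 + k3 * c3 + k4 * c4).
  by rewrite !movingZ !movingD.
move=> h; have {h} := moving_inj (etrans (esym (C5 _ _ _ _ _ _ _ _ _ _ _ _ _ _ _ _ _ _ _)) (etrans h (C4 _ _ _ _ _ _ _ _ _ _ _ _ _ _ _ _))).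
have k0 := k_neq0 Wp0.
move: (k p0) k0 (A p0) (conjV (A p0)) (vdzb A p0) (vdz A p0) (vdzb (vdz A) p0)
  (dz k p0) (dzb k p0) (dz (dz k) p0) (dzb (dz k) p0) (s p0) (dzb s p0).
move=> kp kp0 u v w t z k1 k2 k3 k4 sp sp1 h.
(* The relation [h] solved for [A_zzbar], coefficient by coefficient. *)
exists (kp^-1 * (b * kp + d * k2 - 2 * k4 - mu * (2 * k1))),
  (kp^-1 * (c * kp + d * k1 - k3 - 2^-1 * sp * kp)), (kp^-1 * (d * kp - 2 * k1)),
  (kp^-1 * (- k2 - mu * kp)).
apply: (scalerI kp0); rewrite !scalerDr !scalerA.
have cK e : kp * (kp^-1 * e) = e by rewrite mulrA mulfV ?mul1r.
rewrite !cK.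
have {}h j := congr1 (fun v : 'rV_n => v 0 j) h.
apply/rowP => j; have := h j; rewrite !mxE.
move: (u 0 j) (v 0 j) (w 0 j) (t 0 j) (z 0 j) => uj vj wj tj zj hj.
apply/eqP; rewrite -subr_eq0; apply/eqP.
by move: hj => /eqP; rewrite -subr_eq0 => /eqP <-; ring.
Qed.

End Scale.

Lemma super_conformal_jet : lor (kappa p0) (kappa p0) = 0 -> dot (vdz A p0) (vdz A p0) = 0.
Proof.
have [k [sk k0 kE]] := exists_scale; rewrite (lor_kappa sk kE) => /eqP.
by rewrite mulf_eq0 expf_eq0 (negPf (k0 _ Wp0)) => /eqP.
Qed.

Lemma s_willmore_jet :
  (kappa p0 != 0 -> exists mu, \forall q \near p0, Dzb Y kappa q + ((mu q)^* / 2) *: kappa q = 0) ->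
  (exists a, vdz A p0 = a *: A p0) \/ exists a b c d,
    vdzb (vdz A) p0 = a *: A p0 + b *: conjV (A p0) + c *: vdzb A p0 + d *: vdz A p0.
Proof.
have [k [sk k0 kE]] := exists_scale.
have [/(kappa_umbilic sk k0 kE)|kap0 h] := eqVneq (kappa p0) 0; first by left.
right; have [mu /nbhs_singleton hmu] := h isT.
exact: (s_willmore_relation sk k0 kE hmu).
Qed.

End LocalLift.

(** * The adjoint surface in the finite plane *)

Section NullBasis.
Context {R : realType}.
Local Notation C := R[i].
Implicit Types (z a b c d e : C) (p : plane R).

Definition sqrt30 : C := (Num.sqrt (30%:R : R))%:C.

Lemma sqrt30_sq : sqrt30 * sqrt30 = 30.
Proof.
rewrite /sqrt30 -rmorphM -expr2 sqr_sqrtr ?ler0n //.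
exact: (rmorph_nat (real_complex R) 30).
Qed.

(* The factor [sqrt30] keeps all the coefficients below rational. *)
Definition nv a b c d e : 'rV[C]_5 :=
  a *: E1 R + b *: conjV (E1 R) + c *: E2 R + d *: conjV (E2 R) + (sqrt30 * e) *: e5 R.

Lemma dotEE : [/\ dot (E1 R) (E1 R) = 0, dot (E1 R) (conjV (E1 R)) = 2,
  dot (E1 R) (E2 R) = 0, dot (E1 R) (conjV (E2 R)) = 0 & dot (E1 R) (e5 R) = 0] /\
  [/\ dot (E2 R) (E2 R) = 0, dot (E2 R) (conjV (E2 R)) = 2,
  dot (E2 R) (e5 R) = 0 & dot (e5 R) (e5 R) = 1].
Proof.
have ii := @imag_sqr R.
have c1 : conjV (E1 R) = \row_(j < 5) [:: 1; - 'i; 0; 0; 0]`_j.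
  by apply/rowP => j; rewrite !mxE; case: j => [[|[|[|[|[|j]]]]] ij] //;
    rewrite [nth _ _ _]/= [in RHS]/= ?conjc0 ?conjc1 ?conjci.
have c2 : conjV (E2 R) = \row_(j < 5) [:: 0; 0; 1; - 'i; 0]`_j.
  by apply/rowP => j; rewrite !mxE; case: j => [[|[|[|[|[|j]]]]] ij] //;
    rewrite [nth _ _ _]/= [in RHS]/= ?conjc0 ?conjc1 ?conjci.
rewrite c1 c2; split; split; rewrite dotE !big_ord_recl big_ord0 !mxE /= ?mulrN ?ii; ring.
Qed.

Lemma conjV_e5 : conjV (e5 R) = e5 R.
Proof.
apply/rowP => j; rewrite !mxE; case: j => [[|[|[|[|[|j]]]]] ij] //;
  by rewrite [nth _ _ _]/= [in RHS]/= ?conjc0 ?conjc1.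
Qed.

Lemma dot_nv a b c d e a' b' c' d' e' : dot (nv a b c d e) (nv a' b' c' d' e') =
  2 * (a * b' + b * a' + c * d' + d * c') + 30 * e * e'.
Proof.
have [[h1 h2 h3 h4 h5] [h6 h7 h8 h9]] := dotEE.
have J (u v : 'rV[C]_5) x : dot u v = x -> dot (conjV u) (conjV v) = x^* by move=> <-; exact: dot_conj.
have h1' := J _ _ _ h1; have h3' := J _ _ _ h3; have h4' := J _ _ _ h4; have h5' := J _ _ _ h5.
have h6' := J _ _ _ h6; have h8' := J _ _ _ h8.
rewrite conjVK in h4'; rewrite conjV_e5 in h5' h8'.
have k11 : dot (E1 R) (E1 R) = 0 :> C by rewrite h1.
have k12 : dot (E1 R) (conjV (E1 R)) = 2 :> C by rewrite h2.
have k21 : dot (conjV (E1 R)) (E1 R) = 2 :> C by rewrite dotC.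
have k13 : dot (E1 R) (E2 R) = 0 :> C by rewrite h3.
have k31 : dot (E2 R) (E1 R) = 0 :> C by rewrite dotC.
have k14 : dot (E1 R) (conjV (E2 R)) = 0 :> C by rewrite h4.
have k41 : dot (conjV (E2 R)) (E1 R) = 0 :> C by rewrite dotC.
have k15 : dot (E1 R) (e5 R) = 0 :> C by rewrite h5.
have k51 : dot (e5 R) (E1 R) = 0 :> C by rewrite dotC.
have k22 : dot (conjV (E1 R)) (conjV (E1 R)) = 0 :> C by rewrite h1' conjc0.
have k23 : dot (conjV (E1 R)) (E2 R) = 0 :> C by rewrite h4' conjc0.
have k32 : dot (E2 R) (conjV (E1 R)) = 0 :> C by rewrite dotC.
have k24 : dot (conjV (E1 R)) (conjV (E2 R)) = 0 :> C by rewrite h3' conjc0.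
have k42 : dot (conjV (E2 R)) (conjV (E1 R)) = 0 :> C by rewrite dotC.
have k25 : dot (conjV (E1 R)) (e5 R) = 0 :> C by rewrite h5' conjc0.
have k52 : dot (e5 R) (conjV (E1 R)) = 0 :> C by rewrite dotC.
have k33 : dot (E2 R) (E2 R) = 0 :> C by rewrite h6.
have k34 : dot (E2 R) (conjV (E2 R)) = 2 :> C by rewrite h7.
have k43 : dot (conjV (E2 R)) (E2 R) = 2 :> C by rewrite dotC.
have k35 : dot (E2 R) (e5 R) = 0 :> C by rewrite h8.
have k53 : dot (e5 R) (E2 R) = 0 :> C by rewrite dotC.
have k44 : dot (conjV (E2 R)) (conjV (E2 R)) = 0 :> C by rewrite h6' conjc0.
have k45 : dot (conjV (E2 R)) (e5 R) = 0 :> C by rewrite h8' conjc0.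
have k54 : dot (e5 R) (conjV (E2 R)) = 0 :> C by rewrite dotC.
have k55 : dot (e5 R) (e5 R) = 1 :> C by rewrite h9.
rewrite /nv !(dotDl, dotDr, dotZl, dotZr).
rewrite k11 k12 k13 k14 k15.
rewrite k21 k22 k23 k24 k25.
rewrite k31 k32 k33 k34 k35.
rewrite k41 k42 k43 k44 k45.
rewrite k51 k52 k53 k54 k55.
rewrite -sqrt30_sq; ring.
Qed.

Lemma conjV_nv a b c d e : conjV (nv a b c d e) = nv (b^*) (a^*) (d^*) (c^*) (e^*).
Proof.
rewrite /nv !conjVD !conjVZ !conjVK conjV_e5 conjcM /sqrt30 conjc_real.
move: (E1 R) (conjV (E1 R)) (E2 R) (conjV (E2 R)) => u u' v v'.
by apply/rowP => j; rewrite !mxE; ring.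
Qed.

Lemma hdot_nv a b c d e a' b' c' d' e' : hdot (nv a b c d e) (nv a' b' c' d' e') =
  2 * (a * a'^* + b * b'^* + c * c'^* + d * d'^*) + 30 * e * e'^*.
Proof. by rewrite /hdot conjV_nv dot_nv. Qed.

Lemma nvD a b c d e a' b' c' d' e' : nv a b c d e + nv a' b' c' d' e' =
  nv (a + a') (b + b') (c + c') (d + d') (e + e').
Proof.
rewrite /nv; move: (E1 R) (conjV (E1 R)) (E2 R) (conjV (E2 R)) (e5 R) => u1 u2 u3 u4 u5.
by apply/rowP => j; rewrite !mxE; ring.
Qed.

Lemma nvZ k a b c d e : k *: nv a b c d e = nv (k * a) (k * b) (k * c) (k * d) (k * e).
Proof.
rewrite /nv; move: (E1 R) (conjV (E1 R)) (E2 R) (conjV (E2 R)) (e5 R) => u1 u2 u3 u4 u5.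
by apply/rowP => j; rewrite !mxE; ring.
Qed.

Lemma nv_eq0 a b c d e : nv a b c d e = 0 -> [/\ a = 0, b = 0, c = 0, d = 0 & e = 0].
Proof.
move=> h; have E x : dot (nv a b c d e) x = 0 by rewrite h dot0l.
have k (x y : C) : y = 2 * x -> y = 0 -> x = 0.
  by move=> -> /eqP; rewrite mulf_eq0 pnatr_eq0 => /eqP.
split.
- by apply: k (E (nv 0 1 0 0 0)); rewrite dot_nv; ring.
- by apply: k (E (nv 1 0 0 0 0)); rewrite dot_nv; ring.
- by apply: k (E (nv 0 0 0 1 0)); rewrite dot_nv; ring.
- by apply: k (E (nv 0 0 1 0 0)); rewrite dot_nv; ring.
(* The factor [1/15] turns the weight 30 of the fifth coordinate into the weight 2 of the others. *)
- by apply: k (E (nv 0 0 0 0 (15^-1))); rewrite dot_nv; field.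
Qed.

Lemma has_vdz_nv (f1 f2 f3 f4 f5 : plane R -> C) p a1 a2 a3 a4 a5 b1 b2 b3 b4 b5 :
  has_dz f1 p a1 b1 -> has_dz f2 p a2 b2 -> has_dz f3 p a3 b3 -> has_dz f4 p a4 b4 ->
  has_dz f5 p a5 b5 ->
  has_vdz (fun q => nv (f1 q) (f2 q) (f3 q) (f4 q) (f5 q)) p (nv a1 a2 a3 a4 a5) (nv b1 b2 b3 b4 b5).
Proof.
move=> h1 h2 h3 h4 h5.
have k f a b (u : 'rV[C]_5) : has_dz f p a b -> has_vdz (fun q => f q *: u) p (a *: u) (b *: u).
  by move=> h; apply: has_vdz_eq (has_vdzZ h (has_vdz_cst u p)) _ _; rewrite scaler0 addr0.
have h5' := has_dzZ sqrt30 h5.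
exact: has_vdzD (has_vdzD (has_vdzD (has_vdzD (k _ _ _ _ h1) (k _ _ _ _ h2)) (k _ _ _ _ h3))
  (k _ _ _ _ h4)) (k _ _ _ _ h5').
Qed.

Lemma smoothV_nv U (f1 f2 f3 f4 f5 : plane R -> C) : open U ->
  smoothC U f1 -> smoothC U f2 -> smoothC U f3 -> smoothC U f4 -> smoothC U f5 ->
  smoothV U (fun q => nv (f1 q) (f2 q) (f3 q) (f4 q) (f5 q)).
Proof.
move=> oU h1 h2 h3 h4 h5.
have k f u : smoothC U f -> smoothV U (fun q => f q *: (u : 'rV[C]_5)).
  by move=> h; apply: smoothVZ => //; exact: smoothV_cst.
have h5' : smoothC U (fun q => sqrt30 * f5 q) by apply: smoothCM => //; exact: smoothC_cst.
apply: smoothVD => //; last exact: k.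
apply: smoothVD => //; last exact: k.
apply: smoothVD => //; last exact: k.
by apply: smoothVD => //; exact: k.
Qed.

End NullBasis.

Lemma nv00 {R : realType} : nv 0 0 0 0 0 = 0 :> 'rV[R[i]]_5.
Proof. by rewrite -(scale0r (nv 0 0 0 0 0)) nvZ !mulr0. Qed.

Lemma nv_eq {R : realType} (a b c d e a' b' c' d' e' : R[i]) :
  a = a' -> b = b' -> c = c' -> d = d' -> e = e' -> nv a b c d e = nv a' b' c' d' e'.
Proof. by move=> -> -> -> -> ->. Qed.

Ltac holo h := lazymatch goal with
  | |- has_dz (fun _ => ?c) _ _ _ => eapply (has_dz_cst c)
  | |- has_dz (fun q => @?f q + @?g q) _ _ _ => eapply (has_dzD (f := f) (g := g)); holo h
  | |- has_dz (fun q => - @?f q) _ _ _ => eapply (has_dzN (f := f)); holo h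
  | |- has_dz (fun q => @?f q * @?g q) _ _ _ => eapply (has_dzM (f := f) (g := g)); holo h
  | |- has_dz (fun q => _ ^+ ?n) _ _ _ => eapply (has_dzX n h)
  | |- _ => exact h end.

Ltac holov h := lazymatch goal with
  | |- has_vdz (fun q => nv (@?f1 q) (@?f2 q) (@?f3 q) (@?f4 q) (@?f5 q)) _ _ _ =>
    eapply has_vdz_eq;
      [eapply (has_vdz_nv (f1 := f1) (f2 := f2) (f3 := f3) (f4 := f4) (f5 := f5)); holo h |
       rewrite nvZ; apply: nv_eq; rewrite /=; by field | rewrite -nv00; apply: nv_eq; rewrite /=; by ring] end.

(** * The polynomial data of the surface and their inner products *)

Section Data.
Context {R : realType}.
Local Notation C := R[i].
Implicit Types (z : C) (p : plane R) (ze : plane R -> C).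

(* With [D = z^4 - z] and [m = z^3 - 1], one has [Psi = P / D^2] and [Psi' = Q / D^3], and
   [Pi = (P + (4 z^3 - 3) / 6 * Q) / (z^2 m)] is a polynomial: a multiple of [Q] cancels the
   pole of [Psi] at 0 and leaves only simple poles at the cube roots of unity. *)
Definition Pv z : 'rV[C]_5 := nv ((1 + 32 * z ^+ 3) / 2) ((z ^+ 2 + - 2 * z ^+ 5) / 12)
  (8 * z ^+ 3 + - 5 * z ^+ 6) (- 6^-1 * z ^+ 2) (- 2^-1 * z ^+ 4).
Definition P1v z : 'rV[C]_5 := nv (48 * z ^+ 2) ((2 * z + - 10 * z ^+ 4) / 12)
  (24 * z ^+ 2 + - 30 * z ^+ 5) (- 3^-1 * z) (- 2 * z ^+ 3).
Definition Qv z : 'rV[C]_5 := nv (1 + - 20 * z ^+ 3 + - 80 * z ^+ 6) (2^-1 * z ^+ 8)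
  (10 * z ^+ 9 + - 20 * z ^+ 6 + - 8 * z ^+ 3) (z ^+ 5) (2 * z ^+ 7 + z ^+ 4).
Definition Q1v z : 'rV[C]_5 := nv (- 60 * z ^+ 2 + - 480 * z ^+ 5) (4 * z ^+ 7)
  (90 * z ^+ 8 + - 120 * z ^+ 5 + - 24 * z ^+ 2) (5 * z ^+ 4) (14 * z ^+ 6 + 4 * z ^+ 3).
Definition Q2v z : 'rV[C]_5 := nv (- 120 * z + - 2400 * z ^+ 4) (28 * z ^+ 6)
  (720 * z ^+ 7 + - 600 * z ^+ 4 + - 48 * z) (20 * z ^+ 3) (84 * z ^+ 5 + 12 * z ^+ 2).
Definition Piv z : 'rV[C]_5 := nv (- (80 / 3) * (z + 2 * z ^+ 4)) ((4 * z ^+ 6 + z ^+ 3 + - 1) / 12)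
  ((20 * z ^+ 7 + - 35 * z ^+ 4 + - 36 * z) / 3) ((4 * z ^+ 3 + 1) / 6) ((4 * z ^+ 5 + 3 * z ^+ 2) / 3).
Definition Pi1v z : 'rV[C]_5 := nv (- (80 / 3) * (1 + 8 * z ^+ 3)) ((24 * z ^+ 5 + 3 * z ^+ 2) / 12)
  ((140 * z ^+ 6 + - 140 * z ^+ 3 + - 36) / 3) (2 * z ^+ 2) ((20 * z ^+ 4 + 6 * z) / 3).
Definition mz z : C := z ^+ 3 - 1.
Definition Dz z : C := z ^+ 4 - z.
Definition D1z z : C := 4 * z ^+ 3 - 1.

Section Holomorphic.
Variables (ze : plane R -> C) (p : plane R) (a : C).
Hypothesis dze : has_dz ze p a 0.

Lemma has_vdz_Pv : has_vdz (fun q => Pv (ze q)) p (a *: P1v (ze p)) 0.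
Proof. rewrite /Pv /P1v; holov dze. Qed.

Lemma has_vdz_Qv : has_vdz (fun q => Qv (ze q)) p (a *: Q1v (ze p)) 0.
Proof. rewrite /Qv /Q1v; holov dze. Qed.

Lemma has_vdz_Q1v : has_vdz (fun q => Q1v (ze q)) p (a *: Q2v (ze p)) 0.
Proof. rewrite /Q1v /Q2v; holov dze. Qed.

Lemma has_vdz_Piv : has_vdz (fun q => Piv (ze q)) p (a *: Pi1v (ze p)) 0.
Proof. rewrite /Piv /Pi1v; holov dze. Qed.

Lemma has_dz_mz : has_dz (fun q => mz (ze q)) p (a * (3 * ze p ^+ 2)) 0.
Proof. rewrite /mz; eapply has_dz_eq; [holo dze | by rewrite /=; ring | by rewrite /=; ring]. Qed.

Lemma has_dz_Dz : has_dz (fun q => Dz (ze q)) p (a * D1z (ze p)) 0.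
Proof. rewrite /Dz; eapply has_dz_eq; [holo dze | by rewrite /D1z /=; ring | by rewrite /=; ring]. Qed.

Lemma has_dz_D1z : has_dz (fun q => D1z (ze q)) p (a * (12 * ze p ^+ 2)) 0.
Proof. rewrite /D1z; eapply has_dz_eq; [holo dze | by rewrite /=; ring | by rewrite /=; ring]. Qed.

End Holomorphic.

Lemma dot_QQ z : dot (Qv z) (Qv z) = 0. Proof. by rewrite dot_nv; field. Qed.
Lemma dot_QQ1 z : dot (Qv z) (Q1v z) = 0. Proof. by rewrite dot_nv; field. Qed.
Lemma dot_Q1Q1 z : dot (Q1v z) (Q1v z) = 0. Proof. by rewrite dot_nv; field. Qed.
Lemma dot_QQ2 z : dot (Qv z) (Q2v z) = 0. Proof. by rewrite dot_nv; field. Qed.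
Lemma dot_Q1Q2 z : dot (Q1v z) (Q2v z) = 0. Proof. by rewrite dot_nv; field. Qed.
(** The first nonzero product: [Q] and [Q1] span an isotropic plane orthogonal to [Q2]. Both
    negative claims rest on this value being nonzero wherever [Dz z != 0]. *)
Lemma dot_Q2Q2 z : dot (Q2v z) (Q2v z) = 480 * z ^+ 2 * Dz z ^+ 2.
Proof. by rewrite dot_nv /Dz; field. Qed.
(** The numerator in the quotient rule for [P / D^2]. *)
Lemma Qv_P z : Qv z = Dz z *: P1v z - (2 * D1z z) *: Pv z.
Proof. by rewrite -scaleNr !nvZ nvD; apply: nv_eq; rewrite /Dz /D1z; field. Qed.
(** At a zero of [D] one has [Q = - 2 D' P], so cancellation requires the multiplier [1 / (2 D')].
    As [D'] is -1 at 0 and 3 at the cube roots of unity, this is -1/2 and 1/6, the values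
    interpolated by [(4 z^3 - 3) / 6]. *)
Lemma Piv_P z : (z ^+ 2 * mz z) *: Piv z = Pv z + ((4 * z ^+ 3 - 3) / 6) *: Qv z.
Proof. by rewrite !nvZ nvD; apply: nv_eq; rewrite /mz; field. Qed.
Lemma dot_PiQ z : dot (Piv z) (Qv z) = - (mz z * D1z z) / 6.
Proof. by rewrite dot_nv /mz /D1z; field. Qed.
(** Together with [dot_PiQ], the factor [mz z] makes the square of [c1v] divisible by [mz z]. *)
Lemma dot_PiPi z : dot (Piv z) (Piv z) = - (8 / 9) * z * mz z.
Proof. by rewrite dot_nv /mz; field. Qed.

Lemma Dz_mz z : Dz z = z * mz z. Proof. by rewrite /Dz /mz; ring. Qed.

Lemma Dz_neq0 z : Dz z != 0 -> z != 0 /\ mz z != 0.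
Proof. by rewrite Dz_mz mulf_eq0 negb_or => /andP. Qed.

Lemma mz0_neq0 : mz 0 != 0.
Proof. by rewrite /mz expr0n /= sub0r oppr_eq0 oner_eq0. Qed.

Lemma Pv_Piv z : Pv z = (z ^+ 2 * mz z) *: Piv z - ((4 * z ^+ 3 - 3) / 6) *: Qv z.
Proof. by rewrite Piv_P addrK. Qed.

(* [m^2 (Pi / m)'], where [m = z^3 - 1]. *)
Definition dPiv z := mz z *: Pi1v z - (3 * z ^+ 2) *: Piv z.

Lemma dot_dPi_dPi z : dot (dPiv z) (dPiv z) = 0.
Proof. by rewrite /dPiv -scaleNr !nvZ nvD dot_nv /mz; field. Qed.
Lemma dot_dPi_Q z : dot (dPiv z) (Qv z) = 0.
Proof. by rewrite /dPiv -scaleNr !nvZ nvD dot_nv /mz; field. Qed.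
Lemma dot_dPi_Q1 z : dot (dPiv z) (Q1v z) = 0.
Proof. by rewrite /dPiv -scaleNr !nvZ nvD dot_nv /mz; field. Qed.

Lemma conjV_Qv z : conjV (Qv z) = nv (2^-1 * z^* ^+ 8) (1 + - 20 * z^* ^+ 3 + - 80 * z^* ^+ 6)
  (z^* ^+ 5) (10 * z^* ^+ 9 + - 20 * z^* ^+ 6 + - 8 * z^* ^+ 3) (2 * z^* ^+ 7 + z^* ^+ 4).
Proof. by rewrite /Qv conjV_nv; apply: nv_eq; rewrite !conjcE. Qed.

Lemma conjV_Q1v z : conjV (Q1v z) = nv (4 * z^* ^+ 7) (- 60 * z^* ^+ 2 + - 480 * z^* ^+ 5)
  (5 * z^* ^+ 4) (90 * z^* ^+ 8 + - 120 * z^* ^+ 5 + - 24 * z^* ^+ 2) (14 * z^* ^+ 6 + 4 * z^* ^+ 3).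
Proof.
have kM (k : nat) (x : C) n : (k%:R * x ^+ n)^* = k%:R * x^* ^+ n by rewrite conjcM conjc_nat conjcX.
have kN (k : nat) (x : C) n : (- k%:R * x ^+ n)^* = - k%:R * x^* ^+ n.
  by rewrite conjcM conjcN conjc_nat conjcX.
rewrite /Q1v conjV_nv; apply: nv_eq.
- exact: (kM 4).
- by rewrite conjcD (kN 60) (kN 480).
- exact: (kM 5).
- by rewrite 2!conjcD (kM 90) (kN 120) (kN 24).
- by rewrite conjcD (kM 14) (kM 4).
Qed.

Lemma Qv_neq0 z : Qv z != 0.
Proof.
apply/eqP => /nv_eq0[h1 _ _ h4 _].
have z0 : z = 0 by apply/eqP; move/eqP: h4; rewrite expf_eq0 => /andP[].
by move: h1; rewrite z0 !expr0n /= !mulr0 !addr0 => /eqP; rewrite oner_eq0.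
Qed.

(** The second and fourth coordinates of [Q] are monomials of degrees 8 and 5; their logarithmic
    derivatives [8/z] and [5/z] differ, which already separates [Q] from its derivative. *)
Lemma Q_wedge_Q1 z k l : z != 0 -> k *: Qv z + l *: Q1v z = 0 -> l = 0.
Proof.
move=> z0; rewrite !nvZ nvD => /nv_eq0[_ h2 _ h4 _].
have : z ^+ 7 * (3 * l) = 0.
  have -> : z ^+ 7 * (3 * l) = 2 * (k * (2^-1 * z ^+ 8) + l * (4 * z ^+ 7))
    - z ^+ 3 * (k * z ^+ 5 + l * (5 * z ^+ 4)) by field.
  by rewrite h2 h4 !mulr0 subrr.
by move/eqP; rewrite mulf_eq0 expf_eq0 (negPf z0) mulf_eq0 pnatr_eq0 => /eqP.
Qed.

(** When [z^3 = 1] the second and fourth coordinates are [1/3 + k z^2 / 2] and [5/6 + k z^2], which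
    cannot both vanish. So the surface really has a pole at each cube root of unity, whatever
    multiple of [Q] is added. *)
Lemma Pi_wedge_Q z k : mz z = 0 -> Piv z + k *: Qv z != 0.
Proof.
rewrite /mz => /subr0_eq z3; apply/eqP; rewrite nvZ nvD => /nv_eq0[_ h2 _ h4 _].
have z0 : z != 0 by apply/eqP => z0; move: z3; rewrite z0 expr0n /= => /eqP; rewrite eq_sym oner_eq0.
have e2 : (4 * z ^+ 6 + z ^+ 3 + -1) / 12 + k * (2^-1 * z ^+ 8) = 3^-1 + k / 2 * z ^+ 2.
  have -> : z ^+ 8 = z ^+ 3 * z ^+ 3 * z ^+ 2 by ring.
  have -> : z ^+ 6 = z ^+ 3 * z ^+ 3 by ring.
  by rewrite z3; field.
have e4 : (4 * z ^+ 3 + 1) / 6 + k * z ^+ 5 = 5 / 6 + k * z ^+ 2.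
  have -> : z ^+ 5 = z ^+ 3 * z ^+ 2 by ring.
  by rewrite z3; field.
rewrite e2 in h2; rewrite e4 in h4.
have : (6^-1 : C) = 0.
  have -> : (6^-1 : C) = (5 / 6 + k * z ^+ 2) - 2 * (3^-1 + k / 2 * z ^+ 2) by field.
  by rewrite h2 h4 mulr0 subrr.
by move/eqP; rewrite invr_eq0 pnatr_eq0.
Qed.
End Data.

Ltac smoothC_poly oU h := lazymatch goal with
  | |- smoothC _ (fun _ => ?c) => exact (smoothC_cst c oU)
  | |- smoothC _ (fun q => @?f q + @?g q) => apply (smoothCD (f := f) (g := g) oU); smoothC_poly oU h
  | |- smoothC _ (fun q => - @?f q) => apply (smoothCN (f := f) oU); smoothC_poly oU h
  | |- smoothC _ (fun q => @?f q * @?g q) => apply (smoothCM (f := f) (g := g) oU); smoothC_poly oU h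
  | |- smoothC _ (fun q => _ ^+ ?n) => exact (smoothCX n oU h)
  | |- _ => exact h end.

Ltac smoothV_poly oU h := lazymatch goal with
  | |- smoothV _ (fun q => nv (@?f1 q) (@?f2 q) (@?f3 q) (@?f4 q) (@?f5 q)) =>
    apply (smoothV_nv (f1 := f1) (f2 := f2) (f3 := f3) (f4 := f4) (f5 := f5) oU);
    smoothC_poly oU h end.

(** * The adjoint surface with its denominators cleared *)

Section Values.
Context {R : realType}.
Local Notation C := R[i].
Implicit Types (z : C) (p : plane R).

Section Smooth.
Variables (U : set (plane R)) (ze : plane R -> C).
Hypotheses (oU : open U) (sze : smoothC U ze).

Lemma smoothV_Pv : smoothV U (fun q => Pv (ze q)).
Proof. by rewrite /Pv; smoothV_poly oU sze. Qed.
Lemma smoothV_Qv : smoothV U (fun q => Qv (ze q)).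
Proof. by rewrite /Qv; smoothV_poly oU sze. Qed.
Lemma smoothV_Q1v : smoothV U (fun q => Q1v (ze q)).
Proof. by rewrite /Q1v; smoothV_poly oU sze. Qed.
Lemma smoothV_Piv : smoothV U (fun q => Piv (ze q)).
Proof. by rewrite /Piv; smoothV_poly oU sze. Qed.
Lemma smoothC_mz : smoothC U (fun q => mz (ze q)).
Proof. by rewrite /mz; smoothC_poly oU sze. Qed.
Lemma smoothC_Dz : smoothC U (fun q => Dz (ze q)).
Proof. by rewrite /Dz; smoothC_poly oU sze. Qed.
Lemma smoothC_D1z : smoothC U (fun q => D1z (ze q)).
Proof. by rewrite /D1z; smoothC_poly oU sze. Qed.
End Smooth.

Variables (x0 : 'rV[R]_5) (c : R).

(* [m^-1 c1 = Psi + b Q] where [<Psi + b Q, Q^*>] is the antiholomorphic function [H]. In [yC]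
   the denominator [|m|^2] of the inverse stereographic projection of [xh] is cleared, so
   that [yC] is regular at the poles of [xh]; the last term of [Sv] comes from
   [<c1, c1> = m F]. *)
Definition rv z : C := hdot (Qv z) (Qv z).
Definition Hv z : C := c%:C * z^* ^+ 8.
Definition H1v z : C := c%:C * (8 * z^* ^+ 7).
Definition be z : C := (mz z * Hv z - hdot (Piv z) (Qv z)) / rv z.
Definition be_z z : C :=
  (3 * z ^+ 2 * Hv z - hdot (Pi1v z) (Qv z) - be z * hdot (Q1v z) (Qv z)) / rv z.
Definition be_zb z : C := (mz z * H1v z - hdot (Piv z) (Q1v z) - be z * hdot (Qv z) (Q1v z)) / rv z.
Definition c1v z : 'rV[C]_5 := Piv z + be z *: Qv z.
Definition Fv z : C := - (8 / 9) * z - D1z z / 3 * be z.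
Definition Wv z : C := mz z * (mz z)^*.
Definition nC z : 'rV[C]_5 :=
  Wv z *: toC x0 + ((mz z)^* *: c1v z + mz z *: conjV (c1v z)).
Definition Sv z : C := Wv z * dot (toC x0) (toC x0) +
  2 * dot (toC x0) ((mz z)^* *: c1v z + mz z *: conjV (c1v z)) +
  2 * hdot (c1v z) (c1v z) + ((mz z)^* * Fv z + mz z * (Fv z)^*).
Definition yC z : 'rV[C]_(5 + 1) :=
  row_mx ((2 / (Sv z + Wv z)) *: nC z) (1 - Wv z * (2 / (Sv z + Wv z)))%:M.
Definition yfun z : 'rV[R]_(5 + 1) := reC (yC z).
Definition xhC z : 'rV[C]_5 := toC x0 + ((mz z)^-1 *: c1v z + conjV ((mz z)^-1 *: c1v z)).
Definition xh z : 'rV[R]_5 := reC (xhC z).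

Lemma rv_neq0 z : rv z != 0.
Proof. by rewrite gt_eqF // hdot_gt0 // Qv_neq0. Qed.

Lemma hdot_real m (v : 'rV[C]_m) : (hdot v v)^* = hdot v v.
Proof. by rewrite /hdot -dot_conj conjVK dotC. Qed.

Lemma dot_c1 z : dot (c1v z) (c1v z) = mz z * Fv z.
Proof.
have E (u v : 'rV[C]_5) b : dot (u + b *: v) (u + b *: v) = dot u u + 2 * b * dot u v + b ^+ 2 * dot v v.
  by rewrite !dot_lin (dotC v u); ring.
rewrite /c1v /Fv E dot_QQ dot_PiPi dot_PiQ; move: (be z) (mz z) (D1z z) => b m d.
by field.
Qed.

(** The vector [nC] is [|m|^2] times the surface. Divisibility of [<c1, c1>] by [m] lets one factor
    [Wv] split off, so that the squared norm of the surface is [Sv / Wv] with a smooth numerator. *)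
Lemma dot_nC z : dot (nC z) (nC z) = Wv z * Sv z.
Proof.
have h := dot_c1 z; have h' : dot (conjV (c1v z)) (conjV (c1v z)) = (mz z * Fv z)^*.
  by rewrite dot_conj h.
rewrite conjcM in h'.
have E (u u' x : 'rV[C]_5) m m' f f' : dot u u = m * f -> dot u' u' = m' * f' ->
    dot ((m * m') *: x + (m' *: u + m *: u')) ((m * m') *: x + (m' *: u + m *: u')) =
    m * m' * (m * m' * dot x x + 2 * dot x (m' *: u + m *: u') + 2 * dot u u' + (m' * f + m * f')).
  move=> e e'; rewrite !dot_lin e e' (dotC u' u) !(dotC _ x).
  by move: (dot x x) (dot x u) (dot x u') (dot u u') => d1 d2 d3 d4; ring.
by rewrite /nC /Sv /Wv (E _ _ _ _ _ _ _ h h').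
Qed.

Lemma mzJ0 z : ((mz z)^* == 0) = (mz z == 0). Proof. exact: conjc_eq0. Qed.

Lemma Wv_conj z : (Wv z)^* = Wv z.
Proof. by rewrite /Wv conjcM conjcK mulrC. Qed.

Lemma nC_conj z : conjV (nC z) = nC z.
Proof.
rewrite /nC conjVD conjVZ conjV_toC Wv_conj; congr (_ + _).
by rewrite conjVD !conjVZ !conjVK conjcK addrC.
Qed.

Lemma Sv_conj z : (Sv z)^* = Sv z.
Proof.
have E : (dot (toC x0) ((mz z)^* *: c1v z + mz z *: conjV (c1v z)))^* =
    dot (toC x0) ((mz z)^* *: c1v z + mz z *: conjV (c1v z)).
  rewrite -dot_conj conjV_toC conjVD !conjVZ !conjVK conjcK; congr dot.
  by rewrite addrC.
have rD (a b : C) : a^* = a -> b^* = b -> (a + b)^* = a + b by rewrite conjcD => -> ->.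
have rM (a b : C) : a^* = a -> b^* = b -> (a * b)^* = a * b by rewrite conjcM => -> ->.
have r2 : (2 : C)^* = 2 by exact: conjc_nat.
apply: (rD _ _); [apply: (rD _ _); [apply: (rD _ _)|]|].
- by apply: (rM _ _ (Wv_conj z)); rewrite dot_toC conjc_real.
- exact: (rM _ _ r2 E).
- exact: (rM _ _ r2 (hdot_real (c1v z))).
- by rewrite conjcD !conjcM conjcK conjcK addrC.
Qed.

Lemma Wv_eq0 z : (Wv z == 0) = (mz z == 0).
Proof. by rewrite /Wv mulf_eq0 mzJ0 orbb. Qed.

Lemma Wv_ge0 z : 0 <= Wv z. Proof. exact: mulcJ_ge0. Qed.

Lemma c1_neq0 z : mz z = 0 -> c1v z != 0. Proof. exact: Pi_wedge_Q. Qed.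

(** At a pole only [2 |c1|^2] remains, and [c1] is nonzero there; elsewhere [Sv] is a squared norm
    divided by [Wv > 0]. *)
Lemma SW_gt0 z : 0 < Sv z + Wv z.
Proof.
have [m0|m0] := eqVneq (mz z) 0.
  have e0 : (mz z)^* *: c1v z + mz z *: conjV (c1v z) = 0 by rewrite m0 conjc0 !scale0r addr0.
  rewrite /Sv e0 /Wv m0 conjc0 !mul0r dot0r mulr0 !add0r !addr0.
  by rewrite mulr_gt0 ?ltr0n // hdot_gt0 // c1_neq0.
have W0 : 0 < Wv z by rewrite lt0r Wv_ge0 Wv_eq0 m0.
apply: ltr_wpDl => //.
have -> : Sv z = dot (nC z) (nC z) / Wv z.
  by rewrite dot_nC mulrC mulKf // gt_eqF.
have -> : dot (nC z) (nC z) = hdot (nC z) (nC z) by rewrite /hdot nC_conj.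
by apply: divr_ge0; [exact: hdot_ge0|exact: ltW].
Qed.

Lemma SW_neq0 z : Sv z + Wv z != 0. Proof. by rewrite gt_eqF // SW_gt0. Qed.

Lemma toC_yfun z : toC (yfun z) = yC z.
Proof.
have kJ : (2 / (Sv z + Wv z))^* = 2 / (Sv z + Wv z).
  rewrite conjcM conjc_inv (conjcD (Sv z)) Sv_conj Wv_conj; congr (_ / _); exact: conjc_nat.
apply: toC_real; rewrite /yC /conjV map_row_mx map_scalar_mx; congr (row_mx _ _%:M).
- by rewrite -[LHS]/(conjV _) conjVZ nC_conj kJ.
- rewrite -[LHS]/((1 - Wv z * (2 / (Sv z + Wv z)))^*).
  by rewrite (conjcD 1) conjcN (conjcM (Wv z)) kJ Wv_conj conjc1.
Qed.

Lemma toC_xh z : toC (xh z) = xhC z.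
Proof.
apply: toC_real; rewrite /xhC conjVD conjV_toC; congr (_ + _).
by rewrite conjVD conjVK addrC.
Qed.

Lemma xhC_nC z : mz z != 0 -> xhC z = (Wv z)^-1 *: nC z.
Proof.
move=> m0; have mJ0 : (mz z)^* != 0 by rewrite mzJ0.
rewrite /xhC /nC /Wv conjVZ conjc_inv.
move: (conjV (c1v z)) (c1v z) (toC x0) (mz z) ((mz z)^*) m0 mJ0 => u v w m m' m0 mJ0.
by apply/rowP => j; rewrite !mxE; field; rewrite m0 mJ0.
Qed.

Lemma yfun_stereo z : mz z != 0 -> yfun z = inv_stereo (xh z).
Proof.
move=> m0; apply: toC_inj; rewrite toC_yfun toC_inv_stereo toC_xh (xhC_nC m0) dotZl dotZr dot_nC.
have W0 : Wv z != 0 by rewrite Wv_eq0.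
have := SW_neq0 z; rewrite /yC scalerA; move: (Wv z) (Sv z) W0 => w s w0 sw0.
have -> : 1 + w^-1 * (w^-1 * (w * s)) = (s + w) / w by field.
by congr (row_mx (_ *: _) _%:M); field; rewrite w0 sw0.
Qed.

Lemma yfun_pole z : mz z = 0 -> yC z = row_mx 0 1%:M.
Proof.
move=> m0; rewrite /yC /nC /Wv m0 conjc0 !mul0r !scale0r !addr0 subr0.
by rewrite scaler0.
Qed.

Lemma dot_yfun z : dot (yfun z) (yfun z) = 1.
Proof.
have [m0|m0] := eqVneq (mz z) 0; last by rewrite yfun_stereo // dot_inv_stereo.
apply: (@complexI R); rewrite -dot_toC toC_yfun yfun_pole // dot_row_mx dot0l add0r dot_scalar_mx.
by rewrite mulr1 rmorph1.
Qed.

End Values.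

(** * The derivative of the adjoint surface and the absence of branch points *)

Section Charts.
Context {R : realType}.
Local Notation C := R[i].
Implicit Types (z : C) (p : plane R).
Variables (x0 : 'rV[R]_5) (c : R).

Section Point.
Variables (ze : plane R -> C) (p : plane R) (a : C).
Hypothesis dze : has_dz ze p a 0.

(** Here [ze] is any holomorphic expression of [z] in the chart, with derivative [a]; taking [z]
    itself or its inverse lets one computation serve both charts. *)
Lemma has_dz_Hv : has_dz (fun q => Hv c (ze q)) p 0 (a^* * H1v c (ze p)).
Proof.
have h := has_dzZ (c%:C) (has_dzX 8 (has_dzJ dze)).
by apply: has_dz_eq h _ _; rewrite ?conjc0 ?mulr0 // /H1v /=; ring.
Qed.

Lemma has_dz_rv : has_dz (fun q => rv (ze q)) p (a * hdot (Q1v (ze p)) (Qv (ze p)))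
  (a^* * hdot (Qv (ze p)) (Q1v (ze p))).
Proof.
have hQ := has_vdz_Qv dze; have h := has_dz_dot hQ (has_vdzJ hQ).
apply: has_dz_eq h _ _.
- by rewrite conjV0 dot0r addr0 dotZl.
- by rewrite dot0l add0r conjVZ dotZr.
Qed.

Lemma has_dz_be : has_dz (fun q => be c (ze q)) p (a * be_z c (ze p)) (a^* * be_zb c (ze p)).
Proof.
have hP := has_dz_dot (has_vdz_Piv dze) (has_vdzJ (has_vdz_Qv dze)).
have hN := has_dzB (has_dzM (has_dz_mz dze) has_dz_Hv) hP.
have h := has_dzM hN (has_dzV (rv_neq0 (ze p)) has_dz_rv).
apply: has_dz_eq h _ _.
- rewrite conjV0 dot0r addr0 dotZl -/(hdot (Pi1v _) _) /be_z {1}/be -/(hdot (Piv _) _).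
  move: (ze p) => z; have := rv_neq0 z.
  move: (hdot (Pi1v z) (Qv z)) (hdot (Piv z) (Qv z)) (hdot (Q1v z) (Qv z)) (rv z) (Hv c z) (mz z).
  by move=> h1 h2 h3 r H m r0; field.
- rewrite dot0l add0r conjVZ dotZr -/(hdot (Piv _) (Q1v _)) /be_zb {1}/be -/(hdot (Piv _) (Qv _)).
  move: (ze p) (conjc a) => z a'; have := rv_neq0 z.
  move: (hdot (Piv z) (Q1v z)) (hdot (Piv z) (Qv z)) (hdot (Qv z) (Q1v z)) (rv z) (Hv c z) (H1v c z) (mz z).
  by move=> h1 h2 h3 r H H' m r0; field.
Qed.

Lemma has_vdz_c1 : has_vdz (fun q => c1v c (ze q)) p
  (a *: (Pi1v (ze p) + be_z c (ze p) *: Qv (ze p) + be c (ze p) *: Q1v (ze p)))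
  ((a^* * be_zb c (ze p)) *: Qv (ze p)).
Proof.
have h := has_vdzD (has_vdz_Piv dze) (has_vdzZ has_dz_be (has_vdz_Qv dze)).
apply: has_vdz_eq h _ _.
- move: (Pi1v _) (Qv _) (Q1v _) (be _ _) (be_z _ _) => u v w b b'.
  by apply/rowP => j; rewrite !mxE; ring.
- by rewrite scaler0 addr0 add0r.
Qed.

End Point.

(** The z-derivative of [xh]: the derivative of [c1 / m], plus the conjugate of its zbar-derivative,
    the latter being a multiple of [Q]. *)
Definition Av z : 'rV[C]_5 := (mz z) ^- 2 *: dPiv z
  + (be_z c z / mz z - 3 * z ^+ 2 * be c z / mz z ^+ 2) *: Qv z
  + (be c z / mz z) *: Q1v z + (be_zb c z / mz z)^* *: conjV (Qv z).

Lemma has_vdz_xh ze p a : has_dz ze p a 0 -> mz (ze p) != 0 ->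
  has_vdz (fun q => toC (xh x0 c (ze q))) p (a *: Av (ze p)) (conjV (a *: Av (ze p))).
Proof.
move=> dze m0.
have h1 := has_vdzZ (has_dzV m0 (has_dz_mz dze)) (has_vdz_c1 dze).
have h2 := has_vdzD (has_vdz_cst (toC x0) p) (has_vdzD h1 (has_vdzJ h1)).
have E : (fun q => toC (xh x0 c (ze q))) = (fun q => toC x0 +
    ((mz (ze q))^-1 *: c1v c (ze q) + conjV ((mz (ze q))^-1 *: c1v c (ze q)))).
  by apply/funext => q; rewrite toC_xh.
have h3 : vdz (fun q => toC (xh x0 c (ze q))) p = a *: Av (ze p).
  rewrite E (has_vdz_vdz h2) add0r /Av /dPiv /c1v conjVD.
  rewrite oppr0 mul0r scale0r conjV0 add0r (conjVZ ((mz _)^-1)) (conjVZ (_ * be_zb _ _)).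
  rewrite (conjcM (conjc a)) conjcK (conjcM (be_zb _ _)).
  move: (ze p) m0 => z m0.
  move: (mz z) (Piv _) (Pi1v _) (Qv _) (Q1v _) (conjV _) (be _ _) (be_z _ _) (conjc (be_zb _ _)) (conjc ((mz _)^-1)) m0.
  move=> m u v w w' wJ b b' t mJ m0.
  by apply/rowP => j; rewrite !mxE; field.
rewrite -h3 -vdzb_toC E; move: h2; rewrite -E => h2.
by rewrite (has_vdz_vdz h2) (has_vdz_vdzb h2).
Qed.

(** After [dot_null_comb] there remains the z-derivative of [<c1 / m, conj Q>]. That function is [H]
    by the choice of [be], and [H] is antiholomorphic. *)
Lemma Av_null z : mz z != 0 -> dot (Av z) (Av z) = 0.
Proof.
move=> m0.
have hx : dot (conjV (Qv z)) (conjV (Qv z)) = 0 by rewrite dot_conj dot_QQ conjc0.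
apply: (etrans (dot_null_comb _ _ _ _ (dot_dPi_dPi z) (dot_QQ z) hx (dot_dPi_Q z) (dot_dPi_Q1 z) (dot_QQ1 z))).
rewrite dot_Q1Q1 mulr0 add0r.
have -> : dot (dPiv z) (conjV (Qv z)) = mz z * hdot (Pi1v z) (Qv z) - 3 * z ^+ 2 * hdot (Piv z) (Qv z).
  by rewrite /dPiv dotDl dotNl (dotZl (mz z)) (dotZl (3 * z ^+ 2)).
rewrite -/(hdot (Q1v z) (Qv z)) -/(hdot (Qv z) (Qv z)) -/(rv z) /be_z.
have := rv_neq0 z; have -> : hdot (Piv z) (Qv z) = mz z * Hv c z - be c z * rv z.
  by rewrite /be divfK ?rv_neq0 // opprB addrCA subrr addr0.
move: (hdot (Pi1v z) (Qv z)) (hdot (Q1v z) (Qv z)) (rv z) (be c z) (Hv c z) (mz z) m0 (conjc _).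
move=> h1 h2 r b H m m0 t r0.
by field; rewrite m0 r0.
Qed.

(* The differential of [xh] vanishes where [b = 0] and [b_zbar = 0]. *)
Definition no_branch := forall z, Dz z != 0 ->
  hdot (Pv z) (Qv z) = Dz z ^+ 2 * Hv c z -> hdot (Pv z) (Q1v z) = Dz z ^+ 2 * H1v c z -> False.

(** With [g = (4 z^3 - 3) / 6] one has [Pi / m = Psi + (g / D^2) Q]; this is the derivative of that
    identity, multiplied by [D^3]. *)
Lemma dPiv_PQ z : (z ^+ 3 * mz z) *: dPiv z =
  (1 + 2 * z ^+ 2 * Dz z - (4 * z ^+ 3 - 3) / 3 * D1z z) *: Qv z +
  ((4 * z ^+ 3 - 3) / 6 * Dz z) *: Q1v z.
Proof.
rewrite /dPiv -scaleNr scalerDr !scalerA !nvZ !nvD; apply: nv_eq; rewrite /mz /Dz /D1z; by field.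
Qed.

Lemma dot_Av z y : dot (Av z) y = (mz z) ^- 2 * dot (dPiv z) y
  + (be_z c z / mz z - 3 * z ^+ 2 * be c z / mz z ^+ 2) * dot (Qv z) y
  + be c z / mz z * dot (Q1v z) y + (be_zb c z / mz z)^* * dot (conjV (Qv z)) y.
Proof.
have E (u v w x y' : 'rV[C]_5) k l m t : dot (k *: u + l *: v + m *: w + t *: x) y' =
  k * dot u y' + l * dot v y' + m * dot w y' + t * dot x y'.
  by rewrite !dotDl !dotZl.
exact: E.
Qed.

Lemma Qv0 : Qv 0 = nv 1 0 0 0 0 :> 'rV[C]_5.
Proof. by apply: nv_eq; ring. Qed.

Lemma Q1v0 : Q1v 0 = nv 0 0 0 0 0 :> 'rV[C]_5.
Proof. by apply: nv_eq; ring. Qed.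

Lemma dPiv0 : dPiv 0 = nv (80 / 3) 0 12 0 0 :> 'rV[C]_5.
Proof. by rewrite /dPiv -scaleNr !nvZ nvD; apply: nv_eq; rewrite /mz; field. Qed.

(** The combination set to zero is the coefficient of [Q] measured from [Psi] instead of from
    [Pi / m]. Substituting [P] for [Pi] brings the two vanishing conditions into the form excluded
    by [no_branch]. *)
Lemma no_branch_be z : no_branch -> z != 0 -> mz z != 0 ->
  be c z / mz z + (4 * z ^+ 3 - 3) / 6 / (z ^+ 2 * mz z ^+ 2) = 0 -> be_zb c z = 0 -> False.
Proof.
move=> nb z0 m0 b0 t0; have r0 := rv_neq0 z.
have bE : be c z = - ((4 * z ^+ 3 - 3) / 6) / (z ^+ 2 * mz z).
  apply/eqP; rewrite -subr_eq0; apply/eqP.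
  have -> : be c z - - ((4 * z ^+ 3 - 3) / 6) / (z ^+ 2 * mz z) =
     mz z * (be c z / mz z + (4 * z ^+ 3 - 3) / 6 / (z ^+ 2 * mz z ^+ 2)).
    by move: (be c z) (mz z) m0 => b m m0; field; rewrite m0 z0.
  by rewrite b0 mulr0.
apply: (nb z); rewrite ?Dz_mz ?mulf_neq0 // Pv_Piv /hdot dotDl dotNl !dotZl -!/(hdot _ _).
- have -> : hdot (Piv z) (Qv z) = mz z * Hv c z - be c z * rv z.
    by rewrite {1}/be divfK // opprB addrCA subrr addr0.
  rewrite bE -/(rv z); move: (rv z) (Hv c z) (mz z) m0 => r H m m0; by field; rewrite m0 z0.
- have -> : hdot (Piv z) (Q1v z) = mz z * H1v c z - be c z * hdot (Qv z) (Q1v z).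
    have : be_zb c z * rv z = 0 by rewrite t0 mul0r.
    rewrite /be_zb divfK // => /eqP; rewrite -addrA -opprD subr_eq0 => /eqP ->.
    by rewrite addrK.
  rewrite bE; move: (hdot (Qv z) (Q1v z)) (H1v c z) (mz z) m0 => h H m m0; by field; rewrite m0 z0.
Qed.

Lemma Av_neq0 z : no_branch -> mz z != 0 -> Av z != 0.
Proof.
move=> nb m0; apply/eqP => A0.
have [z0|z0] := eqVneq z 0.
  (* At 0 the vector [Q] and its conjugate lie in the span of [E1] and its conjugate and [Q1] is
     zero, so the [E2] component of [dPiv 0] cannot cancel. *)
  have A1 : dot (Av 0) (nv 0 0 0 1 0) = 0.
    by move: A0; rewrite z0 => ->; exact: dot0l.
  have h1 : dot (dPiv 0) (nv 0 0 0 1 0) = 24 :> C by rewrite dPiv0 dot_nv; ring.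
  have h2 : dot (Qv 0) (nv 0 0 0 1 0) = 0 :> C by rewrite Qv0 dot_nv; ring.
  have h3 : dot (Q1v 0) (nv 0 0 0 1 0) = 0 :> C by rewrite Q1v0 dot_nv; ring.
  have h4 : dot (conjV (Qv 0)) (nv 0 0 0 1 0) = 0 :> C.
    by rewrite Qv0 conjV_nv dot_nv conjc0; ring.
  have G (k l m n e f g h : C) : e = 24 -> f = 0 -> g = 0 -> h = 0 ->
      k * e + l * f + m * g + n * h = k * 24.
    by move=> -> -> -> ->; rewrite !mulr0 !addr0.
  have := etrans (esym (etrans (dot_Av 0 _) (G _ _ _ _ _ _ _ _ h1 h2 h3 h4))) A1.
  have -> : mz 0 ^- 2 = 1 :> C by rewrite /mz; field.
  by rewrite mul1r => /eqP; rewrite pnatr_eq0.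
have r0 := rv_neq0 z.
(* Pairing with [Q] kills every isotropic term and leaves the conjugate of [Q], which forces
   [be_zb = 0]. Independence of [Q] and [Q1] then yields the second branch equation. *)
have Q0 : dot (Av z) (Qv z) = (be_zb c z / mz z)^* * rv z.
  rewrite dot_Av dot_dPi_Q dot_QQ (dotC (Q1v z)) dot_QQ1 (dotC (conjV _)).
  by rewrite !mulr0 !add0r.
have t0 : be_zb c z = 0.
  move: Q0; rewrite A0 dot0l => /esym/eqP; rewrite mulf_eq0 (negPf r0) orbF conjc_eq0.
  by rewrite mulf_eq0 invr_eq0 (negPf m0) orbF => /eqP.
have b0 : be c z / mz z + (4 * z ^+ 3 - 3) / 6 / (z ^+ 2 * mz z ^+ 2) = 0.
  have : (z ^+ 3 * mz z ^+ 3) *: Av z = 0 by rewrite A0 scaler0.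
  have E (u v w x : 'rV[C]_5) k a l n k1 l1 : (k * a) *: u = k1 *: v + l1 *: w ->
      k *: (a *: u + l *: v + n *: w + 0 *: x) = (k1 + k * l) *: v + (l1 + k * n) *: w.
    move=> h; rewrite scale0r addr0 !scalerDr !scalerA h.
    by apply/rowP => j; rewrite !mxE; ring.
  have h1 := dPiv_PQ z.
  have km : z ^+ 3 * mz z ^+ 3 * (mz z) ^- 2 = z ^+ 3 * mz z.
    by move: (mz z) m0 => m m0; field.
  rewrite -km in h1.
  have t0' : (be_zb c z / mz z)^* = 0 by rewrite t0 mul0r conjc0.
  rewrite /Av t0' (E _ _ _ _ _ _ _ _ _ _ h1).
  move/(Q_wedge_Q1 z0); rewrite Dz_mz => h.
  apply: (mulfI (_ : z ^+ 3 * mz z ^+ 3 != 0)); first by rewrite mulf_neq0 // expf_neq0.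
  by rewrite mulr0 -h; move: (be c z) (mz z) m0 => b m m0; field; rewrite m0 z0.
exact: (no_branch_be nb z0 m0 b0 t0).
Qed.

End Charts.

Section Chart.
Context {R : realType}.
Local Notation C := R[i].
Implicit Types (z : C) (p : plane R).
Variables (x0 : 'rV[R]_5) (c : R).
Variables (U : set (plane R)) (ze a : plane R -> C).
Hypotheses (oU : open U) (sze : smoothC U ze).
Hypothesis dze : forall p, U p -> has_dz ze p (a p) 0.
Hypothesis a_neq0 : forall p, U p -> a p != 0.
Hypothesis nb : no_branch c.

Lemma smoothC_be : smoothC U (fun q => be c (ze q)).
Proof.
have sQ := smoothV_Qv oU sze; have sP := smoothV_Piv oU sze.
have sr : smoothC U (fun q => rv (ze q)) by apply: (smoothC_dot oU sQ); exact: smoothVJ.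
have sH : smoothC U (fun q => Hv c (ze q)).
  apply: (smoothCM oU (smoothC_cst _ oU)); apply: smoothCX => //; exact: smoothCJ.
apply: (smoothCM oU); last by apply: (smoothCV oU sr) => q _; exact: rv_neq0.
apply: (smoothCB oU); first exact: (smoothCM oU (smoothC_mz oU sze) sH).
by apply: (smoothC_dot oU sP); exact: smoothVJ.
Qed.

Lemma smoothV_c1 : smoothV U (fun q => c1v c (ze q)).
Proof.
exact: (smoothVD oU (smoothV_Piv oU sze) (smoothVZ oU smoothC_be (smoothV_Qv oU sze))).
Qed.

Lemma smoothC_Wv : smoothC U (fun q => Wv (ze q)).
Proof. have sm := smoothC_mz oU sze; exact: (smoothCM oU sm (smoothCJ oU sm)). Qed.

Lemma smoothV_cross : smoothV U (fun q => (mz (ze q))^* *: c1v c (ze q) + mz (ze q) *: conjV (c1v c (ze q))).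
Proof.
have sm := smoothC_mz oU sze.
exact: (smoothVD oU (smoothVZ oU (smoothCJ oU sm) smoothV_c1) (smoothVZ oU sm (smoothVJ oU smoothV_c1))).
Qed.

Lemma smoothV_nC : smoothV U (fun q => nC x0 c (ze q)).
Proof.
exact: (smoothVD oU (smoothVZ oU smoothC_Wv (smoothV_cst _ oU)) smoothV_cross).
Qed.

Lemma smoothC_Fv : smoothC U (fun q => Fv c (ze q)).
Proof.
apply: (smoothCB oU); first exact: (smoothCM oU (smoothC_cst _ oU) sze).
apply: (smoothCM oU _ smoothC_be).
exact: (smoothCM oU (smoothC_D1z oU sze) (smoothC_cst _ oU)).
Qed.

Lemma smoothC_Sv : smoothC U (fun q => Sv x0 c (ze q)).
Proof.
have sm := smoothC_mz oU sze; have sF := smoothC_Fv.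
apply: (smoothCD oU); last exact: (smoothCD oU (smoothCM oU (smoothCJ oU sm) sF)
  (smoothCM oU sm (smoothCJ oU sF))).
apply: (smoothCD oU); last first.
  exact: (smoothCM oU (smoothC_cst _ oU) (smoothC_dot oU smoothV_c1 (smoothVJ oU smoothV_c1))).
apply: (smoothCD oU); first exact: (smoothCM oU smoothC_Wv (smoothC_cst _ oU)).
exact: (smoothCM oU (smoothC_cst _ oU) (smoothC_dot oU (smoothV_cst _ oU) smoothV_cross)).
Qed.

Lemma smoothC_k : smoothC U (fun q => 2 / (Sv x0 c (ze q) + Wv (ze q))).
Proof.
apply: (smoothCM oU (smoothC_cst _ oU)); apply: (smoothCV oU (smoothCD oU smoothC_Sv smoothC_Wv)).
by move=> q _; exact: SW_neq0.
Qed.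

Lemma smooth_chart : smooth_row U (fun q => yfun x0 c (ze q)).
Proof.
apply/(smooth_rowP _ oU).
apply: (smoothV_ext oU (F := fun q => yC x0 c (ze q))) => [q _|]; first by rewrite toC_yfun.
apply: smoothV_row_mx; first exact: (smoothVZ oU smoothC_k smoothV_nC).
apply: smoothV_scalar_mx.
exact: (smoothCB oU (smoothC_cst _ oU) (smoothCM oU smoothC_Wv smoothC_k)).
Qed.

Lemma chart_regular p : U p -> mz (ze p) != 0 ->
  vdz (fun q => toC (yfun x0 c (ze q))) p = stereo_dz (toC (xh x0 c (ze p))) (a p *: Av c (ze p)).
Proof.
move=> Up m0.
have nm := smoothC_near_neq0 oU (smoothC_mz oU sze) Up m0.
have nE : \forall q \near p, toC (yfun x0 c (ze q)) = toC (inv_stereo (xh x0 c (ze q))).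
  by apply: filterS nm => q mq; rewrite yfun_stereo.
rewrite (vdz_ext nE); exact: has_vdz_vdz (has_vdz_inv_stereo (has_vdz_xh x0 c (dze Up) m0)).
Qed.

(** Where [m = 0] the function [|m|^2] vanishes to second order, so its first derivatives are zero,
    and in the derivative of [nC] only [m_z] times the conjugate of [c1] survives. That vector is
    nonzero, and it is null because [<c1, c1>] is divisible by [m]. *)
Lemma chart_pole p : U p -> mz (ze p) = 0 ->
  vdz (fun q => toC (yfun x0 c (ze q))) p = row_mx
   (2 / (Sv x0 c (ze p) + Wv (ze p)) * (a p * (3 * ze p ^+ 2)) *: conjV (c1v c (ze p))) 0%:M.
Proof.
move=> Up m0.
have hk := smoothC_has_dz smoothC_k Up.
have hm := has_dz_mz (dze Up); have hc := has_vdz_c1 c (dze Up).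
have hW := has_dzM hm (has_dzJ hm).
have hn := has_vdzD (has_vdzZ hW (has_vdz_cst (toC x0) p))
  (has_vdzD (has_vdzZ (has_dzJ hm) hc) (has_vdzZ hm (has_vdzJ hc))).
have h := has_vdz_row_mx (has_vdzZ hk hn)
  (has_vdz_scalar_mx (has_dzB (has_dz_cst 1 p) (has_dzM hW hk))).
have E : (fun q => toC (yfun x0 c (ze q))) = (fun q => row_mx
    ((2 / (Sv x0 c (ze q) + Wv (ze q))) *: ((mz (ze q) * (mz (ze q))^*) *: toC x0 +
      ((mz (ze q))^* *: c1v c (ze q) + mz (ze q) *: conjV (c1v c (ze q)))))
    (1 - mz (ze q) * (mz (ze q))^* * (2 / (Sv x0 c (ze q) + Wv (ze q))))%:M).
  by apply/funext => q; rewrite toC_yfun.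
rewrite E (has_vdz_vdz h); cbv beta; rewrite m0 !conjc0.
move: (ze p) (dz _ p) (2 / _) (toC x0) (c1v c _) (conjV (_ *: _)) (conjV (c1v c _)) => z k' k x v u' u.
congr (row_mx _ _%:M); last by ring.
by apply/rowP => j; rewrite !mxE; ring.
Qed.

Lemma chart_vdz p : U p -> vdz (fun q => toC (yfun x0 c (ze q))) p != 0 /\
  dot (vdz (fun q => toC (yfun x0 c (ze q))) p) (vdz (fun q => toC (yfun x0 c (ze q))) p) = 0.
Proof.
move=> Up; have a0 := a_neq0 Up.
have [m0|m0] := eqVneq (mz (ze p)) 0.
  have z0 : ze p != 0.
    by apply/eqP => z0; move/eqP: m0; rewrite z0 (negPf mz0_neq0).
  rewrite (chart_pole Up m0); set k := _ * _; set v := conjV _; split.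
    have k0 : k != 0.
      rewrite /k !mulf_neq0 ?invr_eq0 ?expf_neq0 ?pnatr_eq0 //; exact: SW_neq0.
    have v0 : v != 0.
      apply: contra (c1_neq0 c m0) => /eqP h; rewrite -(conjVK (c1v c (ze p))) -/v h.
      by rewrite conjV0.
    apply/eqP => h; have [/eqP + _] := eq_row_mx (etrans h (esym (@row_mx0 _ 1 5 1))).
    by rewrite scaler_eq0 (negPf k0) (negPf v0).
  rewrite dot_row_mx dot_scalar_mx dotZl dotZr dot_conj dot_c1 m0 mul0r conjc0.
  by rewrite !mulr0 addr0.
rewrite (chart_regular Up m0); split.
  by apply: stereo_dz_neq0; rewrite scaler_eq0 (negPf a0) (negPf (Av_neq0 nb m0)).
by apply: dot_stereo_dz; rewrite dotZl dotZr (Av_null c m0) !mulr0.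
Qed.

End Chart.

(** * The chart at infinity and the choice of the constant *)

Section Infinity.
Context {R : realType}.
Local Notation C := R[i].
Implicit Types (z w : C) (p : plane R).
Variables (x0 : 'rV[R]_5) (c : R).

Lemma open_zcoord_neq0 (f : C -> C) : smoothC setT (fun p => f (zcoord p)) ->
  open [set p : plane R | f (zcoord p) != 0].
Proof.
move=> sf; have := open_smoothC_neq0 openT sf.
by congr open; apply/seteqP; split=> p //= [].
Qed.

Lemma zcoord_inj : injective (@zcoord R).
Proof. by move=> [a b] [a' b'] [] -> ->. Qed.

Lemma zcoord_plane_of z : zcoord (plane_of z) = z. Proof. by case: z. Qed.

Lemma zcoord_eq0 p : (zcoord p == 0) = (p == 0).
Proof.
apply/eqP/eqP => [h|->] //; exact: zcoord_inj.
Qed.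

Definition bv z : C := (Hv c z - hdot ((Dz z) ^- 2 *: Pv z) (Qv z)) / rv z.

(** Passes from the decomposition with base [Pi], regular at 0, to the one with base [Psi], where
    [bv] is the coefficient whose zeros matter. *)
Lemma c1_Psi z : Dz z != 0 ->
  (mz z)^-1 *: c1v c z = (Dz z) ^- 2 *: Pv z + bv z *: Qv z.
Proof.
move=> /Dz_neq0[z0 m0]; rewrite Dz_mz.
have hE : hdot ((z * mz z) ^- 2 *: Pv z) (Qv z) =
   (z * mz z) ^- 2 * ((z ^+ 2 * mz z) * hdot (Piv z) (Qv z) - (4 * z ^+ 3 - 3) / 6 * rv z).
  by rewrite /hdot dotZl Pv_Piv dotDl dotNl (dotZl (z ^+ 2 * _)) (dotZl (_ / 6)).
rewrite /bv Dz_mz hE /c1v /be Pv_Piv.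
have r0 := rv_neq0 z; move: r0 m0.
move: (hdot (Piv z) (Qv z)) (rv z) (Hv c z) (mz z) (Piv z) (Qv z) => h r H m u v r0 m0.
by apply/rowP => j; rewrite !mxE; field; rewrite r0 m0 z0.
Qed.

(* [P (1/w) = w^-6 Pt w] and [Q (1/w) = w^-9 Qt w]. *)
Definition Ptv w : 'rV[C]_5 := nv ((w ^+ 6 + 32 * w ^+ 3) / 2) ((w ^+ 4 + - 2 * w) / 12)
  (8 * w ^+ 3 + - 5) (- 6^-1 * w ^+ 4) (- 2^-1 * w ^+ 2).
Definition Qtv w : 'rV[C]_5 := nv (w ^+ 9 + - 20 * w ^+ 6 + - 80 * w ^+ 3) (2^-1 * w)
  (10 + - 20 * w ^+ 3 + - 8 * w ^+ 6) (w ^+ 4) (2 * w ^+ 2 + w ^+ 5).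
Definition rt w : C := hdot (Qtv w) (Qtv w).
Definition Psit w : 'rV[C]_5 := (w ^+ 2 / mz w ^+ 2) *: Ptv w.
(** This is [w^-9] times [bv] at [1/w]. The term [c * conj w] is [H (1/w)] times the ninth power of
    [conj w]. *)
Definition bt w : C := (c%:C * w^* - hdot (Psit w) (Qtv w)) / rt w.
Definition xtC w : 'rV[C]_5 := toC x0 + (Psit w + bt w *: Qtv w + conjV (Psit w + bt w *: Qtv w)).
Definition xt w : 'rV[R]_5 := reC (xtC w).

Lemma Qtv_neq0 w : Qtv w != 0.
Proof.
apply/eqP => /nv_eq0[_ h2 h3 _ _].
have w0 : w = 0.
  by apply/eqP; move/eqP: h2; rewrite mulf_eq0 invr_eq0 pnatr_eq0.
have : (10 : C) = 0 by rewrite -h3 w0; ring.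
by move/eqP; rewrite pnatr_eq0.
Qed.

Lemma rt_neq0 w : rt w != 0. Proof. by rewrite gt_eqF // hdot_gt0 // Qtv_neq0. Qed.

Lemma toC_xt w : toC (xt w) = xtC w.
Proof.
apply: toC_real; rewrite /xtC conjVD conjV_toC; congr (_ + _).
by move: (Psit w + _) => v; rewrite conjVD conjVK addrC.
Qed.

Lemma Qv_inv w : w != 0 -> Qv w^-1 = w ^- 9 *: Qtv w.
Proof. by move=> w0; rewrite /Qv /Qtv nvZ; apply: nv_eq; field. Qed.

Lemma Psi_inv w : w != 0 -> mz w != 0 -> (Dz w^-1) ^- 2 *: Pv w^-1 = Psit w.
Proof.
move=> w0 m0; have DE : Dz w^-1 = - mz w / w ^+ 4 by rewrite /Dz /mz; field.
rewrite DE /Psit; move: (mz w) m0 => m m0.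
by rewrite /Pv /Ptv !nvZ; apply: nv_eq; field; rewrite w0 m0.
Qed.

Lemma mz_inv w : w != 0 -> mz w != 0 -> mz w^-1 != 0.
Proof.
move=> w0 m0; have -> : mz w^-1 = - mz w / w ^+ 3 by rewrite /mz; field.
by rewrite mulf_neq0 ?oppr_eq0 ?invr_eq0 ?expf_neq0.
Qed.

Lemma xh_inv w : w != 0 -> mz w != 0 -> xh x0 c w^-1 = xt w.
Proof.
move=> w0 m0; apply: toC_inj; rewrite toC_xh toC_xt /xhC /xtC.
have wJ0 : w^* != 0 by rewrite conjc_eq0.
have D0 : Dz w^-1 != 0.
  have -> : Dz w^-1 = w^-1 * mz w^-1 by rewrite /Dz /mz; ring.
  by rewrite mulf_neq0 ?invr_eq0 // mz_inv.
suff -> : (mz w^-1)^-1 *: c1v c w^-1 = Psit w + bt w *: Qtv w by [].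
rewrite (c1_Psi D0) (Psi_inv w0 m0); congr (_ + _); rewrite (Qv_inv w0) scalerA; congr (_ *: _).
rewrite /bv /bt (Psi_inv w0 m0) (Qv_inv w0).
have -> : rv w^-1 = w ^- 9 * w^* ^- 9 * rt w.
  by rewrite /rv Qv_inv // /hdot conjVZ dotZl dotZr conjc_inv conjcX mulrA.
have -> : hdot (Psit w) (w ^- 9 *: Qtv w) = w^* ^- 9 * hdot (Psit w) (Qtv w).
  by rewrite /hdot conjVZ dotZr conjc_inv conjcX.
rewrite /Hv conjc_inv; move: (hdot _ _) (rt w) (rt_neq0 w) (w^*) wJ0 => h r r0 w' w'0.
by field; rewrite w0 w'0 r0.
Qed.

Lemma xt0 : xt 0 = x0.
Proof.
apply: toC_inj; rewrite toC_xt /xtC.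
have P0 : Psit 0 = 0 by rewrite /Psit expr0n /= mul0r scale0r.
have b0 : bt 0 = 0 by rewrite /bt P0 conjc0 mulr0 /hdot dot0l subr0 mul0r.
by rewrite P0 b0 scale0r addr0 conjV0 !addr0.
Qed.

Lemma smooth_xt U : open U -> (forall p, U p -> mz (zcoord p) != 0) ->
  smooth_row U (fun p => xt (zcoord p)).
Proof.
move=> oU m0; have sz := smoothC_zcoord oU; apply/(smooth_rowP _ oU).
have sP : smoothV U (fun p => Ptv (zcoord p)) by rewrite /Ptv; smoothV_poly oU sz.
have sQ : smoothV U (fun p => Qtv (zcoord p)) by rewrite /Qtv; smoothV_poly oU sz.
have sPsi : smoothV U (fun p => Psit (zcoord p)).
  apply: (smoothVZ oU _ sP); apply: (smoothCM oU (smoothCX 2 oU sz)).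
  apply: (smoothCV oU (smoothCX 2 oU (smoothC_mz oU sz))) => p Up.
  by rewrite expf_neq0 // m0.
have sb : smoothC U (fun p => bt (zcoord p)).
  apply: (smoothCM oU); last first.
    by apply: (smoothCV oU (smoothC_dot oU sQ (smoothVJ oU sQ))) => p _; exact: rt_neq0.
  apply: (smoothCB oU); first exact: (smoothCM oU (smoothC_cst _ oU) (smoothCJ oU sz)).
  exact: (smoothC_dot oU sPsi (smoothVJ oU sQ)).
have sv := smoothVD oU sPsi (smoothVZ oU sb sQ).
apply: (smoothV_ext oU _ (smoothVD oU (smoothV_cst (toC x0) oU) (smoothVD oU sv (smoothVJ oU sv)))).
by move=> p _; rewrite toC_xt.
Qed.

(** At [w = 0] the term [Psit] vanishes to second order, [Qtv 0 = 10 E2] and [rt 0 = 200]. To first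
    order the adjoint correction is therefore [(c / 20) conj(w) E2]; the z-derivative comes from its
    conjugate. *)
Lemma has_vdz_xt0 p : p = 0 -> has_vdz (fun q => toC (xt (zcoord q))) p
  (nv 0 0 0 (c%:C / 20) 0) (conjV (nv 0 0 0 (c%:C / 20) 0)).
Proof.
move=> p0; have z0 : zcoord p = 0 by rewrite p0.
have hz := has_dz_zcoord p; have sz := smoothC_zcoord (@openT (plane R)).
have hP : has_vdz (fun q => Ptv (zcoord q)) p (vdz (fun q => Ptv (zcoord q)) p)
    (vdzb (fun q => Ptv (zcoord q)) p).
  by apply: (smoothV_has_vdz (U := setT)) => //; rewrite /Ptv; smoothV_poly (@openT (plane R)) sz.
have hQ : has_vdz (fun q => Qtv (zcoord q)) p (vdz (fun q => Qtv (zcoord q)) p)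
    (vdzb (fun q => Qtv (zcoord q)) p).
  by apply: (smoothV_has_vdz (U := setT)) => //; rewrite /Qtv; smoothV_poly (@openT (plane R)) sz.
have m0 : mz (zcoord p) ^+ 2 != 0.
  by rewrite z0 expf_neq0 // mz0_neq0.
have hf := has_dzM (has_dzX 2 hz) (has_dzV m0 (has_dzX 2 (has_dz_mz hz))).
have hPsi : has_vdz (fun q => Psit (zcoord q)) p 0 0.
  apply: has_vdz_eq (has_vdzZ hf hP) _ _.
  - by rewrite z0 /= !expr0n /= !(mul0r, mulr0, scale0r, addr0, add0r, expr1).
  - by rewrite z0 /= !expr0n /= !(mul0r, mulr0, scale0r, addr0, add0r, expr1).
have P0 : Psit (zcoord p) = 0 by rewrite z0 /Psit expr0n /= mul0r scale0r.
have hN := has_dzB (has_dzZ c%:C (has_dzJ hz)) (has_dz_dot hPsi (has_vdzJ hQ)).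
have hr : has_dz (fun q => rt (zcoord q)) p _ _ := has_dz_dot hQ (has_vdzJ hQ).
have hb := has_dzM hN (has_dzV (rt_neq0 (zcoord p)) hr).
have r200 : rt 0 = 200.
  have -> : rt 0 = hdot (nv 0 0 10 0 0) (nv 0 0 10 0 0).
    by rewrite /rt; have -> : Qtv 0 = nv 0 0 10 0 0 by apply: nv_eq; ring.
  by rewrite hdot_nv conjc_nat !conjc0; ring.
have hb' : has_dz (fun q => bt (zcoord q)) p 0 (c%:C / 200).
  apply: has_dz_eq hb _ _; cbv beta; rewrite P0 !dot0l ?conjc0 ?conjc1 z0 r200 ?conjc0.
  - by move: (dot _ _ + _) => k; field.
  - by move: (dot _ _ + _) => k; field.
have hv := has_vdzD hPsi (has_vdzZ hb' hQ).
have b0 : bt (zcoord p) = 0.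
  by rewrite /bt P0 z0 conjc0 mulr0 /hdot dot0l subr0 mul0r.
have Q0 : Qtv (zcoord p) = nv 0 0 10 0 0 by rewrite z0; apply: nv_eq; ring.
have {}hv : has_vdz (fun q => Psit (zcoord q) + bt (zcoord q) *: Qtv (zcoord q)) p
    0 (nv 0 0 (c%:C / 20) 0 0).
  have G (k l : C) (u v : 'rV[C]_5) : k = 0 -> 0 + (l *: u + k *: v) = l *: u.
    by move=> ->; rewrite scale0r addr0 add0r.
  apply: has_vdz_eq hv _ _; apply: (etrans (G _ _ _ _ b0)); first exact: scale0r.
  by rewrite Q0 nvZ; apply: nv_eq; field.
have h := has_vdzD (has_vdz_cst (toC x0) p) (has_vdzD hv (has_vdzJ hv)).
have E : (fun q => toC (xt (zcoord q))) = (fun q => toC x0 +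
  (Psit (zcoord q) + bt (zcoord q) *: Qtv (zcoord q) +
   conjV (Psit (zcoord q) + bt (zcoord q) *: Qtv (zcoord q)))).
  by apply/funext => q; rewrite toC_xt.
have cJ : (c%:C / 20 : C)^* = c%:C / 20.
  by rewrite conjcM conjc_real conjc_inv; congr (_ / _); exact: conjc_nat.
have nJ : conjV (nv 0 0 (c%:C / 20) 0 0) = nv 0 0 0 (c%:C / 20) 0.
  rewrite conjV_nv; apply: nv_eq; try exact: conjc0; exact: cJ.
have G (u : 'rV[C]_5) : 0 + (0 + u) = u by rewrite !add0r.
have G' (u : 'rV[C]_5) : 0 + (u + conjV 0) = u by rewrite conjV0 addr0 add0r.
rewrite E; apply: has_vdz_eq h _ _.
  by apply: (etrans (G _)).
exact: (etrans (G' _) (etrans (esym (conjVK _)) (congr1 (@conjV R 5) nJ))).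
Qed.

End Infinity.

(** * Choosing the constant so that no branch point exists *)

Section Constant.
Context {R : realType}.
Local Notation C := R[i].
Implicit Types (z w : C) (p : plane R).

(* The constant [c] cancels in this combination of the two equations of [no_branch]. *)
Definition Gv z : C := 8 * hdot (Pv z) (Qv z) - z^* * hdot (Pv z) (Q1v z).

Lemma GvE z : Gv z = (1 + 32 * z ^+ 3) * (8 - 100 * z^* ^+ 3 - 160 * z^* ^+ 6)
  - 20 * (8 * z ^+ 3 - 5 * z ^+ 6) * (z^* ^+ 9 + 4 * z^* ^+ 6 + 4 * z^* ^+ 3)
  - z ^+ 2 * z^* ^+ 5 - 30 * z ^+ 4 * (z^* ^+ 7 + 2 * z^* ^+ 4).
Proof.
rewrite /Gv /hdot conjV_Qv conjV_Q1v /Pv (dot_nv _ _ _ _ _ (2^-1 * _)) dot_nv.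
by move: (z^*) => w; field.
Qed.

Lemma norm_monomials (L : seq (nat * nat * nat)) z w : 1 <= `|z| -> `|w| = `|z| ->
  all (fun t => t.1.2 + t.2 <= 12)%N L ->
  `|\sum_(t <- L) t.1.1%:R * z ^+ t.1.2 * w ^+ t.2| <= (\sum_(t <- L) t.1.1)%N%:R * `|z| ^+ 12.
Proof.
move=> z1 wz; elim: L => [|[[k a] b] L IH] /=; first by rewrite !big_nil normr0 mul0r.
move=> /andP[ab aL]; rewrite !big_cons natrD mulrDl.
apply: le_trans (ler_normD _ _) (lerD _ (IH aL)).
rewrite /= !normrM !normrX wz normr_nat -mulrA -exprD ler_wpM2l ?ler0n //.
exact: ler_weXn2l.
Qed.

(** The term [100 z^6 zbar^9] has degree 15, all other monomials have degree at most 12 and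
    coefficients of total size below 15000. A zero with [|z| >= 1] thus satisfies [|z|^3 <= 150],
    incompatible with [|z| >= 10]. *)
Lemma Gv_far z : 10 <= `|z| -> Gv z != 0.
Proof.
move=> z10; apply/eqP => G0.
have z1 : 1 <= `|z| by apply: le_trans z10; rewrite ler1n.
have wz : `|z^*| = `|z| by exact: normcJ.
(* Entries are coefficient, power of [z], power of [zbar]: [LA] lists the terms of [Gv] with
   negative sign, [LB] those with positive sign other than the leading one. The coefficient 5760 is
   entered as two halves. *)
pose LA : seq (nat * nat * nat) := [:: (100, 0, 3); (160, 0, 6); (3840, 3, 3); (2880, 3, 6); (2880, 3, 6);
  (160, 3, 9); (1, 2, 5); (30, 4, 7); (60, 4, 4)]%N.
pose LB : seq (nat * nat * nat) := [:: (8, 0, 0); (256, 3, 0); (400, 6, 6); (400, 6, 3)]%N.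
have hA := @norm_monomials LA z (z^*) z1 wz isT.
have hB := @norm_monomials LB z (z^*) z1 wz isT.
have E : 100 * z ^+ 6 * z^* ^+ 9 = \sum_(t <- LA) t.1.1%:R * z ^+ t.1.2 * z^* ^+ t.2 -
    \sum_(t <- LB) t.1.1%:R * z ^+ t.1.2 * z^* ^+ t.2.
  rewrite /LA /LB !big_cons !big_nil /=; apply/eqP; rewrite -subr_eq0 -[X in _ == X]G0 GvE.
  by move: (z^*) => w; apply/eqP; ring.
have := le_trans (ler_normB _ _) (lerD hA hB); rewrite -E -mulrDl -natrD.
have hN : (\sum_(t <- LA) t.1.1 + \sum_(t <- LB) t.1.1 <= 100 * 150)%N.
  by rewrite /LA /LB !big_cons !big_nil.
rewrite (normrM (100 * z ^+ 6)) (normrM 100) !normrX wz normr_nat -mulrA -exprD.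
have -> : `|z| ^+ (6 + 9) = `|z| ^+ 3 * `|z| ^+ 12 by rewrite -exprD.
have p12 : 0 < `|z| ^+ 12 by rewrite exprn_gt0 // (lt_le_trans _ z1).
rewrite mulrA ler_pM2r // => h.
have h3 : 10 ^+ 3 <= `|z| ^+ 3 by rewrite lerXn2r // ?nnegrE ?ler0n // normr_ge0.
have hC : (\sum_(t <- LA) t.1.1 + \sum_(t <- LB) t.1.1)%N%:R <= 100 * 150 :> C.
  by rewrite -natrM ler_nat.
have := le_trans h hC; rewrite ler_pM2l ?ltr0n // => /(le_trans h3).
by rewrite -natrX ler_nat.
Qed.

(** The hypothesis holds exactly at 0 and at the cube roots of unity. At 0 the value of [Gv] is 8;
    at a cube root [z^3 = zbar^3 = z zbar = 1] reduces every monomial to a number, and the total is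
    -8947. *)
Lemma Gv_special z : Dz z ^+ 2 * z^* ^+ 8 = 0 -> Gv z != 0.
Proof.
move=> /eqP; rewrite mulf_eq0 !expf_eq0 /= conjc_eq0.
rewrite Dz_mz mulf_eq0 orbAC orbb => /orP[/eqP z0|/eqP m0]; apply/eqP; rewrite GvE.
  rewrite z0 conjc0 => h; have : (8 : C) = 0 by rewrite -h; ring.
  by move/eqP; rewrite pnatr_eq0.
have z3 : z ^+ 3 = 1 by move: m0; rewrite /mz => /subr0_eq.
have w3 : z^* ^+ 3 = 1 by rewrite -conjcX z3 conjc1.
have s1 : z * z^* = 1.
  apply/eqP; rewrite -(@pexpr_eq1 _ _ 3) ?mulcJ_ge0 //.
  by rewrite exprMn z3 w3 mulr1.
move: (z^*) w3 s1 => w w3 s1.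
have -> : z ^+ 2 * w ^+ 5 = (z * w) ^+ 2 * w ^+ 3 by ring.
have -> : 30 * z ^+ 4 * (w ^+ 7 + 2 * w ^+ 4) = 30 * (z * w) ^+ 4 * (w ^+ 3 + 2) by ring.
have -> : w ^+ 9 = w ^+ 3 * w ^+ 3 * w ^+ 3 by ring.
have -> : w ^+ 6 = w ^+ 3 * w ^+ 3 by ring.
have -> : z ^+ 6 = z ^+ 3 * z ^+ 3 by ring.
rewrite z3 w3 s1 => h.
have : (8947 : C) = 0 by rewrite -[RHS]oppr0 -h; ring.
by move/eqP; rewrite pnatr_eq0.
Qed.

Lemma Re_mulJ_ge0 z : 0 <= complex.Re (z * z^*).
Proof. by have := mulcJ_ge0 z; rewrite lecE => /andP[_]. Qed.

(* [Gv] is nonzero for [10 <= |z|] and wherever the coefficient [D^2 zbar^8] of [c] vanishes, so a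
   solution of the two equations has bounded [z], and by compactness bounded [c]. *)
Lemma exists_no_branch : exists2 c : R, 0 < c & no_branch c.
Proof.
pose E z : C := Dz z ^+ 2 * z^* ^+ 8.
pose g p : R := complex.Re (Gv (zcoord p) * (Gv (zcoord p))^*) +
  complex.Re (E (zcoord p) * (E (zcoord p))^*).
pose f p : R := complex.Re (hdot (Pv (zcoord p)) (Qv (zcoord p)) *
  (hdot (Pv (zcoord p)) (Qv (zcoord p)))^*).
have oT := @openT (plane R); have sz := smoothC_zcoord oT.
have sh V : smoothV setT (fun p => V (zcoord p) : 'rV[C]_5) ->
    smoothC setT (fun p => hdot (Pv (zcoord p)) (V (zcoord p))).
  by move=> sV; exact: (smoothC_dot oT (smoothV_Pv oT sz) (smoothVJ oT sV)).
have sPQ := sh _ (smoothV_Qv oT sz); have sPQ1 := sh _ (smoothV_Q1v oT sz).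
have sJ := smoothCJ oT sz.
have sG : smoothC setT (fun p => Gv (zcoord p)).
  exact: (smoothCB oT (smoothCM oT (smoothC_cst _ oT) sPQ) (smoothCM oT sJ sPQ1)).
have sE : smoothC setT (fun p => E (zcoord p)).
  exact: (smoothCM oT (smoothCX 2 oT (smoothC_Dz oT sz)) (smoothCX 8 oT sJ)).
have cont (h : plane R -> R) : smooth setT h -> continuous h.
  by move=> sh' p; exact: (smooth_continuous sh').
have sq (h : plane R -> C) : smoothC setT h ->
    smooth setT (fun p => complex.Re (h p * (h p)^*)).
  by move=> sh'; have [] := smoothCM oT sh' (smoothCJ oT sh').
have cg : continuous g by apply: cont; apply: (smoothD oT); exact: sq.
have cf : continuous f by apply: cont; exact: sq.
pose K : set (plane R) := `[(-10 : R), 10] `*` `[(-10 : R), 10].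
have cK : compact K by apply: compact_setX; exact: segment_compact.
have K0 : K !=set0 by exists (0, 0); split; rewrite /= in_itv /=; apply/andP; split; lra.
have [p1 _ hp1] := compact_EVT_min K0 cK (continuous_subspaceT cg).
have [p2 _ hp2] := compact_EVT_max K0 cK (continuous_subspaceT cf).
have g1 : 0 < g p1.
  have h1 := Re_mulJ_ge0 (Gv (zcoord p1)); have h2 := Re_mulJ_ge0 (E (zcoord p1)).
  rewrite lt0r addr_ge0 // andbT; apply/negP => /eqP g0.
  have e0 : E (zcoord p1) = 0.
    apply/eqP; apply: contraT => /Re_mulJ_neq0 /eqP ne; exfalso; apply: ne.
    by move: g0; rewrite /g => g0; lra.
  have n0 := Gv_special e0; have := Re_mulJ_neq0 n0; move/eqP; apply.
  by move: g0; rewrite /g => g0; lra.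
have f0 : 0 <= f p2 by exact: Re_mulJ_ge0.
(* At a solution [Gv] vanishes, so [g = |E|^2] and [f = c^2 |E|^2]. Then
   [f >= c^2 min g >= c min g], which exceeds [max f] for this [c]. *)
pose c := 1 + f p2 / g p1.
have c1 : 1 <= c by rewrite ler_wpDr // divr_ge0 // ltW.
exists c; first by rewrite (lt_le_trans _ c1).
move=> z D0 h1 h2.
have G0 : Gv z = 0.
  rewrite /Gv h1 h2 /Hv /H1v; move: (z^*) (Dz z) c%:C => w d k; ring.
pose p := plane_of z; have zp : zcoord p = z by exact: zcoord_plane_of.
have nz : ~~ (10 <= `|z|) by apply/negP => /Gv_far; rewrite G0 eqxx.
have pK : p \in K.
  rewrite inE; split; rewrite /= in_itv /= -ler_norml leNgt; apply: contra nz => h.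
  - by apply: le_trans (normc_ge_Re z); rewrite -(rmorph_nat (real_complex R) 10) lecR ltW.
  - have -> : `|z| = `|z * 'i| by rewrite normrM normCi mulr1.
    apply: le_trans (normc_ge_Re _); rewrite imag_unitE !ReImE /= mulr0 mulr1 sub0r normrN.
    by rewrite -(rmorph_nat (real_complex R) 10) lecR ltW.
have := hp1 p pK; have := hp2 p pK; rewrite /f /g zp G0 conjc0 mulr0 add0r -/(f p2) -/(g p1).
have -> : hdot (Pv z) (Qv z) = c%:C * E z.
  by rewrite h1 /Hv /E; move: (z^*) (Dz z) c%:C => w d k; ring.
have -> : complex.Re (c%:C * E z * (c%:C * E z)^*) = c ^+ 2 * complex.Re (E z * (E z)^*).
  by case: (E z) => a b; rewrite !ReImE /=; ring.
move=> hf hg.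
have hc : f p2 < c * g p1.
  by rewrite /c mulrDl mul1r divfK ?gt_eqF // ltr_pwDl.
have h3 : c * g p1 <= c ^+ 2 * complex.Re (E z * (E z)^*).
  rewrite expr2 -mulrA ler_wpM2l //; first exact: le_trans c1.
  by apply: le_trans hg _; rewrite ler_peMl // Re_mulJ_ge0.
by have := lt_le_trans hc (le_trans h3 hf); rewrite ltxx.
Qed.

End Constant.

(** * Jets of the adjoint surface *)

Section Jets.
Context {R : realType}.
Local Notation C := R[i].
Implicit Types (z : C) (p q : plane R).
Variables (x0 : 'rV[R]_5) (c : R).
Hypothesis nb : no_branch c.

Lemma has_vdz_Q2v (ze : plane R -> C) p a : has_dz ze p a 0 ->
  exists B, has_vdz (fun q => Q2v (ze q)) p B 0.
Proof.
move=> dze; rewrite /Q2v; eexists; lazymatch goal with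
  | |- has_vdz (fun q => nv (@?f1 q) (@?f2 q) (@?f3 q) (@?f4 q) (@?f5 q)) _ _ _ =>
    eapply has_vdz_eq;
      [eapply (has_vdz_nv (f1 := f1) (f2 := f2) (f3 := f3) (f4 := f4) (f5 := f5)); holo dze |
       reflexivity | rewrite -nv00; apply: nv_eq; rewrite /=; by ring] end.
Qed.

Definition bb z : C := be c z / mz z + (4 * z ^+ 3 - 3) / 6 / Dz z ^+ 2.
Let W : set (plane R) := [set p | Dz (zcoord p) != 0].
Let beta p := bb (zcoord p).

Lemma open_W : open W.
Proof. by apply: (open_zcoord_neq0 (f := Dz)); exact: (smoothC_Dz openT (smoothC_zcoord openT)). Qed.

Lemma smooth_beta : smoothC W beta.
Proof.
have oW := open_W; have sz := smoothC_zcoord oW.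
apply: (smoothCD oW).
  apply: (smoothCM oW (smoothC_be c oW sz)); apply: (smoothCV oW (smoothC_mz oW sz)) => p /Dz_neq0[] //.
apply: (smoothCM oW); last first.
  apply: (smoothCV oW (smoothCX 2 oW (smoothC_Dz oW sz))) => p Wp; exact: expf_neq0.
have s3 : smoothC W (fun p => 4 * zcoord p ^+ 3 - 3).
  exact: (smoothCB oW (smoothCM oW (smoothC_cst _ oW) (smoothCX 3 oW sz)) (smoothC_cst _ oW)).
exact: (smoothCM oW s3 (smoothC_cst _ oW)).
Qed.

(** The coefficient of [Q] in the z-derivative of the surface: the derivative of [bb] plus the
    contribution [D^-3] of [Psi' = Q / D^3]. *)
Definition Al z : C := be_z c z / mz z - 3 * z ^+ 2 * be c z / mz z ^+ 2
  + (1 + 2 * z ^+ 2 * Dz z - (4 * z ^+ 3 - 3) / 3 * D1z z) / Dz z ^+ 3.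

Lemma has_dz_beta p : W p -> has_dz beta p (Al (zcoord p) - (Dz (zcoord p)) ^- 3)
  (be_zb c (zcoord p) / mz (zcoord p)).
Proof.
move=> Wp; have [z0 m0] := Dz_neq0 Wp; have hz := has_dz_zcoord p.
have hb := has_dzM (has_dz_be c hz) (has_dzV m0 (has_dz_mz hz)).
have D2 : Dz (zcoord p) ^+ 2 != 0 by exact: expf_neq0.
have hf := has_dzM (has_dzM (has_dzB (has_dzZ 4 (has_dzX 3 hz)) (has_dz_cst 3 p)) (has_dz_cst (6^-1 : C) p))
  (has_dzV D2 (has_dzX 2 (has_dz_Dz hz))).
have h := has_dzD hb hf.
apply: has_dz_eq h _ _.
- rewrite /Al; have D0 : Dz (zcoord p) != 0 := Wp.
  move: (zcoord p) z0 m0 D0 => z z0 m0 D0 /=.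
  move: (be c z) (be_z c z) (mz z) (Dz z) (D1z z) m0 D0 => b b' m d d1 m0 D0.
  by field; rewrite m0 D0.
- rewrite conjc1; have D0 : Dz (zcoord p) != 0 := Wp.
  move: (zcoord p) z0 m0 D0 => z z0 m0 D0 /=.
  move: (be c z) (be_zb c z) (mz z) (Dz z) m0 D0 => b b' m d m0 D0.
  by field; rewrite m0 D0.
Qed.

Lemma Av_QQ1 z : Dz z != 0 -> Av c z = Al z *: Qv z + bb z *: Q1v z
  + (be_zb c z / mz z)^* *: conjV (Qv z).
Proof.
move=> D0; have [z0 m0] := Dz_neq0 D0; rewrite /Av; congr (_ + _).
have h : (mz z) ^- 2 *: dPiv z = (z ^+ 3 * mz z ^+ 3)^-1 *: ((z ^+ 3 * mz z) *: dPiv z).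
  rewrite scalerA; congr (_ *: _); by field; rewrite z0 m0.
rewrite h dPiv_PQ /Al /bb Dz_mz.
move: (be c z) (be_z c z) (mz z) (D1z z) (Qv z) (Q1v z) m0 => b b' m d1 u v m0.
by apply/rowP => j; rewrite !mxE; field; rewrite m0 z0.
Qed.

(** Expresses that [<Psi + b Q, conj Q>] has zero z-derivative, being the antiholomorphic function
    [H]. *)
Lemma Al_relation z : Dz z != 0 -> Al z * rv z + bb z * hdot (Q1v z) (Qv z) = 0.
Proof.
move=> D0; have [z0 m0] := Dz_neq0 D0.
have hP : z ^+ 3 * mz z * (mz z * hdot (Pi1v z) (Qv z) - 3 * z ^+ 2 * hdot (Piv z) (Qv z)) =
    (1 + 2 * z ^+ 2 * Dz z - (4 * z ^+ 3 - 3) / 3 * D1z z) * rv z +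
    (4 * z ^+ 3 - 3) / 6 * Dz z * hdot (Q1v z) (Qv z).
  have := congr1 (fun v => dot v (conjV (Qv z))) (dPiv_PQ z).
  have E (u v w : 'rV[C]_5) k l : dot (k *: u + l *: v) w = k * dot u w + l * dot v w.
    by rewrite dotDl !dotZl.
  have E' (u v w : 'rV[C]_5) k l m : dot (k *: (l *: u - m *: v)) w = k * (l * dot u w - m * dot v w).
    by rewrite dotZl dotDl dotNl !dotZl.
  by move=> h; apply: (etrans (esym (E' _ _ _ _ _ _)) (etrans h (E _ _ _ _ _))).
have hPi : hdot (Piv z) (Qv z) = mz z * Hv c z - be c z * rv z.
  by rewrite {1}/be divfK ?rv_neq0 // opprB addrCA subrr addr0.
have r0 := rv_neq0 z.
have key : Al z * rv z + bb z * hdot (Q1v z) (Qv z) = (mz z) ^- 2 *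
  (mz z * hdot (Pi1v z) (Qv z) - 3 * z ^+ 2 * hdot (Piv z) (Qv z)) +
   (be_z c z / mz z - 3 * z ^+ 2 * be c z / mz z ^+ 2) * rv z + be c z / mz z * hdot (Q1v z) (Qv z).
  have -> : (mz z) ^- 2 * (mz z * hdot (Pi1v z) (Qv z) - 3 * z ^+ 2 * hdot (Piv z) (Qv z)) =
    (z ^+ 3 * mz z ^+ 3)^-1 *
     (z ^+ 3 * mz z * (mz z * hdot (Pi1v z) (Qv z) - 3 * z ^+ 2 * hdot (Piv z) (Qv z))).
    move: (_ - _) => k; move: (mz z) m0 => m m0; by field; rewrite m0 z0.
  rewrite hP /Al /bb Dz_mz.
  move: (hdot (Q1v z) (Qv z)) (be c z) (be_z c z) (rv z) (D1z z) => h b b' r d1.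
  by move: (mz z) m0 => m m0; field; rewrite m0 z0.
rewrite key hPi /be_z.
move: (hdot (Pi1v z) _) => h1; move: (hdot _ _) => h2; move: (rv z) (be c z) (Hv c z) (mz z) m0 r0 => r b H m m0 r0.
by field; rewrite m0 r0.
Qed.

Let al p := dz beta p + (Dz (zcoord p)) ^- 3.
Let tau p := (dzb beta p)^*.
Let xz := fun q => toC (xh x0 c (zcoord q)).
Let A := vdz xz.
Local Notation Q p := (Qv (zcoord p)).
Local Notation Q1 p := (Q1v (zcoord p)).
Local Notation Q2 p := (Q2v (zcoord p)).

Lemma al_Al p : W p -> al p = Al (zcoord p).
Proof. by move=> Wp; rewrite /al (has_dz_dz (has_dz_beta Wp)) subrK. Qed.

Lemma A_QQ1 p : W p -> A p = al p *: Q p + beta p *: Q1 p + tau p *: conjV (Q p).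
Proof.
move=> Wp; have [z0 m0] := Dz_neq0 Wp.
have h := has_vdz_xh x0 c (has_dz_zcoord p) m0.
rewrite /A (has_vdz_vdz h) scale1r Av_QQ1 // (al_Al Wp).
by rewrite /tau (has_dz_dzb (has_dz_beta Wp)).
Qed.

Lemma smooth_al : smoothC W al.
Proof.
have oW := open_W; have sz := smoothC_zcoord oW.
apply: (smoothCD oW (smoothC_dz oW smooth_beta)).
by apply: (smoothCV oW (smoothCX 3 oW (smoothC_Dz oW sz))) => p Wp; exact: expf_neq0.
Qed.

Lemma smooth_tau : smoothC W tau.
Proof. exact: (smoothCJ open_W (smoothC_dzb open_W smooth_beta)). Qed.

Lemma smooth_xz : smooth_row W (fun p => xh x0 c (zcoord p)).
Proof.
have oW := open_W; have sz := smoothC_zcoord oW; apply/(smooth_rowP _ oW).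
have sm : smoothC W (fun p => (mz (zcoord p))^-1).
  by apply: (smoothCV oW (smoothC_mz oW sz)) => p /Dz_neq0[].
have s1 := smoothVZ oW sm (smoothV_c1 c oW sz).
apply: (smoothV_ext oW _ (smoothVD oW (smoothV_cst (toC x0) oW) (smoothVD oW s1 (smoothVJ oW s1)))).
by move=> p _; rewrite toC_xh.
Qed.

Lemma A_null p : W p -> dot (A p) (A p) = 0.
Proof.
move=> Wp; have [z0 m0] := Dz_neq0 Wp.
have h := has_vdz_xh x0 c (has_dz_zcoord p) m0.
by rewrite /A (has_vdz_vdz h) scale1r Av_null.
Qed.

Lemma has_vdz_A p : W p -> has_vdz A p
  (dz al p *: Q p + (al p + dz beta p) *: Q1 p + beta p *: Q2 p + dz tau p *: conjV (Q p))
  (dzb al p *: Q p + dzb beta p *: Q1 p + (dzb tau p *: conjV (Q p) + tau p *: conjV (Q1 p))).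
Proof.
move=> Wp; have oW := open_W; have hz := has_dz_zcoord p.
have hQ := has_vdz_Qv hz; have hQ1 := has_vdz_Q1v hz.
have ha := smoothC_has_dz smooth_al Wp; have hb := smoothC_has_dz smooth_beta Wp.
have ht := smoothC_has_dz smooth_tau Wp.
have h := has_vdzD (has_vdzD (has_vdzZ ha hQ) (has_vdzZ hb hQ1)) (has_vdzZ ht (has_vdzJ hQ)).
have nE : \forall q \near p, al q *: Q q + beta q *: Q1 q + tau q *: conjV (Q q) = A q.
  by apply: (nbhs_eq_on oW Wp) => q Wq; rewrite A_QQ1.
have G (u v w u' : 'rV[C]_5) a' a b' b t' t :
    a' *: u + a *: (1 *: v) + (b' *: v + b *: (1 *: w)) + (t' *: u' + t *: conjV 0) =
    a' *: u + (a + b') *: v + b *: w + t' *: u'.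
  by rewrite conjV0; apply/rowP => j; rewrite !mxE; ring.
have G' (u v u' v' : 'rV[C]_5) a' a b' b t' t :
    a' *: u + a *: 0 + (b' *: v + b *: 0) + (t' *: u' + t *: conjV (1 *: v')) =
    a' *: u + b' *: v + (t' *: u' + t *: conjV v').
  by rewrite scale1r; move: (conjV v') => v''; apply/rowP => j; rewrite !mxE; ring.
by apply: has_vdz_eq (has_vdz_ext nE h) _ _; [exact: G|exact: G'].
Qed.

(** Only the coefficient of [Q2] is kept explicit; it carries the obstruction to the S-Willmore
    property. *)
Lemma vdzb_A1 p : W p -> exists a b d e, vdzb (vdz A) p =
  a *: Q p + b *: Q1 p + dzb beta p *: Q2 p + (d *: conjV (Q p) + e *: conjV (Q1 p)).
Proof.
move=> Wp; have oW := open_W; have hz := has_dz_zcoord p.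
have hQ := has_vdz_Qv hz; have hQ1 := has_vdz_Q1v hz; have [B hQ2] := has_vdz_Q2v hz.
have ha := smoothC_has_dz (smoothC_dz oW smooth_al) Wp.
have hb := smoothC_has_dz smooth_beta Wp.
have hab := has_dzD (smoothC_has_dz smooth_al Wp) (smoothC_has_dz (smoothC_dz oW smooth_beta) Wp).
have ht := smoothC_has_dz (smoothC_dz oW smooth_tau) Wp.
have h := has_vdzD (has_vdzD (has_vdzD (has_vdzZ ha hQ) (has_vdzZ hab hQ1)) (has_vdzZ hb hQ2))
  (has_vdzZ ht (has_vdzJ hQ)).
have nE : \forall q \near p, dz al q *: Q q + (al q + dz beta q) *: Q1 q + beta q *: Q2 q +
    dz tau q *: conjV (Q q) = vdz A q.
  by apply: (nbhs_eq_on oW Wp) => q Wq; rewrite (has_vdz_vdz (has_vdz_A Wq)).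
rewrite (has_vdz_vdzb (has_vdz_ext nE h)).
have G (u v w u' v' : 'rV[C]_5) a' a b' b e' e t' t :
    a' *: u + a *: 0 + (b' *: v + b *: 0) + (e' *: w + e *: 0) + (t' *: u' + t *: conjV (1 *: v')) =
    a' *: u + b' *: v + e' *: w + (t' *: u' + t *: conjV v').
  by rewrite scale1r; move: (conjV v') => v''; apply/rowP => j; rewrite !mxE; ring.
by do 4 eexists; exact: G.
Qed.

(** The mixed bracket produced by [dot_null_comb] is the z-derivative of the left-hand side of
    [Al_relation] and vanishes, leaving the square of the [Q2] term. *)
Lemma jet_dot p : W p -> dot (vdz A p) (vdz A p) = beta p ^+ 2 * (480 * zcoord p ^+ 2 * Dz (zcoord p) ^+ 2).
Proof.
move=> Wp; rewrite (has_vdz_vdz (has_vdz_A Wp)); have oW := open_W; have hz := has_dz_zcoord p.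
have hx : dot (conjV (Q p)) (conjV (Q p)) = 0 by rewrite dot_conj dot_QQ conjc0.
apply: (etrans (dot_null_comb _ _ _ _ (dot_QQ _) (dot_Q1Q1 _) hx (dot_QQ1 _) (dot_QQ2 _) (dot_Q1Q2 _))).
rewrite dot_Q2Q2.
suff -> : dz al p * dot (Q p) (conjV (Q p)) + (al p + dz beta p) * dot (Q1 p) (conjV (Q p)) +
    beta p * dot (Q2 p) (conjV (Q p)) = 0 by rewrite mulr0 addr0.
have hQ := has_vdz_Qv hz; have hQ1 := has_vdz_Q1v hz.
have h := has_dzD (has_dzM (smoothC_has_dz smooth_al Wp) (has_dz_rv hz))
  (has_dzM (smoothC_has_dz smooth_beta Wp) (has_dz_dot hQ1 (has_vdzJ hQ))).
have nE : \forall q \near p, 0 = al q * rv (zcoord q) + beta q * dot (Q1 q) (conjV (Q q)).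
  by apply: (nbhs_eq_on oW Wp) => q Wq; rewrite (al_Al Wq) Al_relation.
have h0 := etrans (esym (has_dz_dz h)) (has_dz_dz (has_dz_ext nE (has_dz_cst 0 p))).
have G (u v w x : 'rV[C]_5) a' a b' b :
    a' * dot u x + a * (1 * dot v x) + (b' * dot v x + b * (dot (1 *: w) x + dot v (conjV 0))) = 0 ->
    a' * dot u x + (a + b') * dot v x + b * dot w x = 0.
  by move=> <-; rewrite conjV0 dot0r scale1r; move: (dot u x) (dot v x) (dot w x) => d1 d2 d3; ring.
exact: (G (Q p) (Q1 p) (Q2 p) (conjV (Q p)) _ _ _ _ h0).
Qed.

Lemma tau_neq0 p : W p -> beta p = 0 -> tau p != 0.
Proof.
move=> Wp b0; have [z0 m0] := Dz_neq0 Wp.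
rewrite /tau (has_dz_dzb (has_dz_beta Wp)) conjc_eq0 mulf_eq0 invr_eq0 (negPf m0) orbF.
apply/eqP => t0; apply: (no_branch_be nb z0 m0 _ t0).
by rewrite -[RHS]b0 /beta /bb Dz_mz exprMn.
Qed.

(** Where [beta = 0], [Al_relation] gives [al = 0], hence [beta_z = - D^-3]. So [A] is a multiple of
    the conjugate of [Q], while [A_z] has a nonzero [Q1] component. Pairing with [Q] removes the
    conjugate direction, and independence of [Q] and [Q1] concludes. *)
Lemma jet_not_umbilic p : W p -> beta p = 0 -> ~ exists a, vdz A p = a *: A p.
Proof.
move=> Wp b0 [a +]; have [z0 m0] := Dz_neq0 Wp; have r0 := rv_neq0 (zcoord p).
have Z (X Y u v w x : 'rV[C]_5) k l m t k' t' : m = 0 ->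
    X = k *: u + l *: v + m *: w + t *: x -> Y = k' *: u + m *: v + t' *: x -> X = a *: Y ->
    k *: u + l *: v + t *: x = a *: (k' *: u + t' *: x).
  by move=> -> -> ->; rewrite !scale0r !addr0.
move=> /(Z _ _ _ _ _ _ _ _ _ _ _ _ b0 (has_vdz_vdz (has_vdz_A Wp)) (A_QQ1 Wp)).
have al0 : al p = 0.
  have := Al_relation Wp; rewrite -(al_Al Wp) -/(beta p) b0 mul0r addr0 => /eqP.
  by rewrite mulf_eq0 (negPf r0) orbF => /eqP.
have bz : dz beta p = - (Dz (zcoord p)) ^- 3.
  by have := al0; rewrite /al => /eqP; rewrite addr_eq0 => /eqP.
rewrite al0 bz add0r scale0r add0r scalerA => h.
have E (u v w x : 'rV[C]_5) k l t : dot (k *: u + l *: v + t *: w) x = k * dot u x + l * dot v x + t * dot w x.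
  by rewrite !dotDl !dotZl.
have h1 := congr1 (fun v => dot v (Q p)) h.
have h2 := etrans (esym (E _ _ _ _ _ _ _)) (etrans h1 (dotZl _ _ _)).
rewrite dot_QQ (dotC (Q1 p)) dot_QQ1 (dotC (conjV _)) -/(hdot (Q p) (Q p)) -/(rv (zcoord p)) !mulr0 !add0r in h2.
have h3 := mulIf r0 h2.
rewrite h3 in h; have := addIr (_ : 'rV[C]_5) (etrans h (esym (add0r _))).
move=> /(Q_wedge_Q1 z0)/eqP; rewrite oppr_eq0 invr_eq0 expf_eq0 /=.
by rewrite (negPf Wp).
Qed.

(* Where [beta = 0], only the left-hand side has a component along [Q2], with coefficient
   [beta_zbar], which is nonzero there. *)
Lemma jet_not_s_willmore p : W p -> beta p = 0 -> ~ exists a b d e,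
  vdzb (vdz A) p = a *: A p + b *: conjV (A p) + d *: vdzb A p + e *: vdz A p.
Proof.
move=> Wp b0 [a [b [d [e h]]]]; have [z0 m0] := Dz_neq0 Wp.
have [a1 [b1 [d1 [e1 hAA]]]] := vdzb_A1 Wp.
have hA1 := has_vdz_vdz (has_vdz_A Wp); have hAb := has_vdz_vdzb (has_vdz_A Wp).
have hA : A p = al p *: Q p + tau p *: conjV (Q p).
  have Z (X u v x : 'rV[C]_5) k l t : l = 0 -> X = k *: u + l *: v + t *: x -> X = k *: u + t *: x.
    by move=> -> ->; rewrite scale0r addr0.
  exact: (Z _ _ _ _ _ _ _ b0 (A_QQ1 Wp)).
have hJ : conjV (A p) = (al p)^* *: conjV (Q p) + (tau p)^* *: Q p.
  have Z (X u : 'rV[C]_5) k t : X = k *: u + t *: conjV u -> conjV X = k^* *: conjV u + t^* *: u.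
    by move=> ->; rewrite conjVD !conjVZ conjVK.
  exact: (Z _ _ _ _ hA).
have hA2 : vdz A p = dz al p *: Q p + (al p + dz beta p) *: Q1 p + dz tau p *: conjV (Q p).
  have Z (X u v w x : 'rV[C]_5) k l m t : m = 0 -> X = k *: u + l *: v + m *: w + t *: x ->
      X = k *: u + l *: v + t *: x.
    by move=> -> ->; rewrite scale0r addr0.
  exact: (Z _ _ _ _ _ _ _ _ _ b0 hA1).
move: h; rewrite hAA hA2 hAb hJ hA.
have t0 : dzb beta p != 0 by have := tau_neq0 Wp b0; rewrite /tau conjc_eq0.
have G (u v u' v' w : 'rV[C]_5) k1 k2 k3 k4 k5 l1 l2 l3 l4 l5 n1 n2 n3 n4 n5 n6 :
    k1 *: u + k2 *: v + k3 *: w + (k4 *: u' + k5 *: v') =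
    a *: (l1 *: u + l2 *: u') + b *: (l3 *: u' + l4 *: u) +
    d *: (n1 *: u + n2 *: v + (n3 *: u' + n4 *: v')) + e *: (n5 *: u + n6 *: v + l5 *: u') ->
  k3 *: w = (a * l1 + b * l4 + d * n1 + e * n5 - k1) *: u + (d * n2 + e * n6 - k2) *: v
    + ((a * l2 + b * l3 + d * n3 + e * l5 - k4) *: u' + (d * n4 - k5) *: v').
  move=> h; have -> : k3 *: w = k1 *: u + k2 *: v + k3 *: w + (k4 *: u' + k5 *: v')
     - k1 *: u - k2 *: v - k4 *: u' - k5 *: v'.
    by apply/rowP => j; rewrite !mxE; ring.
  by rewrite h; apply/rowP => j; rewrite !mxE; ring.
move=> /G; move: (_ - a1) (_ - b1) (_ - d1) (_ - e1) => k l m n h.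
(* The vectors [Q], [Q1], [Q2] are orthogonal to [Q] and to [Q1], so the part [x] along the
   conjugates of [Q] and [Q1] is too. *)
have Eq (u v w x y : 'rV[C]_5) t' k' l' : dot u y = 0 -> dot v y = 0 -> dot w y = 0 ->
    t' *: w = k' *: u + l' *: v + x -> dot x y = 0.
  move=> h1 h2 h3 /(congr1 (fun v => dot v y)).
  by rewrite !dotDl !dotZl h1 h2 h3 !mulr0 !add0r.
(* Such an [x] has zero Hermitian norm and vanishes. What is left expresses a multiple of [Q2]
   through [Q] and [Q1], which its product with [Q2] refutes. *)
have Ev (u v x : 'rV[C]_5) k' l' : x = k' *: conjV u + l' *: conjV v -> dot x u = 0 -> dot x v = 0 -> x = 0.
  move=> xE h1 h2; apply: hdot_eq0; rewrite /hdot {2}xE conjVD !conjVZ !conjVK.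
  by rewrite dotDr !dotZr h1 h2 !mulr0 addr0.
have v1 := Eq _ _ _ _ _ _ _ _ (dot_QQ _) (etrans (dotC _ _) (dot_QQ1 _)) (etrans (dotC _ _) (dot_QQ2 _)) h.
have v2 := Eq _ _ _ _ _ _ _ _ (dot_QQ1 _) (dot_Q1Q1 _) (etrans (dotC _ _) (dot_Q1Q2 _)) h.
have E3 (u v w x : 'rV[C]_5) t' k' l' : x = 0 -> t' *: w = k' *: u + l' *: v + x -> t' *: w = k' *: u + l' *: v.
  by move=> ->; rewrite addr0.
have {h v1 v2}h := E3 _ _ _ _ _ _ _ (Ev _ _ _ _ _ erefl v1 v2) h.
have Z0 (k' l' : C) : k' * 0 + l' * 0 = 0 by rewrite !mulr0 addr0.
have h1 := congr1 (fun v => dot v (Q2 p)) h.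
have E2 (u v w : 'rV[C]_5) k' l' : dot (k' *: u + l' *: v) w = k' * dot u w + l' * dot v w.
  by rewrite !dotDl !dotZl.
have h2 := etrans (esym (dotZl _ _ _)) (etrans h1 (E2 _ _ _ _ _)).
rewrite dot_QQ2 dot_Q1Q2 dot_Q2Q2 in h2; have {}h2 := etrans h2 (Z0 _ _).
have n480 : (480 : C) != 0 by rewrite pnatr_eq0.
by move: (mulf_neq0 t0 (mulf_neq0 (mulf_neq0 n480 (expf_neq0 2 z0)) (expf_neq0 2 Wp))); rewrite h2 eqxx.
Qed.

End Jets.

(** * A zero of the coefficient on the real axis *)

Section Concrete.
Context {R : realType}.
Local Notation C := R[i].
Implicit Types (z : C) (p q : plane R).
Variables (x0 : 'rV[R]_5) (c : R).
Let W : set (plane R) := [set p | Dz (zcoord p) != 0].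

Lemma bb_bv z : Dz z != 0 -> bb c z = bv c z.
Proof.
move=> D0; have [z0 m0] := Dz_neq0 D0.
have h : (mz z)^-1 *: c1v c z = (Dz z) ^- 2 *: Pv z + bb c z *: Qv z.
  rewrite Pv_Piv /bb /c1v Dz_mz; move: (be c z) (Piv z) (Qv z) => b u v.
  move: (mz z) m0 => m m0.
  by apply/rowP => j; rewrite !mxE; field; rewrite m0 z0.
have /addrI/eqP := etrans (esym h) (c1_Psi c D0).
by rewrite -subr_eq0 -scalerBl scaler_eq0 (negPf (Qv_neq0 z)) orbF subr_eq0 => /eqP.
Qed.

Lemma bb_eq0 z : Dz z != 0 -> Dz z ^+ 2 * Hv c z = hdot (Pv z) (Qv z) -> bb c z = 0.
Proof.
move=> D0 h; rewrite bb_bv // /bv /hdot dotZl -/(hdot _ _) -h.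
by rewrite mulKf ?expf_neq0 // subrr mul0r.
Qed.

Lemma exists_bb_eq0 : 0 < c -> exists2 p, W p & bb c (zcoord p) = 0.
Proof.
move=> c0.
(* [F] is [D^2 H - <P, Q^*>] on the real axis. *)
pose F : {poly R} := c%:P * 'X^8 * ('X^4 - 'X) ^+ 2 - (2%:P * (
    (1 + 32%:P * 'X^3) * (2^-1)%:P * (1 - 20%:P * 'X^3 - 80%:P * 'X^6)
    + ('X^2 - 2%:P * 'X^5) * (12^-1)%:P * (2^-1)%:P * 'X^8
    + (8%:P * 'X^3 - 5%:P * 'X^6) * (10%:P * 'X^9 - 20%:P * 'X^6 - 8%:P * 'X^3)
    - (6^-1)%:P * 'X^2 * 'X^5) - 15%:P * 'X^4 * (2%:P * 'X^7 + 'X^4)).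
have FE t : F.[t] = c * t ^+ 8 * (t ^+ 4 - t) ^+ 2 - (2 * (
    (1 + 32 * t ^+ 3) / 2 * (1 - 20 * t ^+ 3 - 80 * t ^+ 6)
    + (t ^+ 2 - 2 * t ^+ 5) / 12 * 2^-1 * t ^+ 8
    + (8 * t ^+ 3 - 5 * t ^+ 6) * (10 * t ^+ 9 - 20 * t ^+ 6 - 8 * t ^+ 3)
    - t ^+ 2 / 6 * t ^+ 5) - 15 * t ^+ 4 * (2 * t ^+ 7 + t ^+ 4)).
  by rewrite /F !(hornerD, hornerN, hornerM, hornerC, hornerXn, hornerX, horner_exp); field.
(* At both ends [D] vanishes, so the signs come from [- <P, conj Q>] alone. Being strict, they also
   keep the root away from the ends, where the surface formula is singular. *)
have F0 : F.[0] = -1 by rewrite FE !expr0n /=; field.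
have F1 : 0 < F.[1] by rewrite FE !expr1n; lra.
have [|t /andP[t0 t1] /rootP Ft] := @poly_ivt R F 0 1 ler01.
  by rewrite F0 oppr_le0 ler01 ltW.
have {}t0 : 0 < t.
  by rewrite lt_def t0 andbT; apply/eqP => e; move: Ft; rewrite e F0 => /eqP; rewrite oppr_eq0 oner_eq0.
have {}t1 : t < 1.
  by rewrite lt_def t1 andbT; apply/eqP => e; move: F1; rewrite e Ft ltxx.
have Dt : t ^+ 4 - t != 0.
  by rewrite lt_eqF // subr_lt0 exprSr gtr_pMl // exprn_ilt1 // ltW.
have rN k : (k%:R : R)%:C = k%:R :> C by exact: (rmorph_nat (real_complex R)).
have zE : zcoord (t, 0) = t%:C by [].
have DE : Dz t%:C = (t ^+ 4 - t)%:C by rewrite /Dz rmorphB rmorphXn.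
have D0 : Dz t%:C != 0.
  by rewrite DE; apply: contra Dt => /eqP/(@complexI R) ->.
exists (t, 0) => //=; rewrite zE; apply: bb_eq0 => //.
have zJ : (t%:C : C)^* = t%:C by exact: conjc_real.
rewrite /hdot conjV_Qv zJ.
rewrite dot_nv /Hv zJ DE.
apply/eqP; rewrite -subr_eq0; apply/eqP.
have E (k1 k2 k3 k4 k5 k6 k7 k8 k9 a2 a3 a4 a5 a6 a7 a8 a9 m1 m2 m3 d e : R) :
    (e * a8 * d - (k2 * ((k1 + k3 * a3) * m1 * (k1 - k4 * a3 - k5 * a6)
    + (a2 - k2 * a5) * m2 * m1 * a8 + (k6 * a3 - k7 * a6) * (k8 * a9 - k4 * a6 - k6 * a3)
    - a2 * m3 * a5) - k9 * a4 * (k2 * a7 + a4)))%:C =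
    e%:C * a8%:C * d%:C - (k2%:C * ((k1%:C + k3%:C * a3%:C) * m1%:C * (k1%:C - k4%:C * a3%:C - k5%:C * a6%:C)
    + (a2%:C - k2%:C * a5%:C) * m2%:C * m1%:C * a8%:C
    + (k6%:C * a3%:C - k7%:C * a6%:C) * (k8%:C * a9%:C - k4%:C * a6%:C - k6%:C * a3%:C)
    - a2%:C * m3%:C * a5%:C) - k9%:C * a4%:C * (k2%:C * a7%:C + a4%:C)) :> C.
  by rewrite !(rmorphB (real_complex R), rmorphD (real_complex R), rmorphM (real_complex R)).
rewrite -[RHS]/((0 : R)%:C) -Ft FE; apply: etrans (esym (E _ _ _ _ _ _ _ _ _ _ _ _ _ _ _ _ _ _ _ _ _ _)).
have fV (u : R) : (u^-1)%:C = u%:C^-1 :> C by exact: (fmorphV (real_complex R)).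
have fX (u : R) k : (u ^+ k)%:C = u%:C ^+ k :> C by exact: (rmorphXn (real_complex R)).
by rewrite !fV !fX !rN (rmorph1 (real_complex R)); field.
Qed.

End Concrete.

(** * The surface on the sphere *)

Section Adjoint.
Context {R : realType}.
Local Notation C := R[i].
Implicit Types (z : C) (p q : plane R).
Variables (x0 : 'rV[R]_5) (c : R).
Let W : set (plane R) := [set p | Dz (zcoord p) != 0].

Lemma Psi_Pv z : Dz z != 0 -> Psi z = (Dz z) ^- 2 *: Pv z.
Proof.
move=> D0; have [z0 m0] := Dz_neq0 D0; rewrite /Psi /Pv nvZ /nv Dz_mz.
have E (u1 u2 u3 u4 u5 : 'rV[C]_5) k1 k2 k3 k4 k5 l1 l2 l3 l4 l5 :
    k1 = l1 -> k2 = l2 -> k3 = l3 -> - k4 = l4 -> - k5 = l5 ->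
    k1 *: u1 + k2 *: u2 + k3 *: u3 - k4 *: u4 - k5 *: u5 =
    l1 *: u1 + l2 *: u2 + l3 *: u3 + l4 *: u4 + l5 *: u5.
  by move=> <- <- <- <- <-; rewrite !scaleNr.
apply: E; rewrite -?[z ^+ 3 - 1]/(mz z) -/sqrt30; move: (mz z) m0 (@sqrt30 R) => m m0 k;
  by field; rewrite m0 z0.
Qed.

Let Psi_ p := Psi (zcoord p).
Let phi p := (Dz (zcoord p)) ^- 3 *: Qv (zcoord p).
Let phi1 p := (Dz (zcoord p)) ^- 3 *: Q1v (zcoord p) +
  (- (3 * D1z (zcoord p) / Dz (zcoord p) ^+ 4)) *: Qv (zcoord p).

Lemma smooth_Psi : smoothV W Psi_.
Proof.
have oW : open W := @open_W R; have sz := smoothC_zcoord oW.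
apply: (smoothV_ext oW (F := fun p => (Dz (zcoord p)) ^- 2 *: Pv (zcoord p))).
  by move=> p Wp; rewrite /Psi_ Psi_Pv.
apply: (smoothVZ oW _ (smoothV_Pv oW sz)).
by apply: (smoothCV oW (smoothCX 2 oW (smoothC_Dz oW sz))) => p Wp; exact: expf_neq0.
Qed.

Lemma has_vdz_Psi p : W p -> has_vdz Psi_ p (phi p) 0.
Proof.
move=> Wp; have hz := has_dz_zcoord p; have D2 : Dz (zcoord p) ^+ 2 != 0 := expf_neq0 2 Wp.
have h := has_vdzZ (has_dzV D2 (has_dzX 2 (has_dz_Dz hz))) (has_vdz_Pv hz).
have nE : \forall q \near p, (Dz (zcoord q)) ^- 2 *: Pv (zcoord q) = Psi_ q.
  by apply: (nbhs_eq_on (@open_W R) Wp) => q Wq; rewrite /Psi_ Psi_Pv.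
apply: has_vdz_eq (has_vdz_ext nE h) _ _.
- rewrite /phi Qv_P; have D0 : Dz (zcoord p) != 0 := Wp.
  move: (Pv _) (P1v _) (D1z _) => u v d1; move: (Dz _) D0 => d d0.
  by apply/rowP => j; rewrite !mxE; field.
- by rewrite scaler0 addr0 !mulr0 oppr0 mul0r scale0r.
Qed.

Lemma has_vdz_phi p : W p -> has_vdz phi p (phi1 p) 0.
Proof.
move=> Wp; have hz := has_dz_zcoord p; have D3 : Dz (zcoord p) ^+ 3 != 0 := expf_neq0 3 Wp.
have h := has_vdzZ (has_dzV D3 (has_dzX 3 (has_dz_Dz hz))) (has_vdz_Qv hz).
apply: has_vdz_eq h _ _.
- rewrite /phi1; have D0 : Dz (zcoord p) != 0 := Wp.
  move: (Qv _) (Q1v _) (D1z _) => u v d1; move: (Dz _) D0 => d d0.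
  by apply/rowP => j; rewrite !mxE; field.
- by rewrite scaler0 addr0 !mulr0 oppr0 mul0r scale0r.
Qed.

Lemma has_vdz_phi1 p : W p -> exists phi2, has_vdz phi1 p phi2 0.
Proof.
move=> Wp; have hz := has_dz_zcoord p; have D3 : Dz (zcoord p) ^+ 3 != 0 := expf_neq0 3 Wp.
have D4 : Dz (zcoord p) ^+ 4 != 0 := expf_neq0 4 Wp.
have h1 := has_vdzZ (has_dzV D3 (has_dzX 3 (has_dz_Dz hz))) (has_vdz_Q1v hz).
have h2 := has_vdzZ (has_dzN (has_dzM (has_dzZ 3 (has_dz_D1z hz)) (has_dzV D4 (has_dzX 4 (has_dz_Dz hz)))))
  (has_vdz_Qv hz).
eexists; apply: has_vdz_eq (has_vdzD h1 h2) erefl _.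
have E (u v : 'rV[C]_5) k l m d e f g h : (- (3 * k * 0) / d) *: u + l *: 0 +
    (- (3 * 0 / e + f * (- (4 * h * 0) / g)) *: v + m *: 0) = 0.
  by rewrite !mulr0 oppr0 !mul0r mulr0 addr0 oppr0 !scaler0 !scale0r !addr0.
exact: E.
Qed.

Lemma dot_phi_phi p : dot (phi p) (phi p) = 0.
Proof. by rewrite /phi dotZl dotZr dot_QQ !mulr0. Qed.

Lemma dot_phi_phi1 p : dot (phi p) (phi1 p) = 0.
Proof.
have E (u v : 'rV[C]_5) k l m : dot u u = 0 -> dot u v = 0 -> dot (k *: u) (l *: v + m *: u) = 0.
  by move=> h1 h2; rewrite dotZl dotDr !dotZr h1 h2 !mulr0 addr0 mulr0.
exact: (E _ _ _ _ _ (dot_QQ _) (dot_QQ1 _)).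
Qed.

Lemma dot_phi1_phi1 p : dot (phi1 p) (phi1 p) = 0.
Proof.
have E (u v : 'rV[C]_5) k l : dot u u = 0 -> dot u v = 0 -> dot v v = 0 ->
    dot (k *: u + l *: v) (k *: u + l *: v) = 0.
  by move=> h1 h2 h3; rewrite !(dotDl, dotDr, dotZl, dotZr) (dotC v u) h1 h2 h3 !mulr0 !addr0.
by apply: (E _ _ _ _ (dot_Q1Q1 _) _ (dot_QQ _)); rewrite dotC dot_QQ1.
Qed.

Lemma phi_neq0 p : W p -> phi p != 0.
Proof. by move=> Wp; rewrite scaler_eq0 invr_eq0 (negPf (expf_neq0 3 Wp)) (negPf (Qv_neq0 _)). Qed.

(** Away from 0 and the cube roots of unity [phi = Q / D^3] is null and nowhere zero, so the minimal
    surface is immersed on all of that set. *)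
Lemma domain_xE : domain_x x0 = W.
Proof.
have h p : W p -> immersed_at (minimal_x x0) p.
  move=> Wp; have sx := smooth_surf x0 (@open_W R) smooth_Psi.
  have hx := has_vdz_vdz (has_vdz_surf x0 has_vdz_Psi Wp).
  by apply: (immersed_of_conformal Wp sx); rewrite hx; [exact: phi_neq0|exact: dot_phi_phi].
apply/seteqP; split=> p /=.
  move=> [z0 z1 _]; rewrite /W /= Dz_mz mulf_neq0 //.
  by rewrite /mz subr_eq0.
move=> Wp; have [z0 m0] := Dz_neq0 Wp; split=> //; last exact: h.
by rewrite -subr_eq0.
Qed.

Let a p := bb c (zcoord p) * Dz (zcoord p) ^+ 3.

Lemma smooth_a : smoothC W a.
Proof.
have oW : open W := @open_W R; have sz := smoothC_zcoord oW.
exact: (smoothCM oW (smooth_beta c) (smoothCX 3 oW (smoothC_Dz oW sz))).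
Qed.

(** This is [Al_relation] rescaled: [a = b D^3] because [b Q = a phi], and passing from [Q] to [phi]
    shifts the logarithmic derivative by [- 3 D' / D]. *)
Lemma dz_a p : W p -> dz a p = -1 - hdot (phi1 p) (phi p) / hdot (phi p) (phi p) * a p.
Proof.
move=> Wp; have hz := has_dz_zcoord p.
rewrite (has_dz_dz (has_dzM (has_dz_beta c Wp) (has_dzX 3 (has_dz_Dz hz)))).
have AE : Al c (zcoord p) = - bb c (zcoord p) * (hdot (Q1v (zcoord p)) (Qv (zcoord p)) / rv (zcoord p)).
  have /eqP := Al_relation c Wp; rewrite addr_eq0 => /eqP h.
  by rewrite mulrA mulNr -h mulfK // rv_neq0.
have -> : hdot (phi1 p) (phi p) / hdot (phi p) (phi p) =
   hdot (Q1v (zcoord p)) (Qv (zcoord p)) / rv (zcoord p) - 3 * D1z (zcoord p) / Dz (zcoord p).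
  have E (u v : 'rV[C]_5) k l t : hdot v v != 0 -> t != 0 -> l = t^-1 ^+ 3 ->
      hdot (l *: u + (- (3 * k / t ^+ 4)) *: v) (l *: v) / hdot (l *: v) (l *: v) =
      hdot u v / hdot v v - 3 * k / t.
    rewrite /hdot => v0 t0 lE; have l0 : l != 0 by rewrite lE expf_neq0 // invr_eq0.
    rewrite conjVZ !dotDl !dotZl !dotZr.
    have lJ : l^* != 0 by rewrite conjc_eq0.
    move: (dot u _) (dot v _) v0 (l^*) lJ => d e e0 l' l'0; rewrite lE.
    by field; rewrite e0 t0 l'0.
  apply: (E _ _ _ _ _ (rv_neq0 _) Wp); by rewrite exprVn.
rewrite AE /a; have D0 : Dz (zcoord p) != 0 := Wp.
move: (hdot _ _ / _) (bb _ _) (D1z _) => h b d1; move: (Dz _) D0 => d d0 /=.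
by field.
Qed.

Lemma xh_surf p : W p ->
  toC (xh x0 c (zcoord p)) = toC (surf x0 Psi_ p) + (a p *: phi p + (a p)^* *: conjV (phi p)).
Proof.
move=> Wp; rewrite toC_xh /xhC toC_surf /Psi_ Psi_Pv // (c1_Psi c Wp) -(bb_bv c Wp).
have -> : (a p)^* *: conjV (phi p) = conjV (a p *: phi p) := esym (conjVZ _ _).
have -> : a p *: phi p = bb c (zcoord p) *: Qv (zcoord p).
  by rewrite /a /phi scalerA mulfK // expf_neq0.
have E (u v x : 'rV[C]_5) : x + (u + v + conjV (u + v)) = x + u + conjV u + (v + conjV v).
  by rewrite conjVD; move: (conjV u) (conjV v) => u' v'; apply/rowP => j; rewrite !mxE; ring.
exact: E.
Qed.

(** If the coefficient vanished on a neighbourhood, its zbar-derivative would vanish there as well,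
    against [tau_neq0]. *)
Lemma bb_dense : no_branch c -> W `<=` closure [set p | W p /\ bb c (zcoord p) != 0].
Proof.
move=> nb p Wp B nB; have nW : nbhs p W by exact: (open_nbhs_nbhs (conj (@open_W R) Wp)).
apply: contrapT => h.
have nE : \forall q \near p, 0 = bb c (zcoord q).
  apply: filterS2 nB nW => q Bq Wq; apply: contrapT => b0; apply: h; exists q; split=> //; split=> //.
  by apply/eqP => e; exact: b0.
have /negP := tau_neq0 nb Wp (esym (nbhs_singleton nE)); apply.
by rewrite (has_dz_dzb (has_dz_ext nE (has_dz_cst 0 p))) conjc0.
Qed.

Lemma yfun_adjoint : no_branch c ->
  adjoint (domain_x x0) (fun p => inv_stereo (minimal_x x0 p)) (fun p => yfun x0 c (zcoord p)).
Proof.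
move=> nb; rewrite domain_xE.
have oW : open W := @open_W R.
apply: (surf_adjoint (x0 := x0) (Psi := Psi_) (phi := phi) (phi1 := phi1) (a := a)
  (xhat := fun p => xh x0 c (zcoord p)) oW smooth_Psi has_vdz_Psi has_vdz_phi has_vdz_phi1 _ _ _ phi_neq0
   smooth_a dz_a xh_surf) => [p _|p _|p _|p Wp||].
- exact: dot_phi_phi.
- exact: dot_phi_phi1.
- exact: dot_phi1_phi1.
- by rewrite yfun_stereo //; have [] := Dz_neq0 Wp.
- exact: (smooth_chart x0 c oW (smoothC_zcoord oW)).
- move=> p /(bb_dense nb); apply: closure_subset => q [Wq b0]; split=> //.
  by rewrite mulf_neq0 // expf_neq0.
Qed.

End Adjoint.

(** * Assembling the map on the sphere *)

Section Sphere.
Context {R : realType}.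
Local Notation C := R[i].
Implicit Types (z : C) (p q : plane R).

Lemma Ck_setU k (U V : set (plane R)) f : Ck k U f -> Ck k V f -> Ck k (U `|` V) f.
Proof.
elim: k f => [|k IH] f /=; first by move=> hU hV p [/hU|/hV].
move=> [U1 U2 U3 U4] [V1 V2 V3 V4]; split; [| |exact: IH|exact: IH].
- by move=> p [/U1|/V1].
- by move=> p [/U2|/V2].
Qed.

Lemma conformal_immersion_of_null n (U : set (plane R)) (y : plane R -> 'rV[R]_(n + 1)) :
  smooth_row U y -> (forall p, dot (y p) (y p) = 1) ->
  (forall p, U p -> vdz (fun q => toC (y q)) p != 0 /\
    dot (vdz (fun q => toC (y q)) p) (vdz (fun q => toC (y q)) p) = 0) ->
  conformal_immersion U y.
Proof.
move=> sy y1 hy; split=> // p Up; have [h1 h2] := hy p Up; last exact: h2.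
exact: (immersed_of_conformal Up sy).
Qed.

Variables (x0 : 'rV[R]_5) (c : R).
Hypotheses (c_gt0 : 0 < c) (nb : no_branch c).

(** The value at infinity is the limit of the surface there, as computed by [xt0]. *)
Definition xhat (s : S2 R) : 'rV[R]_(5 + 1) :=
  if s is Some q then yfun x0 c (zcoord q) else inv_stereo x0.

Lemma conformal_chart_z : conformal_immersion setT (fun p => xhat (chart_z p)).
Proof.
have sz := smoothC_zcoord (@openT (plane R)).
apply: conformal_immersion_of_null => [|p|p _]; first exact: (smooth_chart x0 c openT sz).
  exact: dot_yfun.
apply: (chart_vdz x0 (ze := @zcoord R) (a := fun _ => 1) openT sz _ _ nb) => // q _.
exact: has_dz_zcoord.
Qed.

Let U1 : set (plane R) := [set p | zcoord p != 0].
Let U2 : set (plane R) := [set p | mz (zcoord p) != 0].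

Lemma chart_wE1 p : U1 p -> xhat (chart_w p) = yfun x0 c (zcoord p)^-1.
Proof.
by rewrite /U1 /= zcoord_eq0 => p0; rewrite /chart_w (negPf p0) /= zcoord_plane_of.
Qed.

Lemma chart_wE2 p : U2 p -> xhat (chart_w p) = inv_stereo (xt x0 c (zcoord p)).
Proof.
move=> m0; have [p0|p0] := eqVneq p 0.
  by rewrite p0 /chart_w eqxx; have -> : zcoord 0 = 0 :> C by []; rewrite xt0.
have z0 : zcoord p != 0 by rewrite zcoord_eq0.
exact: (etrans (chart_wE1 z0) (etrans (yfun_stereo x0 c (mz_inv z0 m0)) (congr1 (@inv_stereo R 5) (xh_inv x0 c z0 m0)))).
Qed.

Lemma open_U1 : open U1.
Proof. exact: (open_zcoord_neq0 (f := id) (smoothC_zcoord openT)). Qed.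

Lemma open_U2 : open U2.
Proof. exact: (open_zcoord_neq0 (f := mz) (smoothC_mz openT (smoothC_zcoord openT))). Qed.

Lemma smooth_zV : smoothC U1 (fun p => (zcoord p)^-1).
Proof. exact: (smoothCV open_U1 (smoothC_zcoord open_U1)). Qed.

(** Two open sets cover the chart. On the punctured plane the cleared formula in [1/w] handles the
    poles; where [w^3 != 1], in particular at [w = 0], the R^5-valued formula [xt] is smooth. *)
Lemma smooth_chart_w : smooth_row setT (fun p => xhat (chart_w p)).
Proof.
move=> j k; have -> : setT = U1 `|` U2.
  apply/esym/seteqP; split=> // p _; have [z0|z0] := eqVneq (zcoord p) 0; last by left.
  by right; rewrite /U2 /= z0 mz0_neq0.
apply: Ck_setU.
- have h := smooth_chart x0 c open_U1 smooth_zV.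
  by apply: (smooth_ext open_U1 _ (h j)) => p Up; rewrite chart_wE1.
- have h := smooth_inv_stereo open_U2 (smooth_xt x0 c open_U2 (fun p Up => Up)).
  by apply: (smooth_ext open_U2 _ (h j)) => p Up; rewrite chart_wE2.
Qed.

Lemma conformal_chart_w : conformal_immersion setT (fun p => xhat (chart_w p)).
Proof.
apply: conformal_immersion_of_null => [|p|p _]; first exact: smooth_chart_w.
  by have [p0|p0] := eqVneq p 0; [rewrite /chart_w p0 eqxx dot_inv_stereo|
     rewrite chart_wE1 ?dot_yfun // /U1 /= zcoord_eq0].
have [z0|z0] := eqVneq (zcoord p) 0; last first.
  have nE : \forall q \near p, toC (xhat (chart_w q)) = toC (yfun x0 c (zcoord q)^-1).
    by apply: (nbhs_eq_on open_U1 z0) => q Uq; rewrite chart_wE1.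
  rewrite (vdz_ext nE).
  apply: (chart_vdz x0 (a := fun q => - 1 / zcoord q ^+ 2) open_U1 smooth_zV _ _ nb z0) => q Uq.
    have h := has_dzV Uq (has_dz_zcoord q).
    by apply: has_dz_eq h _ _; rewrite // oppr0 mul0r.
  by rewrite mulf_neq0 ?oppr_eq0 ?oner_eq0 // invr_eq0 expf_neq0.
have m0 : U2 p by rewrite /U2 /= z0 mz0_neq0.
have nE : \forall q \near p, toC (xhat (chart_w q)) = toC (inv_stereo (xt x0 c (zcoord q))).
  by apply: (nbhs_eq_on open_U2 m0) => q Uq; rewrite chart_wE2.
have p0 : p = 0 by apply/eqP; rewrite -zcoord_eq0 z0.
rewrite (vdz_ext nE) (has_vdz_vdz (has_vdz_inv_stereo (has_vdz_xt0 x0 c p0))); split.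
  apply: stereo_dz_neq0; apply/eqP => /nv_eq0[_ _ _ /eqP + _].
  rewrite mulf_eq0 invr_eq0 pnatr_eq0 orbF => /eqP/(@complexI R)/eqP.
  by rewrite gt_eqF.
by apply: dot_stereo_dz; rewrite dot_nv !(mul0r, mulr0, addr0).
Qed.

Let W : set (plane R) := [set p | Dz (zcoord p) != 0].

Lemma xhat_stereo p : W p -> xhat (chart_z p) = inv_stereo (xh x0 c (zcoord p)).
Proof. by move=> /Dz_neq0[_ m0]; exact: yfun_stereo. Qed.

Lemma xhat_not_super_conformal : ~ super_conformal setT (fun p => xhat (chart_z p)).
Proof.
move=> [Y [N [s [kappa [fr k0]]]]].
have [p Wp _] := exists_bb_eq0 c_gt0.
(* The point [p] serves only as a point of [W]; density then supplies one where the coefficient is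
   nonzero. *)
have [q [[Wq b0] _]] := bb_dense nb Wp (@filterT _ (nbhs p) _).
have := super_conformal_jet (@open_W R) Wq (smooth_xz x0 c) xhat_stereo fr (A_null x0 c) (k0 q I).
rewrite jet_dot // => /eqP; apply/negP.
have n480 : (480 : C) != 0 by rewrite pnatr_eq0.
have [z0 _] := Dz_neq0 Wq.
exact: (mulf_neq0 (expf_neq0 2 b0) (mulf_neq0 (mulf_neq0 n480 (expf_neq0 2 z0)) (expf_neq0 2 Wq))).
Qed.

Lemma xhat_not_s_willmore : ~ s_willmore setT (fun p => xhat (chart_z p)).
Proof.
move=> [Y [N [s [kappa [fr k0]]]]]; have [p Wp b0] := exists_bb_eq0 c_gt0.
have := s_willmore_jet (@open_W R) Wp (smooth_xz x0 c) xhat_stereo fr (A_null x0 c) (k0 p I).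
case; [exact: (jet_not_umbilic Wp b0)|exact: (jet_not_s_willmore nb Wp b0)].
Qed.

End Sphere.

Theorem proposition8p3 (R : realType) (x0 : 'rV[R]_5) :
  exists xhat : S2 R -> 'rV[R]_(5 + 1),
    [/\ adjoint (domain_x x0) (fun p => inv_stereo (minimal_x x0 p))
          (fun p => xhat (chart_z p)),
        on_S2 (@conformal_immersion R 5) xhat,
        ~ on_S2 (@super_conformal R 5) xhat &
        ~ on_S2 (@s_willmore R 5) xhat].
Proof.
have [c c0 nb] := @exists_no_branch R; exists (xhat x0 c); split.
- exact: yfun_adjoint.
- by split; [exact: conformal_chart_z|exact: conformal_chart_w].
(* A property on the sphere is required in both charts, so failure in the finite chart is enough. *)
- by case=> /(xhat_not_super_conformal c0 nb).
- by case=> /(xhat_not_s_willmore c0 nb).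
Qed.
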